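(* Let $X=X_{\bar 0}\oplus X_{\bar 1}$ be a $\mathbb Z$-superalgebra which is free of finite rank over $\mathbb Z$. Let $DX$ be its Turner double, ${}'DX\supseteq DX$ its divided power version, $T_X=X\oplus X^*$ the trivial extension superalgebra, and $\kappa\colon {}'\mathrm{Sym}(X^* )\to \mathrm{Inv}(X^* )$ the natural isomorphism (all defined in the context). Then: (i) The map $\varphi\colon {}'DX\to \mathrm{Inv}\,T_X$, $\xi\otimes x\mapsto \xi*\kappa(x)$ (for $\xi\in\mathrm{Inv}\,X$, $x\in{}'\mathrm{Sym}(X^* )$), is an isomorphism of superalgebras. (ii) The subalgebra $\varphi(DX)\subseteq \mathrm{Inv}\,T_X$ is generated by $\mathrm{Inv}(X_{\bar 0})$ and all elements of the form $t*1_X^{\otimes d}$ with $t\in T_X$ and $d\ge 0$.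
   Context: Super conventions. $\mathbb Z_2=\{\bar0,\bar1\}$; $R$ denotes a base ring ($\mathbb Z$ or $\mathbb Q$ here). An $R$-superspace is $V=V_{\bar0}\oplus V_{\bar1}$ with both summands free of finite rank over $R$; $\bar v$ is the parity of a homogeneous $v$; formulas with parities are for homogeneous elements, extended linearly. Superalgebras are associative, unital, with parity-compatible product. $V^*=\mathrm{Hom}_R(V,R)$ with its natural $\mathbb Z_2$-grading and $\langle v,\beta\rangle=\langle\beta,v\rangle=\beta(v)$. Put $[u_1,\dots,u_d;w_1,\dots,w_d]=\sum_{1\le a<c\le d}\bar u_c\bar w_a$. Identify $(V_1\otimes\cdots\otimes V_d)^*$ with $V_1^*\otimes\cdots\otimes V_d^*$ by $\langle\beta_1\otimes\cdots\otimes\beta_d,v_1\otimes\cdots\otimes v_d\rangle=(-1)^{[\beta_1,\dots,\beta_d;v_1,\dots,v_d]}\prod_a\langle\beta_a,v_a\rangle$. A tensor product of superalgebras is a superalgebra via $(v_1\otimes\cdots\otimes v_d)(w_1\otimes\cdots\otimes w_d)=(-1)^{[v_1,\dots,v_d;w_1,\dots,w_d]}v_1w_1\otimes\cdots\otimes v_dw_d$. The symmetric group $\mathfrak S_d$ acts on the right on $V^{\otimes d}$ by $(v_1\otimes\cdots\otimes v_d)^g=(-1)^{m}v_{g1}\otimes\cdots\otimes v_{gd}$, $m=\sum_{a<c,\ g^{-1}a>g^{-1}c}\bar v_a\bar v_c$. Invariants. $\mathrm{Inv}^dV=(V^{\otimes d})^{\mathfrak S_d}$, $\mathrm{Inv}\,V=\bigoplus_{d\ge0}\mathrm{Inv}^dV$.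 The shuffle product $*$ on $\bigoplus_d V^{\otimes d}$ is $s*t=\sum_{g}(s\otimes t)^g$ for $s\in V^{\otimes d},t\in V^{\otimes e}$, with $g$ running over shortest coset representatives for $(\mathfrak S_d\times\mathfrak S_e)\backslash\mathfrak S_{d+e}$; it is associative, supercommutative, and preserves $\mathrm{Inv}\,V$. The coproduct $\Delta(v_1\otimes\cdots\otimes v_d)=\sum_{e=0}^d(v_1\otimes\cdots\otimes v_e)\otimes(v_{e+1}\otimes\cdots\otimes v_d)$ restricts to $\mathrm{Inv}\,V\to\mathrm{Inv}\,V\otimes\mathrm{Inv}\,V$; write $\Delta(\xi)=\sum\xi_{(1)}\otimes\xi_{(2)}$. For a superalgebra $X$, $\mathrm{Inv}^dX$ is a subsuperalgebra of $X^{\otimes d}$, and $\mathrm{Inv}\,X$ carries the product which is this one on each $\mathrm{Inv}^dX$ and zero between different $d$ (a locally unital superalgebra); ''superalgebra structure on $\mathrm{Inv}\,T_X$'' means this product. Dual and double. $(\mathrm{Inv}\,X)^*=\bigoplus_d(\mathrm{Inv}^dX)^*$ is a superalgebra with $\langle xy,\xi\rangle=\langle x\otimes y,\Delta(\xi)\rangle$, and an $\mathrm{Inv}\,X$-bimodule by $\langle x\cdot\xi,\eta\rangle=\langle x,\xi\eta\rangle$, $\langle\eta,\xi\cdot x\rangle=\langle\eta\xi,x\rangle$ (actions of $\mathrm{Inv}^dX$ on $(\mathrm{Inv}^eX)^*$ being zero for $d\ne e$). The Turner double is $DX=\mathrm{Inv}\,X\otimes(\mathrm{Inv}\,X)^*$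 with product $$(\xi\otimes x)(\eta\otimes y)=\sum(-1)^{\bar\xi_{(1)}(\bar\xi_{(2)}+\bar\eta+\bar x)+\bar\eta_{(1)}\bar x}\,\xi_{(2)}\eta_{(1)}\otimes(x\cdot\eta_{(2)})(\xi_{(1)}\cdot y).$$ Divided powers. $\mathrm{Sym}\,V$ is the quotient of the tensor superalgebra of $V$ by the ideal generated by $v\otimes u-(v\otimes u)^{(1,2)}$ ($u,v\in V$) and $v\otimes v$ ($v\in V_{\bar1}$). For a $\mathbb Z$-superspace $V$, ${}'\mathrm{Sym}\,V$ is the $\mathbb Z$-subalgebra of $\mathrm{Sym}(V\otimes\mathbb Q)$ generated by all $v^{(m)}=v^m/m!$ ($v\in V_{\bar0}$, $m\ge0$) and all $v\in V_{\bar1}$. The map $\kappa\colon{}'\mathrm{Sym}\,V\to\mathrm{Inv}\,V$ is the algebra isomorphism (for the $*$-product on $\mathrm{Inv}\,V$) with $\kappa(v^{(m)})=v^{\otimes m}$ for $v\in V_{\bar0}$ and $\kappa(v)=v$ for $v\in V_{\bar1}$. The natural map $X^*\to(\mathrm{Inv}\,X)^*$ extends to a superalgebra isomorphism $\mathrm{Sym}(X^* )\cong(\mathrm{Inv}\,X)^*$, used as an identification (also over $\mathbb Q$). Thus ${}'\mathrm{Sym}(X^* )\subseteq(\mathrm{Inv}\,X_{\mathbb Q})^*$, where $X_{\mathbb Q}=X\otimes\mathbb Q$; it is stable under the left and right actions of $\mathrm{Inv}\,X$, so ${}'DX:=\mathrm{Inv}\,X\otimes{}'\mathrm{Sym}(X^*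 )$ is closed under the product $(\xi\otimes x)(\eta\otimes y)=\sum(-1)^{\bar\xi_{(1)}(\bar\xi_{(2)}+\bar\eta+\bar x)+\bar\eta_{(1)}\bar x}\,\xi_{(2)}\eta_{(1)}\otimes(x\cdot\eta_{(2)})(\xi_{(1)}\cdot y)$ in the Turner double $D(X_{\mathbb Q})=\mathrm{Inv}\,X_{\mathbb Q}\otimes(\mathrm{Inv}\,X_{\mathbb Q})^*$ and contains $DX$. Trivial extension. $X^*$ is an $X$-bimodule by $\langle\alpha\cdot a,b\rangle=\langle\alpha,ab\rangle$, $\langle b,a\cdot\alpha\rangle=\langle ba,\alpha\rangle$; $T_X=X\oplus X^*$ with $(a,\alpha)(b,\beta)=(ab,a\cdot\beta+\alpha\cdot b)$. $\mathrm{Inv}\,X$, $\mathrm{Inv}(X_{\bar0})$ and $\mathrm{Inv}(X^* )$ are viewed inside $\bigoplus_d T_X^{\otimes d}$, in which $*$ is taken. *)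

(* Defs.v *)
From HB Require Import structures.
From mathcomp Require Import all_boot all_order all_algebra all_fingroup.
From mathcomp Require Import finmap.
From mathcomp Require Import monalg.

Set Implicit Arguments.
Unset Strict Implicit.
Unset Printing Implicit Defensive.

Import GRing.Theory Num.Theory.

Local Open Scope ring_scope.

(* A free superspace of finite rank is given by a finite set indexing a
   homogeneous basis and by the parities of the basis vectors, so that the same
   record serves over Z and over Q.  Its vectors over R are {ffun V -> R}. *)
Record superspace := Superspace {
  sidx :> finType;
  spar : sidx -> bool
}.

(* Indexed by the dual basis, whose vectors have the parities of the basis. *)
Definition dualsp (V : superspace) : superspace := Superspace (@spar V).

Definition evensp (V : superspace) : superspace :=
  @Superspace {i : V | ~~ spar i} (fun=> false).

Definition sumsp (V W : superspace) : superspace :=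
  @Superspace (V + W)%type
    (fun i => match i with inl j => spar j | inr j => spar j end).

Definition even_vec (R : nzRingType) (V : superspace) (v : {ffun V -> R}) : Prop :=
  forall i, v i != 0 -> ~~ spar i.
Definition odd_vec (R : nzRingType) (V : superspace) (v : {ffun V -> R}) : Prop :=
  forall i, v i != 0 -> spar i.

(* A Z-superalgebra free of finite rank: a ring with a finite homogeneous
   Z-basis; scoordP says that x = \sum_i c_i b_i iff c = scoord x. *)
Record superalgebra := Superalgebra {
  scar :> pzRingType;
  sspace : superspace;
  sbasis : sspace -> scar;
  scoord : scar -> {ffun sspace -> int};
  scoordP : forall (x : scar) (c : {ffun sspace -> int}),
    x = \sum_i sbasis i *~ c i <-> c = scoord x;
  sparM : forall i j k,
    scoord (sbasis i * sbasis j) k != 0 -> spar k = spar i (+) spar j;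
  spar1 : forall k, scoord 1 k != 0 -> ~~ spar k
}.

Arguments scoord {s}.
Arguments sbasis {s}.

Section TrivialExtension.
Variable X : superalgebra.
Local Notation dual := {ffun sspace X -> int}.

Definition vpair (al : dual) (x : X) : int := \sum_k al k * scoord x k.

(* al . a and a . al, where < al . a, b > = < al, a b > and
   < b, a . al > = < b a, al > *)
Definition vract (al : dual) (a : X) : dual :=
  [ffun j => vpair al (a * sbasis j)].
Definition vlact (a : X) (al : dual) : dual :=
  [ffun j => vpair al (sbasis j * a)].

Definition trivext_car : Type := X * dual.
HB.instance Definition _ := GRing.Zmodule.on trivext_car.

Definition trivext_one : trivext_car := (1, 0).
Definition trivext_mul (s t : trivext_car) : trivext_car :=
  (s.1 * t.1, vlact s.1 t.2 + vract s.2 t.1).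

Lemma scoord_sum (x : X) : x = \sum_i sbasis i *~ scoord x i.
Proof. exact/scoordP. Qed.

Lemma scoordD (x y : X) : scoord (x + y) = scoord x + scoord y.
Proof.
apply/esym/scoordP; rewrite {1}[x]scoord_sum {1}[y]scoord_sum -big_split.
by apply: eq_bigr => i _; rewrite ffunE mulrzDr.
Qed.

Lemma scoord0 : scoord (0 : X) = 0.
Proof.
by apply/esym/scoordP; rewrite big1 // => i _; rewrite ffunE mulr0z.
Qed.

Lemma scoordMz (x : X) n : scoord (x *~ n) = scoord x *~ n.
Proof.
apply/esym/scoordP; rewrite {1}[x]scoord_sum mulrz_suml.
by apply: eq_bigr => i _; rewrite ffunMzE -mulrzA mulrzz.
Qed.

Lemma scoord_basis i : scoord (sbasis i : X) = [ffun j => (i == j)%:R].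
Proof.
apply/esym/scoordP; rewrite (bigD1 i) //= ffunE eqxx big1 ?addr0 // => j ne.
by rewrite ffunE eq_sym (negPf ne) mulr0z.
Qed.

Lemma vpairDl al be (x : X) : vpair (al + be) x = vpair al x + vpair be x.
Proof.
by rewrite -big_split; apply: eq_bigr => k _; rewrite ffunE mulrDl.
Qed.

Lemma vpairDr al (x y : X) : vpair al (x + y) = vpair al x + vpair al y.
Proof.
by rewrite -big_split; apply: eq_bigr => k _; rewrite scoordD ffunE mulrDr.
Qed.

Lemma vpair0r al : vpair al 0 = 0.
Proof. by rewrite /vpair big1 // => k _; rewrite scoord0 ffunE mulr0. Qed.

Lemma vpairMz al (x : X) n : vpair al (x *~ n) = vpair al x *~ n.
Proof.
rewrite /vpair mulrz_suml; apply: eq_bigr => k _.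
by rewrite scoordMz ffunMzE mulrzAr.
Qed.

Lemma vpair_sum al (I : finType) (F : I -> X) :
  vpair al (\sum_i F i) = \sum_i vpair al (F i).
Proof. by elim/big_rec2: _ => [|i _ x _ <-]; rewrite ?vpair0r ?vpairDr. Qed.

Lemma vpair_basis al i : vpair al (sbasis i) = al i.
Proof.
rewrite /vpair (bigD1 i) //= scoord_basis ffunE eqxx mulr1 big1 ?addr0 //.
by move=> k ne; rewrite ffunE eq_sym (negPf ne) mulr0.
Qed.

Lemma vpair_inj al be : vpair al =1 vpair be -> al = be.
Proof. by move=> e; apply/ffunP => i; rewrite -!vpair_basis e. Qed.

Lemma vractE al (a b : X) : vpair (vract al a) b = vpair al (a * b).
Proof.
rewrite {2}[b]scoord_sum mulr_sumr vpair_sum; apply: eq_bigr => k _.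
by rewrite ffunE mulrzAr vpairMz -mulrzz.
Qed.

Lemma vlactE al (a b : X) : vpair (vlact a al) b = vpair al (b * a).
Proof.
rewrite {2}[b]scoord_sum mulr_suml vpair_sum; apply: eq_bigr => k _.
by rewrite ffunE mulrzAl vpairMz -mulrzz.
Qed.

Fact trivext_mulA : associative trivext_mul.
Proof.
move=> [a al] [b be] [c ga]; congr pair => /=; first exact: mulrA.
by apply: vpair_inj => x; rewrite !(vpairDl, vractE, vlactE, vpairDr) !mulrA addrA.
Qed.

Fact trivext_mul1l : left_id trivext_one trivext_mul.
Proof.
move=> [a al]; congr pair => /=; first exact: mul1r.
apply: vpair_inj => x; rewrite !(vpairDl, vractE, vlactE) mulr1.
by rewrite {2}/vpair big1 ?addr0 // => k _; rewrite ffunE mul0r.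
Qed.

Fact trivext_mul1r : right_id trivext_one trivext_mul.
Proof.
move=> [a al]; congr pair => /=; first exact: mulr1.
apply: vpair_inj => x; rewrite !(vpairDl, vractE, vlactE) mul1r.
by rewrite {1}/vpair big1 ?add0r // => k _; rewrite ffunE mul0r.
Qed.

Fact trivext_mulDl : left_distributive trivext_mul +%R.
Proof.
move=> [a al] [b be] [c ga]; congr pair => /=; first exact: mulrDl.
by apply: vpair_inj => x;
   rewrite !(vpairDl, vractE, vlactE) mulrDr vpairDr addrACA.
Qed.

Fact trivext_mulDr : right_distributive trivext_mul +%R.
Proof.
move=> [a al] [b be] [c ga]; congr pair => /=; first exact: mulrDr.
by apply: vpair_inj => x;
   rewrite !(vpairDl, vractE, vlactE) mulrDl vpairDr addrACA.
Qed.

HB.instance Definition _ := GRing.Zmodule_isPzRing.Build trivext_car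
  trivext_mulA trivext_mul1l trivext_mul1r trivext_mulDl trivext_mulDr.

Definition trivext_space := sumsp (sspace X) (dualsp (sspace X)).

Definition trivext_basis (i : trivext_space) : trivext_car :=
  match i with
  | inl j => (sbasis j, 0)
  | inr j => (0, [ffun k => (j == k)%:R])
  end.

Definition trivext_coord (t : trivext_car) : {ffun trivext_space -> int} :=
  [ffun i => match i with inl j => scoord t.1 j | inr j => t.2 j end].

Fact trivext_coordP (t : trivext_car) (c : {ffun trivext_space -> int}) :
  t = \sum_i trivext_basis i *~ c i <-> c = trivext_coord t.
Proof.
have fst_mz (u : trivext_car) n : (u *~ n).1 = u.1 *~ n.
  exact: (raddfMz (@fst X dual)).
have snd_mz (u : trivext_car) n : (u *~ n).2 = u.2 *~ n.
  exact: (raddfMz (@snd X dual)).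
have sumE : \sum_i trivext_basis i *~ c i =
    (\sum_i sbasis i *~ c (inl i), [ffun k => c (inr k)]).
  rewrite [LHS]surjective_pairing; congr pair.
    rewrite (raddf_sum (@fst X dual)) big_sumType /= [X in _ + X]big1 ?addr0.
      by apply: eq_bigr => i _; rewrite fst_mz.
    by move=> i _; rewrite fst_mz mul0rz.
  rewrite (raddf_sum (@snd X dual)) big_sumType /= [X in X + _]big1 ?add0r.
    apply/ffunP => k; rewrite sum_ffunE ffunE (bigD1 k) //= snd_mz ffunMzE.
    rewrite ffunE eqxx mulrzz mul1r big1 ?addr0 // => j ne.
    by rewrite snd_mz ffunMzE ffunE (negPf ne) mul0rz.
  by move=> i _; rewrite snd_mz mul0rz.
rewrite sumE; split=> [->|->].
  apply/ffunP => -[j|j]; rewrite ffunE /= ?ffunE //.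
  suff -> : scoord (\sum_i sbasis i *~ c (inl i)) = [ffun i => c (inl i)].
    by rewrite ffunE.
  by apply/esym/scoordP; apply: eq_bigr => i _; rewrite ffunE.
rewrite [LHS]surjective_pairing; congr pair.
  by rewrite {1}[t.1]scoord_sum; apply: eq_bigr => i _; rewrite ffunE.
by apply/ffunP => k; rewrite !ffunE.
Qed.

Fact trivext_parM i j k :
  trivext_coord (trivext_basis i * trivext_basis j) k != 0 ->
  spar k = spar i (+) spar j.
Proof.
rewrite -[_ * _]/(trivext_mul _ _) /trivext_mul ffunE.
have vpair0l (x : X) : vpair 0 x = 0.
  by rewrite /vpair big1 // => l _; rewrite ffunE mul0r.
have vpair_delta l (x : X) : vpair [ffun m => (l == m)%:R] x = scoord x l.
  rewrite /vpair (bigD1 l) //= ffunE eqxx mul1r big1 ?addr0 // => m ne.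
  by rewrite ffunE eq_sym (negPf ne) mul0r.
case: i j k => [i|i] [j|j] [k|k] /=;
  rewrite ?(mulr0, mul0r, scoord0) ?ffunE ?eqxx // ?ffunE ?vpair0l
    ?vpair_delta ?(mulr0, mul0r, scoord0, ffunE) ?addr0 ?add0r ?eqxx //.
- exact: sparM.
- by move/sparM => ->; do 2?case: spar.
- by move/sparM => ->; do 2?case: spar.
Qed.

Fact trivext_par1 k : trivext_coord 1 k != 0 -> ~~ spar k.
Proof.
by rewrite ffunE; case: k => k /=; rewrite ?ffunE ?eqxx //; apply: spar1.
Qed.

Definition trivext : superalgebra := @Superalgebra trivext_car trivext_space
  trivext_basis trivext_coord trivext_coordP trivext_parM trivext_par1.
End TrivialExtension.

(* Tensor algebras: \bigoplus_d V^{\otimes d} over R has the basis of words in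
   the basis of V, the word w1 ... wd standing for w1 \otimes ... \otimes wd.
   The ring product of {malg R[word V]} is the concatenation product.        *)

Definition word (T : choiceType) : Type := seq T.
HB.instance Definition _ (T : choiceType) := Choice.on (word T).

Fact word_unitm (T : choiceType) (u v : word T) :
  u ++ v = [::] -> u = [::] /\ v = [::].
Proof. by case: u. Qed.

HB.instance Definition _ (T : choiceType) :=
  Choice_isMonomialDef.Build (word T)
    (@catA T) (@cat0s T) (@cats0 T) (@word_unitm T).

Notation tens R V := {malg R[word (sidx V)]}.

Definition word_of (T : choiceType) d (w : d.-tuple T) : word T := tval w.

(* T(V) \otimes T(V^* ) *)
Notation tens2 R V := {malg R[(word (sidx V) * word (sidx (dualsp V)))%type]}.

(* R-linear extension of a function defined on the basis K *)
Definition lext (R : nzRingType) (K L : choiceType) (f : K -> {malg R[L]})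
    (s : {malg R[K]}) : {malg R[L]} :=
  \sum_(k <- msupp s) s@_k *: f k.

Definition extQ (K : choiceType) (s : {malg int[K]}) : {malg rat[K]} :=
  \sum_(k <- msupp s) << (s@_k)%:~R *g k >>.

Section Tensors.
Variable R : comNzRingType.

Section OneSpace.
Variable V : superspace.
Implicit Types (d : nat) (s t : tens R V).

Definition tvec (v : {ffun V -> R}) : tens R V :=
  \sum_i << v i *g [:: i] >>.

Definition wpar (w : word V) : nat := (\sum_(i <- w) spar i)%N.

Definition thom (p : bool) t : Prop :=
  forall w, w \in msupp t -> odd (wpar w) = p.

(* [u_1, ..., u_d; w_1, ..., w_d] *)
Definition bracket (U W : superspace) d (u : d.-tuple U) (w : d.-tuple W) : nat :=
  (\sum_(c < d) \sum_(a < d | a < c) spar (tnth u c) * spar (tnth w a))%N.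

Definition act_sign d (w : d.-tuple V) (g : 'S_d) : nat :=
  (\sum_(a < d) \sum_(c < d | (a < c) && ((g^-1)%g c < (g^-1)%g a))
     spar (tnth w a) * spar (tnth w c))%N.

Definition wact d (g : 'S_d) (w : d.-tuple V) : tens R V :=
  << (-1) ^+ act_sign w g *g word_of [tuple tnth w (g a) | a < d] >>.

(* The component of degree d of t, and its image under g. *)
Definition tdeg d t : tens R V := \sum_(w : d.-tuple V) << t@_(word_of w) *g word_of w >>.
Definition tact d (g : 'S_d) t : tens R V :=
  \sum_(w : d.-tuple V) t@_(word_of w) *: wact g w.

(* Inv V: an element is invariant iff all its components are. *)
Definition inv t : Prop := forall d (g : 'S_d), tact g t = tdeg d t.

Definition perm_length d (g : 'S_d) : nat :=
  #|[set ac : 'I_d * 'I_d | (ac.1 < ac.2)%N && (g ac.2 < g ac.1)%N]|.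

Definition young d e : {set 'S_(d + e)} :=
  [set h : 'S_(d + e) | [forall a, (h a < d)%N == (a < d)%N]].

(* In MathComp (h * g)%g maps a to g (h a): the coset of g under the Young
   subgroup acting after g is made of the products (g * h)%g. *)
Definition shortest d e : {set 'S_(d + e)} :=
  [set g : 'S_(d + e) |
    [forall h in young d e, perm_length g <= perm_length (g * h)%g]%N].

Definition wshuffle (u v : word V) : tens R V :=
  \sum_(g in shortest (size u) (size v)) wact g (cat_tuple (in_tuple u) (in_tuple v)).

Definition shuffle s t : tens R V :=
  lext (fun u => lext (wshuffle u) t) s.

(* < u, w > for a word u in the dual basis and a word w *)
Definition wpair d (u : d.-tuple (dualsp V)) (w : d.-tuple V) : R :=
  (-1) ^+ bracket u w * \prod_(a < d) (tnth u a == tnth w a :> V)%:R.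

Definition tpair (x : tens R (dualsp V)) t : R :=
  \sum_(u <- msupp x) \sum_(w : (size u).-tuple V)
     x@_u * t@_(word_of w) * wpair (in_tuple u) w.

(* the element of T(V^* ) of degree d whose pairing with a word w is F w *)
Definition of_form d (F : d.-tuple V -> R) : tens R (dualsp V) :=
  \sum_(w : d.-tuple V) << wpair w w * F w *g word_of w >>.

End OneSpace.

Definition tmap (V W : superspace) (f : V -> W) : tens R V -> tens R W :=
  lext (fun w => << map f w : word W >>).

Definition tprod (V : superspace) (xi : tens R V) (x : tens R (dualsp V)) :
    tens2 R V :=
  \sum_(u <- msupp xi) \sum_(a <- msupp x) << xi@_u * x@_a *g (u, a) >>.

Definition dhom (V : superspace) (p : bool) (z : tens2 R V) : Prop :=
  forall ua, ua \in msupp z -> odd (wpar ua.1 + wpar ua.2)%N = p.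

Section Algebra.
Variable A : superalgebra.
Local Notation V := (sspace A).

(* the product of A^{\otimes d}, zero between different degrees *)
Definition wmul d (u w : d.-tuple V) : tens R V :=
  \sum_(k : d.-tuple V)
    << (-1) ^+ bracket u w *
       \prod_(a < d)
         (scoord (sbasis (tnth u a) * sbasis (tnth w a)) (tnth k a))%:~R
       *g word_of k >>.

Definition tmul (s t : tens R V) : tens R V :=
  \sum_(u <- msupp s) \sum_(w : (size u).-tuple V)
     (s@_u * t@_(word_of w)) *: wmul (in_tuple u) w.

(* x . xi and xi . x, where < x . xi, eta > = < x, xi eta > and
   < eta, xi . x > = < eta xi, x >.  These formulas define an action on all of
   T(V^* ), which induces the action of Inv on the quotient (Inv)^* because Inv
   is closed under the product. *)
Definition tract (x : tens R (dualsp V)) (xi : tens R V) : tens R (dualsp V) :=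
  lext (fun u : word (dualsp V) => of_form (fun w : (size u).-tuple V =>
          tpair << u >> (tmul xi << word_of w >>))) x.
Definition tlact (xi : tens R V) (x : tens R (dualsp V)) : tens R (dualsp V) :=
  lext (fun u : word (dualsp V) => of_form (fun w : (size u).-tuple V =>
          tpair << u >> (tmul << word_of w >> xi))) x.

(* the terms of the coproduct of the word u *)
Definition deconc (u : word V) : seq (word V * word V) :=
  [seq (take i u, drop i u) | i <- iota 0 (size u).+1].

(* (u \otimes a) (w \otimes b) in the Turner double, with s = (u_(1), u_(2)) and
   r = (w_(1), w_(2)).  The product of (Inv)^* is induced by the concatenation
   product of T(V^* ), both being dual to the deconcatenation coproduct. *)
Definition wdmul (ua wb : word V * word (dualsp V)) : tens2 R V :=
  let: (u, a) := ua in let: (w, b) := wb in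
  \sum_(s <- deconc u) \sum_(r <- deconc w)
    (-1) ^+ (wpar s.1 * (wpar s.2 + wpar w + wpar a) + wpar r.1 * wpar a)%N *:
    tprod (tmul << s.2 >> << r.1 >>)
          (tract << a >> << r.2 >> * tlact << s.1 >> << b >>).

Definition dmul (z z' : tens2 R V) : tens2 R V :=
  lext (fun ua => lext (wdmul ua) z') z.

End Algebra.
End Tensors.

(* A superring presented as a subset of an abelian group, closed under the
   product, modulo a congruence; rhom p holds of representatives of homogeneous
   elements of parity p. *)
Record superring := SuperRing {
  ramb :> zmodType;
  rmem : ramb -> Prop;
  req : ramb -> ramb -> Prop;
  rmul : ramb -> ramb -> ramb;
  rhom : bool -> ramb -> Prop
}.

Arguments rmem : clear implicits.
Arguments req : clear implicits.
Arguments rmul : clear implicits.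
Arguments rhom : clear implicits.

Record superring_iso (A B : superring) (f : A -> B) : Prop := SuperringIso {
  iso_mem : forall x, rmem A x -> rmem B (f x);
  iso_sub : forall x y, rmem A x -> rmem A y -> req B (f (x - y)) (f x - f y);
  iso_inj : forall x y, rmem A x -> rmem A y ->
    (req A x y <-> req B (f x) (f y));
  iso_surj : forall y, rmem B y -> exists2 x, rmem A x & req B (f x) y;
  iso_closed : forall x y, rmem A x -> rmem A y -> rmem A (rmul A x y);
  iso_mul : forall x y, rmem A x -> rmem A y ->
    req B (f (rmul A x y)) (rmul B (f x) (f y));
  iso_hom : forall p x, rmem A x -> rhom A p x -> rhom B p (f x)
}.

Inductive zspan (M : zmodType) (G : M -> Prop) : M -> Prop :=
| zspan_gen x of G x : zspan G x
| zspan0 : zspan G 0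
| zspanB x y of zspan G x & zspan G y : zspan G (x - y).

Inductive zalg (M : zmodType) (mul : M -> M -> M) (G : M -> Prop) : M -> Prop :=
| zalg_gen x of G x : zalg mul G x
| zalg0 : zalg mul G 0
| zalgB x y of zalg mul G x & zalg mul G y : zalg mul G (x - y)
| zalgM x y of zalg mul G x & zalg mul G y : zalg mul G (mul x y).

(* Sym V is T(V) modulo sym_ideal. *)
Inductive sym_ideal (R : comNzRingType) (V : superspace) : tens R V -> Prop :=
| sym_comm (v u : {ffun V -> R}) :
    sym_ideal (tvec v * tvec u -
               tact (tperm ord0 ord_max : 'S_2) (tvec v * tvec u))
| sym_odd (v : {ffun V -> R}) of odd_vec v : sym_ideal (tvec v * tvec v)
| symB x y of sym_ideal x & sym_ideal y : sym_ideal (x - y)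
| symMl a x of sym_ideal x : sym_ideal (a * x)
| symMr a x of sym_ideal x : sym_ideal (x * a).

Definition divpow (V : superspace) (v : {ffun V -> int}) (m : nat) : tens rat V :=
  (m`!%:R)^-1 *: extQ (tvec v) ^+ m.

Inductive dsym_gen (V : superspace) : tens rat V -> Prop :=
| dsym_even (v : {ffun V -> int}) m of even_vec v : dsym_gen (divpow v m)
| dsym_odd (v : {ffun V -> int}) of odd_vec v : dsym_gen (extQ (tvec v))
| dsym_ideal x of sym_ideal x : dsym_gen x.

(* the preimage of 'Sym V under the projection of T(V_Q) onto Sym(V_Q) *)
Definition dsym (V : superspace) : tens rat V -> Prop := zalg *%R (@dsym_gen V).

Definition dsym_ring (V : superspace) : superring :=
  SuperRing (@dsym V) (fun x y => sym_ideal (x - y)) *%R (@thom rat V).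

Definition inv_shuffle_ring (V : superspace) : superring :=
  SuperRing (@inv int V) eq (@shuffle int V) (@thom int V).

Definition inv_ring (A : superalgebra) : superring :=
  SuperRing (@inv int (sspace A)) eq (@tmul int A) (@thom int (sspace A)).

Definition is_kappa (V : superspace) (kappa : tens rat V -> tens int V) : Prop :=
  [/\ superring_iso (A := dsym_ring V) (B := inv_shuffle_ring V) kappa,
      forall v m, even_vec v -> kappa (divpow v m) = tvec v ^+ m &
      forall v, odd_vec v -> kappa (extQ (tvec v)) = tvec v].

Lemma kappa_unique (V : superspace) (k k' : tens rat V -> tens int V) :
  is_kappa k -> is_kappa k' -> forall x, dsym x -> k x = k' x.
Proof.
move=> [isok evk oddk] [isok' evk' oddk'].
have d0 : dsym (0 : tens rat V) by exact: zalg0.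
have z0 f : superring_iso (A := dsym_ring V) (B := inv_shuffle_ring V) f ->
    f 0 = 0.
  by move=> isof; have := iso_sub isof d0 d0; rewrite /= !subrr.
have ideal0 f : superring_iso (A := dsym_ring V) (B := inv_shuffle_ring V) f ->
    forall x, sym_ideal x -> f x = 0.
  move=> isof x Ix; rewrite -(z0 f isof); apply/(iso_inj isof) => //.
    by apply: zalg_gen; apply: dsym_ideal.
  by rewrite /= subr0.
move=> x; elim=> {x} [x [v m ev|v od|y Iy]||x y dx IHx dy IHy|x y dx IHx dy IHy].
- by rewrite evk ?evk'.
- by rewrite oddk ?oddk'.
- by rewrite !ideal0.
- by rewrite !z0.
- by rewrite (iso_sub isok dx dy) (iso_sub isok' dx dy) IHx IHy.
- by rewrite (iso_mul isok dx dy) (iso_mul isok' dx dy) IHx IHy.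
Qed.

Section Double.
Variable X : superalgebra.
Local Notation V := (sspace X).

(* the preimage of (Inv X)^* under T(X_Q^* ) -> (Inv X_Q)^* *)
Definition inv_dual (x : tens rat (dualsp V)) : Prop :=
  forall eta : tens int V, inv eta -> tpair x (extQ eta) \is a Num.int.

(* (id \otimes < - , eta >) z *)
Definition contract (z : tens2 rat V) (eta : tens rat V) : tens rat V :=
  lext (fun ua : word V * word (dualsp V) =>
          tpair << ua.2 >> eta *: << ua.1 >>) z.

(* Equality of the images in T(X_Q) \otimes (Inv X_Q)^*, which contains
   Inv X_Q \otimes (Inv X_Q)^*. *)
Definition double_eq (z z' : tens2 rat V) : Prop :=
  forall eta : tens rat V, inv eta -> contract z eta = contract z' eta.

(* Inv X \otimes S in Inv X_Q \otimes (Inv X_Q)^*, where S is the preimage in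
   T(X_Q^* ) of a subgroup of (Inv X_Q)^* = T(X_Q^* ) / (Inv X_Q)^\perp *)
Definition double_of (S : tens rat (dualsp V) -> Prop) : tens2 rat V -> Prop :=
  zspan (fun z => exists (xi : tens int V) (x : tens rat (dualsp V)),
           [/\ inv xi, S x & z = tprod (extQ xi) x]).

Definition turner_double : superring :=
  SuperRing (double_of inv_dual) double_eq (@dmul rat X) (@dhom rat V).
Definition dturner_double : superring :=
  SuperRing (double_of (@dsym (dualsp V))) double_eq (@dmul rat X) (@dhom rat V).

Local Notation VT := (sspace (trivext X)).

Definition in_X : tens int V -> tens int VT := tmap (inl : V -> VT).
Definition in_dual : tens int (dualsp V) -> tens int VT :=
  tmap (inr : dualsp V -> VT).
Definition in_even : tens int (evensp V) -> tens int VT :=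
  tmap (fun i : evensp V => inl (val i) : VT).

Definition trivext_in (a : X) : trivext X := (a, 0).

Definition is_phi (kappa : tens rat (dualsp V) -> tens int (dualsp V))
    (phi : dturner_double -> inv_ring (trivext X)) : Prop :=
  forall (xi : tens int V) (x : tens rat (dualsp V)), inv xi -> dsym x ->
    phi (tprod (extQ xi) x) = shuffle (in_X xi) (in_dual (kappa x)).

Lemma phi_unique kappa kappa' phi phi' :
  is_kappa kappa -> is_kappa kappa' ->
  is_phi kappa phi -> is_phi kappa' phi' ->
  superring_iso phi -> superring_iso phi' ->
  forall z, rmem dturner_double z -> phi z = phi' z.
Proof.
move=> kk kk' pp pp' isop isop'.
have d0 : rmem dturner_double 0 by exact: zspan0.
move=> z; elim=> {z} [z [xi [x [xiP xP ->]]]||x y dx IHx dy IHy].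
- rewrite (pp xi x xiP xP) (pp' xi x xiP xP) (kappa_unique kk kk' xP).
  reflexivity.
- have := iso_sub isop d0 d0; have := iso_sub isop' d0 d0.
  by rewrite /= !subrr => -> ->.
- by rewrite (iso_sub isop dx dy) (iso_sub isop' dx dy) IHx IHy.
Qed.

Inductive double_gen : inv_ring (trivext X) -> Prop :=
| gen_even s of inv s : double_gen (in_even s)
| gen_shuffle (t : trivext X) d :
    double_gen (shuffle (tvec (scoord t))
                        (tvec (scoord (trivext_in 1)) ^+ d)).
End Double.

(* Main.v *)
Require Import Defs.
From HB Require Import structures.
From mathcomp Require Import all_boot all_order all_algebra monalg.
From mathcomp Require Import all_fingroup finmap zify.

(** Words in the basis of V are a basis of the tensor algebra, and everything is
    done there, over the rationals.  The central object is the symmetrization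
    sym, which inserts the letters of a word one after the other in all places,
    with signs; it is the signed sum over all permutations (sum_wa).

    - Invariance under the symmetric groups is invariance under signed swaps of
      neighbours (inv_sinv).  On invariants of degree n, sym is multiplication by
      n! (cf_sym_sinv); so dividing by n!, which is nrm, is a section of sym over
      the invariants, and a map that is insensitive to signed swaps factors
      through sym (swapping_sym).
    - The kernel of sym is the ideal defining the symmetric algebra
      (sym_ideal_sym, sym_eq0_ideal), and also the annihilator of the invariants
      of the dual space (pr_perp).  Hence sym x describes at the same time the
      class of x in the symmetric algebra and in the dual of the invariants.
    - Concatenation becomes the shuffle product: the shuffle of sym x and sym y
      is sym (x y) (shf_sym), because the permutations are the products of
      shortest coset representatives and of permutations of the two blocks.

    So kappa is sym.  Over the integers, the integral invariants are the integral
    combinations of the orbit sums of sorted words (sinv_span), and an orbit sum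
    is the symmetrization of a monomial in divided powers.  This identifies the
    divided power algebra with the elements having integral symmetrization
    (dsymP) and the integral dual of the invariants with the classes of integral
    tensors (inv_dualP).

    Part (i).  The map phi is (xi, x) |-> sym ((xi / n!) x), which is Phi.  The
    actions of X on its dual are products of the trivial extension, in all tensor
    powers (of_tract, of_tlact), while products of two dual vectors vanish.
    Moreover symmetrization commutes with products by invariants (sym_tml,
    sym_tmr).  So, in the product of Phi xi a and Phi eta y, one factor can be
    replaced by the single tensor of a followed by xi / n!; the letters of a then
    meet letters of X in eta (tm_iD_Phi), and the letters of xi meet the other
    letters of eta and those of y (tm_split).  These splittings are the two
    coproducts of the product of the double (Phi_mul).  Injectivity holds because
    the coefficient of Phi xi y at a word of X followed by a word of the dual is a
    product of two coefficients (cf_Phi), and surjectivity follows by taking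
    sorted words in which the letters of X come first (phiQ_surj).  The product
    preserves integrality because the coproduct of an integral invariant is an
    integral combination of products of orbit sums (dsum_span).

    Part (ii).  The image of the double is spanned by symmetrizations of products
    of divided powers of even basis vectors of X and of arbitrary letters
    t_1, ..., t_r.  Allow also a divided power of 1 as a factor.  Multiplication
    by the generator t * 1^n, in degree n + 1, is the derivation that multiplies
    one factor by t (tm_gone).  Applied to a product with the divided power
    1^(l+1), it produces one more letter t next to 1^(l), and two kinds of error
    terms: those in which t is multiplied into some t_i, with fewer letters, and
    those in which it is multiplied into another divided power, with as many
    letters but fewer factors from the divided powers.  Induction on both numbers
    gives the claim (generation); without letters t_i, the element is an invariant
    of the even part.  The converse inclusion is a computation on the generators
    (image_even, image_shuffle). *)

Set Implicit Arguments.
Unset Strict Implicit.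
Unset Printing Implicit Defensive.

Import GRing.Theory Num.Theory.
Local Open Scope ring_scope.

(** * Linear maps out of free modules *)

Lemma sum_exchange (M : nmodType) (I J : Type) (r : seq I) (s : seq J) (F : I -> J -> M) :
  \sum_(i <- r) \sum_(j <- s) F i j = \sum_(j <- s) \sum_(i <- r) F i j.
Proof. exact: exchange_big. Qed.

Section Linear.
Variable R : comNzRingType.

Definition islin (U W : lmodType R) (F : U -> W) :=
  forall a x y, F (a *: x + y) = a *: F x + F y.

Section Closure.
Variables U W : lmodType R.
Implicit Types F G : U -> W.

Lemma islin0 F : islin F -> F 0 = 0.
Proof. by move=> lF; have := lF 1 0 0; rewrite !scale1r addr0 -[LHS]addr0 => /addrI. Qed.

Lemma islinZ F : islin F -> forall a x, F (a *: x) = a *: F x.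
Proof. by move=> lF a x; rewrite -[a *: x]addr0 lF islin0 // addr0. Qed.

Lemma islinD F : islin F -> {morph F : x y / x + y}.
Proof. by move=> lF x y; rewrite -[x]scale1r lF !scale1r. Qed.

Lemma islinB F : islin F -> {morph F : x y / x - y}.
Proof. by move=> lF x y; rewrite islinD // -!scaleN1r islinZ. Qed.

Lemma islin_sum F : islin F -> forall (I : Type) (r : seq I) (p : pred I) (X : I -> U),
  F (\sum_(i <- r | p i) X i) = \sum_(i <- r | p i) F (X i).
Proof.
move=> lF I r p X; elim/big_rec2: _ => [|i y x _ <-]; first exact: islin0.
exact: islinD.
Qed.

Lemma lin_id : islin (fun x : U => x). Proof. by []. Qed.

Lemma lin_cst0 : islin (fun _ : U => 0 : W).
Proof. by move=> a x y; rewrite scaler0 addr0. Qed.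

Lemma lin_add F G : islin F -> islin G -> islin (fun x => F x + G x).
Proof. by move=> lF lG a x y; rewrite lF lG scalerDr addrACA. Qed.

Lemma lin_scale c F : islin F -> islin (fun x => c *: F x).
Proof. by move=> lF a x y; rewrite lF scalerDr !scalerA mulrC. Qed.

Lemma lin_opp F : islin F -> islin (fun x => - F x).
Proof. by move=> lF a x y; rewrite lF opprD scalerN. Qed.

Lemma lin_sum (I : Type) (r : seq I) (p : pred I) (F : I -> U -> W) :
  (forall i, islin (F i)) -> islin (fun x => \sum_(i <- r | p i) F i x).
Proof.
move=> lF a x y; rewrite scaler_sumr -big_split; apply: eq_bigr => i _.
exact: lF.
Qed.

End Closure.

Lemma lin_app (U W W' : lmodType R) (f : W -> W') (F : U -> W) :
  islin f -> islin F -> islin (fun x => f (F x)).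
Proof. by move=> lf lF a x y; rewrite lF lf. Qed.

Lemma malg_scaleU (K : choiceType) (a b : R) (k : K) :
  a *: << b *g k >> = << a * b *g k >> :> {malg R[K]}.
Proof. by apply/malgP => l; rewrite mcoeffZ !mcoeffU mulrnAr. Qed.

Lemma malgUE (K : choiceType) (a : R) (k : K) :
  << a *g k >> = a *: << k >> :> {malg R[K]}.
Proof. by rewrite malg_scaleU mulr1. Qed.

Lemma malg_sum (K : choiceType) (x : {malg R[K]}) :
  x = \sum_(k <- msupp x) x@_k *: << k >>.
Proof. by rewrite {1}[x]monalgE; apply: eq_bigr => k _; rewrite malgUE. Qed.

Lemma lin_eq (K : choiceType) (W : lmodType R) (F G : {malg R[K]} -> W) :
  islin F -> islin G -> (forall k, F << k >> = G << k >>) -> F =1 G.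
Proof.
move=> lF lG FG x; rewrite [x]malg_sum !islin_sum //.
by apply: eq_bigr => k _; rewrite !islinZ // FG.
Qed.

Section LinearExtension.
Variables (K : choiceType) (W : lmodType R) (f : K -> W).

Definition malg_lin (s : {malg R[K]}) : W := \sum_(k <- msupp s) s@_k *: f k.

Lemma malg_linEw (D : {fset K}) s : (msupp s `<=` D)%fset ->
  malg_lin s = \sum_(k <- D) s@_k *: f k.
Proof.
move=> sD; rewrite /malg_lin (big_fsetID _ (mem (msupp s)) D) /=.
rewrite [X in _ = _ + X]big1_fset ?addr0 => [|k].
  apply: eq_fbigl => k; rewrite !inE andbC.
  by case: (boolP (k \in msupp s)) => //= ks; rewrite (fsubsetP sD).
by rewrite !inE /= => /andP [_ ks] _; rewrite mcoeff_outdom // scale0r.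
Qed.

Lemma lin_malg_lin : islin malg_lin.
Proof.
move=> a x y; pose D := (msupp x `|` msupp y)%fset.
have sx : (msupp x `<=` D)%fset by apply: fsubsetUl.
have sy : (msupp y `<=` D)%fset by apply: fsubsetUr.
rewrite (malg_linEw sx) (malg_linEw sy) (@malg_linEw D) => [|].
  rewrite scaler_sumr -big_split; apply: eq_bigr => k _.
  by rewrite mcoeffD mcoeffZ scalerDl scalerA.
apply: fsubset_trans (msuppD_le _ _) _; rewrite fsubUset sy andbT.
exact: fsubset_trans (msuppZ_le _ _) sx.
Qed.

Lemma malg_linU k : malg_lin << k >> = f k.
Proof.
by rewrite (@malg_linEw [fset k]%fset) ?msuppU_le // big_seq_fset1 mcoeffUU scale1r.
Qed.
End LinearExtension.

Lemma lin_lext (K L : choiceType) (f : K -> {malg R[L]}) : islin (lext f).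
Proof. exact: lin_malg_lin. Qed.

Lemma lextU (K L : choiceType) (f : K -> {malg R[L]}) k : lext f << k >> = f k.
Proof. exact: malg_linU. Qed.

Lemma lin_coef (K : choiceType) (k : K) :
  islin (fun x : {malg R[K]} => x@_k : R^o).
Proof. by move=> a x y; rewrite mcoeffD mcoeffZ. Qed.

Lemma lin_lext_lextr (K L M : choiceType) (f : K -> L -> {malg R[M]}) x :
  islin (fun y => lext (fun k => lext (f k) y) x).
Proof.
move=> a y z; move: x; apply: lin_eq.
- exact: lin_lext.
- by apply: lin_add; [apply: lin_scale|]; exact: lin_lext.
by move=> k; rewrite !lextU lin_lext.
Qed.

End Linear.

Section MalgAlgebra.
Variables (R : comNzRingType) (K : monomType).
Implicit Types x y : {malg R[K]}.

Lemma malgMUU (k l : K) : << k >> * << l >> = << mmul k l >> :> {malg R[K]}.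
Proof. by rewrite malgM_def fgmulUU mulr1. Qed.

Lemma malg_scalerAr (c : R) x y : c *: (x * y) = x * (c *: y).
Proof.
have xc : x * c%:MP = c *: x.
  rewrite malgM_def fgmulgU [in RHS](malg_sum x) scaler_sumr.
  by apply: eq_bigr => k _; rewrite mulm1 malgUE scalerA mulrC.
by rewrite scalerAl -xc -mulrA mul_malgC.
Qed.

End MalgAlgebra.

(** * The tensor algebra on words *)

Definition tcopy (R : comNzRingType) (V : superspace) : Type := tens R V.
Section TC.
Variables (R : comNzRingType) (V : superspace).
HB.instance Definition _ := GRing.NzRing.on (tcopy R V).
HB.instance Definition _ := GRing.Lalgebra.on (tcopy R V).
HB.instance Definition _ :=
  GRing.Lalgebra_isAlgebra.Build R (tcopy R V) (@malg_scalerAr R (word V)).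
End TC.

(** An algebra isomorphic to the tensor algebra and known only through its
    structure maps, so that its elements never unfold to finitely supported
    functions. *)
Record tens_copy (R : comNzRingType) (V : superspace) := TensCopy {
  tcar : algType R;
  tof : tens R V -> tcar;
  tto : tcar -> tens R V;
  tofK : cancel tof tto;
  ttoK : cancel tto tof;
  tof_lin : islin tof;
  tof_mul : {morph tof : x y / x * y};
  tof_one : tof 1 = 1
}.

Fact tens_copy_exists (R : comNzRingType) (V : superspace) : tens_copy R V.
Proof. by exists (tcopy R V) (fun x : tens R V => x : tcopy R V) (fun x : tcopy R V => x : tens R V). Qed.

Definition T (R : comNzRingType) (V : superspace) : algType R :=
  tcar (tens_copy_exists R V).

Section Interface.
Variables (R : comNzRingType) (V : superspace).
Local Notation T := (T R V).
Implicit Types (i j : V) (u v w : seq V) (x y z : T).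

Definition of_tens : tens R V -> T := @tof R V (tens_copy_exists R V).
Definition to_tens : T -> tens R V := @tto R V (tens_copy_exists R V).

Lemma of_tensK : cancel of_tens to_tens. Proof. exact: tofK. Qed.
Lemma to_tensK : cancel to_tens of_tens. Proof. exact: ttoK. Qed.
Lemma lin_of : islin of_tens. Proof. exact: tof_lin. Qed.
Lemma of_tensZ a (x : tens R V) : of_tens (a *: x) = a *: of_tens x.
Proof. exact: (islinZ lin_of). Qed.
Lemma of_tens0 : of_tens 0 = 0.
Proof. exact: (islin0 lin_of). Qed.
Lemma of_tensB (x y : tens R V) : of_tens (x - y) = of_tens x - of_tens y.
Proof. exact: (islinB lin_of). Qed.
Lemma of_tens_sum (I : Type) (r : seq I) (p : pred I) (F : I -> tens R V) :
  of_tens (\sum_(k <- r | p k) F k) = \sum_(k <- r | p k) of_tens (F k).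
Proof. exact: (islin_sum lin_of). Qed.
Lemma of_tensM : {morph of_tens : x y / x * y}. Proof. exact: tof_mul. Qed.
Lemma of_tens1 : of_tens 1 = 1. Proof. exact: tof_one. Qed.

Lemma lin_to : islin to_tens.
Proof. by move=> a x y; apply: (can_inj of_tensK); rewrite lin_of !to_tensK. Qed.
Lemma to_tensZ a x : to_tens (a *: x) = a *: to_tens x.
Proof. exact: (islinZ lin_to). Qed.
Lemma to_tens0 : to_tens 0 = 0.
Proof. exact: (islin0 lin_to). Qed.
Lemma to_tensB x y : to_tens (x - y) = to_tens x - to_tens y.
Proof. exact: (islinB lin_to). Qed.

Definition mon w : T := of_tens << (w : word V) >>.
Definition let1 i : T := mon [:: i].
Definition cf x w : R := (to_tens x)@_(w : word V).

Lemma cfP x y : (forall w, cf x w = cf y w) -> x = y.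
Proof. by move=> xy; apply: (can_inj to_tensK); apply/malgP. Qed.

Lemma lin_cf w : islin (fun x => cf x w : R^o).
Proof. exact: (lin_app (lin_coef (w : word V)) lin_to). Qed.

Lemma cf0 w : cf 0 w = 0. Proof. exact: (islin0 (lin_cf w)). Qed.
Lemma cfD x y w : cf (x + y) w = cf x w + cf y w.
Proof. exact: (islinD (lin_cf w)). Qed.
Lemma cfZ a x w : cf (a *: x) w = a * cf x w.
Proof. exact: (islinZ (lin_cf w)). Qed.
Lemma cfB x y w : cf (x - y) w = cf x w - cf y w.
Proof. exact: (islinB (lin_cf w)). Qed.
Lemma cf_sum (I : Type) (r : seq I) (p : pred I) (F : I -> T) w :
  cf (\sum_(i <- r | p i) F i) w = \sum_(i <- r | p i) cf (F i) w.
Proof. exact: (islin_sum (lin_cf w)). Qed.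

Lemma cf_mon w w' : cf (mon w) w' = (w == w')%:R.
Proof. by rewrite /cf of_tensK mcoeffU1. Qed.

Lemma monM u v : mon u * mon v = mon (u ++ v).
Proof. by rewrite /mon -of_tensM malgMUU. Qed.

Lemma mon0 : mon [::] = 1. Proof. exact: of_tens1. Qed.

Lemma mon_cons i w : mon (i :: w) = let1 i * mon w.
Proof. by rewrite monM. Qed.

Definition supp x : seq (seq V) := msupp (to_tens x).

Lemma supp_uniq x : uniq (supp x). Proof. exact: fset_uniq. Qed.
Lemma mem_supp x w : (w \in supp x) = (cf x w != 0).
Proof. by rewrite /cf mcoeff_neq0. Qed.

Lemma tens_sum x : x = \sum_(w <- supp x) cf x w *: mon w.
Proof.
rewrite -{1}[x]to_tensK (malg_sum (to_tens x)) (islin_sum lin_of).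
by apply: eq_bigr => w _; rewrite (islinZ lin_of).
Qed.

Lemma tens_eq (W : lmodType R) (F G : T -> W) :
  islin F -> islin G -> (forall w, F (mon w) = G (mon w)) -> F =1 G.
Proof.
move=> lF lG FG x; rewrite [x]tens_sum !islin_sum //.
by apply: eq_bigr => w _; rewrite !islinZ // FG.
Qed.

Section LinExt.
Variables (W : lmodType R) (f : seq V -> W).

Definition linx : T -> W := locked (fun x => \sum_(w <- supp x) cf x w *: f w).

Lemma linxE x : linx x = \sum_(w <- supp x) cf x w *: f w.
Proof. by rewrite /linx -lock. Qed.

Lemma linxEw (D : seq (seq V)) x : uniq D -> {subset supp x <= D} ->
  linx x = \sum_(w <- D) cf x w *: f w.
Proof.
move=> uD sD; rewrite linxE [RHS](bigID (mem (supp x))) /= [X in _ = _ + X]big1 ?addr0.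
  rewrite -[RHS]big_filter; apply: perm_big; apply: uniq_perm.
  - exact: supp_uniq.
  - exact: filter_uniq.
  by move=> w; rewrite mem_filter; case: (boolP (w \in supp x)) => // /sD ->.
by move=> w; rewrite mem_supp negbK => /eqP ->; rewrite scale0r.
Qed.

Lemma lin_linx : islin linx.
Proof.
move=> a x y; pose D := undup (supp x ++ supp y).
have uD : uniq D by exact: undup_uniq.
rewrite !(linxEw uD) => [|w|w|w]; rewrite ?mem_undup ?mem_cat.
- rewrite scaler_sumr -big_split; apply: eq_bigr => k _.
  by rewrite cfD cfZ scalerDl scalerA.
- by move=> ->; rewrite orbT.
- by move=> ->.
rewrite !mem_supp cfD cfZ; apply: contraR; rewrite negb_or !negbK.
by case/andP => /eqP -> /eqP ->; rewrite mulr0 addr0.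
Qed.

Lemma linx_mon w : linx (mon w) = f w.
Proof.
rewrite (@linxEw [:: w]) // ?big_seq1 ?cf_mon ?eqxx ?scale1r // => v.
by rewrite mem_supp cf_mon inE; case: (w =P v) => [->|_]; rewrite ?eqxx.
Qed.
End LinExt.

Lemma eq_linx (W : lmodType R) (f g : seq V -> W) x : f =1 g -> linx f x = linx g x.
Proof. by move=> fg; rewrite !linxE; apply: eq_bigr => w _; rewrite fg. Qed.

Lemma lin_mull (U : lmodType R) (F : U -> T) y : islin F -> islin (fun a => F a * y).
Proof. by move=> lF a u v; rewrite lF mulrDl scalerAl. Qed.

Lemma lin_mulr (U : lmodType R) (F : U -> T) y : islin F -> islin (fun a => y * F a).
Proof. by move=> lF a u v; rewrite lF mulrDr scalerAr. Qed.
End Interface.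

Lemma cf_eq (R : comNzRingType) (V V' : superspace) (F : T R V' -> T R V)
    (G : T R V' -> R) w :
  islin F -> islin (G : T R V' -> R^o) ->
  (forall u, cf (F (mon R u)) w = G (mon R u)) -> forall x, cf (F x) w = G x.
Proof.
move=> lF lG FG x.
apply: (@tens_eq R V' R^o (fun x => cf (F x) w) G) => //.
exact: (lin_app (lin_cf w)).
Qed.

(** * Derivatives, insertions and symmetrization *)

Ltac lin1 := first
  [ exact: lin_id | exact: lin_cst0 | exact: lin_linx | assumption
  | apply: lin_scale | apply: lin_opp | apply: lin_add | apply: lin_mull | apply: lin_mulr
  | apply: lin_sum => ?
  | apply: (lin_app (lin_linx _))].
Ltac lin := rewrite /=; do ![lin1].

Definition wp (V : superspace) (w : seq V) : bool := odd (wpar w).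

Ltac bcases := repeat (match goal with
  | |- context [@spar ?V ?i] => destruct (@spar V i)
  | |- context [@wp ?V ?w] => destruct (@wp V w)
  | b : bool |- _ => destruct b end); by rewrite /= ?expr0 ?expr1 ?scale1r ?scaleN1r ?mul1r ?mulN1r ?scalerN ?scaleNr ?mulrN ?mulNr ?opprK.

Section Words.
Variables (R : comNzRingType) (V : superspace).
Implicit Types (i j k l : V) (u v w : seq V) (x y z s t : T R V).
Local Notation T := (T R V).

Lemma wp_nil : wp ([::] : seq V) = false.
Proof. by rewrite /wp /wpar big_nil. Qed.

Lemma wp_cons i w : wp (i :: w) = spar i (+) wp w.
Proof. by rewrite /wp /wpar big_cons oddD oddb. Qed.

Lemma wp_cat u v : wp (u ++ v) = wp u (+) wp v.
Proof. by rewrite /wp /wpar big_cat oddD. Qed.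

(** The left derivative removes the first letter if it is i; it shifts
    coefficients by one letter, which gives access to them by induction. *)
Definition wder i w : T := if w is j :: w' then (j == i)%:R *: mon R w' else 0.
Definition der i : T -> T := linx (wder i).

Lemma der_mon i w : der i (mon R w) = wder i w.
Proof. exact: linx_mon. Qed.

Lemma lin_der i : islin (der i). Proof. exact: lin_linx. Qed.
Lemma derZ i a x : der i (a *: x) = a *: der i x.
Proof. exact: (islinZ (lin_der i)). Qed.
Lemma derD i x y : der i (x + y) = der i x + der i y.
Proof. exact: (islinD (lin_der i)). Qed.
Lemma der_sum i (I : Type) (r : seq I) (p : pred I) (F : I -> T) :
  der i (\sum_(k <- r | p k) F k) = \sum_(k <- r | p k) der i (F k).
Proof. exact: (islin_sum (lin_der i)). Qed.

Lemma cf_der i x w : cf (der i x) w = cf x (i :: w).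
Proof.
move: x; apply: cf_eq => [||u]; [exact: lin_der|exact: lin_cf|].
rewrite der_mon cf_mon; case: u => [|j u] /=; first by rewrite cf0.
by rewrite cfZ !cf_mon eqseq_cons -natrM mulnb.
Qed.

Lemma der_let i j x : der i (let1 R j * x) = (j == i)%:R *: x.
Proof.
move: x; apply: tens_eq => [||w]; [|exact/lin_scale/lin_id|].
  by apply: (lin_app (lin_der i)); lin.
by rewrite -mon_cons der_mon.
Qed.

Lemma der1 i : der i 1 = 0. Proof. by rewrite -mon0 der_mon. Qed.

Lemma cf_let i x w :
  cf (let1 R i * x) w = if w is j :: w' then (i == j)%:R * cf x w' else 0.
Proof.
move: x; apply: cf_eq => [||u]; [by lin| |].
  case: w => [|j w]; first exact: lin_cst0.
  by move=> a x y; rewrite cfD cfZ mulrDr mulrCA.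
rewrite -mon_cons cf_mon; case: w => [|j w] //.
by rewrite cf_mon eqseq_cons -natrM mulnb.
Qed.

Lemma letters x : x = cf x [::] *: 1 + \sum_i let1 R i * der i x.
Proof.
apply/cfP => -[|j w]; rewrite cfD cfZ cf_sum -(mon0 R V) cf_mon /=.
  by rewrite mulr1 big1 ?addr0 // => i _; rewrite cf_let.
rewrite mulr0 add0r (bigD1 j) //= cf_let eqxx mul1r cf_der big1 ?addr0 //.
by move=> i /negPf ne; rewrite cf_let ne mul0r.
Qed.

(** The parity automorphism for b = true, the identity for b = false: moving a
    letter of parity b past x turns x into J b x. *)
Definition J (b : bool) : T -> T := linx (fun w => (-1) ^+ (b && wp w) *: mon R w).

Lemma lin_J b : islin (J b). Proof. exact: lin_linx. Qed.
Lemma JZ b a x : J b (a *: x) = a *: J b x.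
Proof. exact: (islinZ (lin_J b)). Qed.
Lemma J_0 b : J b 0 = 0.
Proof. exact: (islin0 (lin_J b)). Qed.
Lemma JD b x y : J b (x + y) = J b x + J b y.
Proof. exact: (islinD (lin_J b)). Qed.
Lemma J_sum b (I : Type) (r : seq I) (p : pred I) (F : I -> T) :
  J b (\sum_(k <- r | p k) F k) = \sum_(k <- r | p k) J b (F k).
Proof. exact: (islin_sum (lin_J b)). Qed.

Lemma J_mon b w : J b (mon R w) = (-1) ^+ (b && wp w) *: mon R w.
Proof. exact: linx_mon. Qed.

Lemma cf_J b x w : cf (J b x) w = (-1) ^+ (b && wp w) * cf x w.
Proof.
move: x; apply: cf_eq => [||u]; [exact: lin_J| |].
  by move=> a x y; rewrite cfD cfZ mulrDr mulrCA.
by rewrite J_mon cfZ cf_mon; case: eqP => [->|_] //; rewrite !mulr0.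
Qed.

Lemma JM b x y : J b (x * y) = J b x * J b y.
Proof.
move: x; apply: tens_eq => [||u]; [by apply: (lin_app (lin_J b)); lin|by lin|].
move: y; apply: tens_eq => [||v]; [by apply: (lin_app (lin_J b)); lin|by lin|].
rewrite monM !J_mon wp_cat -scalerAl -scalerAr scalerA -signr_addb monM.
by rewrite andb_addr.
Qed.

Lemma J_let b i : J b (let1 R i) = (-1) ^+ (b && spar i) *: let1 R i.
Proof. by rewrite J_mon wp_cons wp_nil addbF. Qed.

Lemma J0 x : J false x = x.
Proof. by apply/cfP => w; rewrite cf_J mul1r. Qed.

Lemma JJ b c x : J b (J c x) = J (b (+) c) x.
Proof. by apply/cfP => w; rewrite !cf_J mulrA -signr_addb andb_addl. Qed.

Lemma JC b c x : J b (J c x) = J c (J b x).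
Proof. by rewrite !JJ addbC. Qed.

Lemma J1 b : J b 1 = 1.
Proof. by rewrite -mon0 J_mon wp_nil andbF scale1r. Qed.

(** The letter enters from the left and gets a sign for every letter it passes. *)
Fixpoint wins i (w : seq V) : T :=
  if w is j :: w' then
    mon R [:: i, j & w'] + (-1) ^+ (spar i && spar j) *: (let1 R j * wins i w')
  else let1 R i.
Definition ins i : T -> T := linx (wins i).

Lemma lin_ins i : islin (ins i). Proof. exact: lin_linx. Qed.
Lemma insZ i a x : ins i (a *: x) = a *: ins i x.
Proof. exact: (islinZ (lin_ins i)). Qed.
Lemma ins0 i : ins i 0 = 0.
Proof. exact: (islin0 (lin_ins i)). Qed.
Lemma insD i x y : ins i (x + y) = ins i x + ins i y.
Proof. exact: (islinD (lin_ins i)). Qed.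
Lemma ins_sum i (I : Type) (r : seq I) (p : pred I) (F : I -> T) :
  ins i (\sum_(k <- r | p k) F k) = \sum_(k <- r | p k) ins i (F k).
Proof. exact: (islin_sum (lin_ins i)). Qed.

Lemma ins_mon i w : ins i (mon R w) = wins i w.
Proof. exact: linx_mon. Qed.

Lemma ins1 i : ins i 1 = let1 R i.
Proof. by rewrite -mon0 ins_mon. Qed.

Lemma ins_let i j x :
  ins i (let1 R j * x) = let1 R i * (let1 R j * x) +
    (-1) ^+ (spar i && spar j) *: (let1 R j * ins i x).
Proof.
move: x; apply: tens_eq => [||w]; [by apply: (lin_app (lin_ins i)); lin| |].
  by lin.
by rewrite -mon_cons !ins_mon /= -!mon_cons.
Qed.

Lemma insC i j x : ins i (ins j x) = (-1) ^+ (spar i && spar j) *: ins j (ins i x).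
Proof.
move: x; apply: tens_eq => [||w].
- by apply: (lin_app (lin_ins i)); exact: lin_ins.
- by apply: lin_scale; apply: (lin_app (lin_ins j)); exact: lin_ins.
elim: w => [|k w IH].
  rewrite mon0 !ins1 -[let1 R i]mulr1 -[let1 R j]mulr1 !ins_let !ins1 !mulr1.
  rewrite scalerDr scalerA -signr_addb addrC [spar j && _]andbC addbb.
  by rewrite scale1r.
rewrite mon_cons !ins_let !insD !insZ !ins_let.
rewrite IH !scalerDr !mulrDr -!scalerAr !scalerDr !scalerA -!signr_addb.
rewrite !addrA [RHS](ACl (2*1*4*3*5))%AC /=.
by do 4?[congr (_ + _)]; bcases.
Qed.

(** The symmetrization inserts the letters one by one; this recursive form is the
    sum over all permutations, see sum_wa. *)
Fixpoint wsym (w : seq V) : T := if w is i :: w' then ins i (wsym w') else 1.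
Definition sym : T -> T := linx wsym.

Lemma lin_sym : islin sym. Proof. exact: lin_linx. Qed.
Lemma symZ a x : sym (a *: x) = a *: sym x.
Proof. exact: (islinZ lin_sym). Qed.
Lemma sym0 : sym 0 = 0.
Proof. exact: (islin0 lin_sym). Qed.
Lemma symD x y : sym (x + y) = sym x + sym y.
Proof. exact: (islinD lin_sym). Qed.
Lemma sym_sub x y : sym (x - y) = sym x - sym y.
Proof. exact: (islinB lin_sym). Qed.
Lemma sym_sum (I : Type) (r : seq I) (p : pred I) (F : I -> T) :
  sym (\sum_(k <- r | p k) F k) = \sum_(k <- r | p k) sym (F k).
Proof. exact: (islin_sum lin_sym). Qed.
Lemma sym_mon w : sym (mon R w) = wsym w. Proof. exact: linx_mon. Qed.
Lemma sym1 : sym 1 = 1. Proof. by rewrite -{1}mon0 sym_mon. Qed.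
Lemma sym_let i x : sym (let1 R i * x) = ins i (sym x).
Proof.
move: x; apply: tens_eq => [||w].
- by apply: (lin_app lin_sym); lin.
- by apply: (lin_app (lin_ins i)); exact: lin_sym.
by rewrite -mon_cons !sym_mon.
Qed.

Definition swapping (W : lmodType R) (f : seq V -> W) :=
  forall u i j v,
    f (u ++ [:: i, j & v]) = (-1) ^+ (spar i && spar j) *: f (u ++ [:: j, i & v]).

Lemma swapping_wsym : swapping wsym.
Proof.
move=> u i j v; elim: u => [|k u IH] /=; first exact: insC.
by rewrite IH insZ.
Qed.

(** Invariance under the symmetric groups in terms of neighbouring letters, see
    inv_sinv. *)
Definition sinv x := forall u i j v,
  cf x (u ++ [:: i, j & v]) = (-1) ^+ (spar i && spar j) * cf x (u ++ [:: j, i & v]).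

Lemma sinv_swapping x : sinv x -> swapping (fun w => cf x w : R^o).
Proof. by []. Qed.

Lemma sinv_lin a x y : sinv x -> sinv y -> sinv (a *: x + y).
Proof.
by move=> sx sy u i j v; rewrite !cfD !cfZ sx sy mulrDr mulrCA.
Qed.

Lemma sinv0 : sinv 0.
Proof. by move=> u i j v; rewrite !cf0 mulr0. Qed.

Lemma sinvD x y : sinv x -> sinv y -> sinv (x + y).
Proof. by rewrite -{2}[x]scale1r; apply: sinv_lin. Qed.

Lemma sinvZ a x : sinv x -> sinv (a *: x).
Proof. by rewrite -[a *: x]addr0 => sx; apply: sinv_lin => //; exact: sinv0. Qed.

Lemma sinv_sum (I : Type) (r : seq I) (F : I -> T) :
  (forall a, sinv (F a)) -> sinv (\sum_(a <- r) F a).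
Proof.
move=> sF; elim/big_ind: _ => [|x y sx sy|i _]; [exact: sinv0|exact: sinvD|exact: sF].
Qed.

Lemma sinv1 : sinv 1.
Proof.
move=> u i j v; rewrite -mon0 !cf_mon.
by case: u => [|k u]; rewrite /= mulr0.
Qed.

Lemma sinv_der i x : sinv x -> sinv (der i x).
Proof. by move=> sx u j k v; rewrite !cf_der; exact: (sx (i :: u)). Qed.

Lemma derC i j x : sinv x ->
  der i (der j x) = (-1) ^+ (spar i && spar j) *: der j (der i x).
Proof.
move=> sx; apply/cfP => w; rewrite cfZ !cf_der andbC; exact: (sx [::]).
Qed.

Lemma cf_ins_nil i x : cf (ins i x) [::] = 0.
Proof.
move: x; apply: cf_eq => [||w]; [exact: lin_ins|exact: lin_cst0|].
by rewrite ins_mon; case: w => [|j w] /=; rewrite ?cfD ?cfZ ?cf_let cf_mon ?mulr0 ?addr0.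
Qed.

(** Canonical (anti)commutation relations: insertions create letters, derivatives
    annihilate them. *)
Lemma der_ins i j x : der j (ins i x) =
  (i == j)%:R *: x + (-1) ^+ (spar i && spar j) *: ins i (der j x).
Proof.
move: x; apply: tens_eq => [||w].
- by apply: (lin_app (lin_der j)); exact: lin_ins.
- apply: lin_add; first by lin.
  by apply: lin_scale; apply: (lin_app (lin_ins i)); exact: lin_der.
case: w => [|k w].
  rewrite mon0 ins1 der1 ins0 scaler0 addr0.
  by rewrite -[let1 R i]mulr1 der_let.
rewrite mon_cons ins_let derD derZ !der_let.
rewrite insZ !scalerA; case: (k =P j) => [->|_] //.
by rewrite !mulr0.
Qed.

Lemma sinv_ins i x : sinv x -> sinv (ins i x).
Proof.
move=> sx u; elim: u x sx => [|k u IH] x sx a b v; rewrite /= -!cf_der !der_ins; last first.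
  rewrite !cfD !cfZ sx (IH _ (sinv_der k sx)) mulrDr.
  by congr (_ + _); rewrite mulrCA.
rewrite !derD !derZ !der_ins (derC b a sx).
rewrite insZ !(cfD, cfZ) !mulrDr !mulrA -!signr_addb.
rewrite addrCA; congr (_ + (_ + _)).
- by case: (i =P b) => [->|_]; rewrite ?mulr0 ?mul0r // !mulr1; bcases.
- by case: (i =P a) => [->|_]; rewrite ?mulr0 ?mul0r // ?(mulr1, mul1r) -?signr_addb; bcases.
- by bcases.
Qed.

Lemma sinv_wsym w : sinv (wsym w).
Proof. by elim: w => [|i w IH] /=; [exact: sinv1|exact: sinv_ins]. Qed.

Lemma sinv_sym x : sinv (sym x).
Proof.
rewrite /sym linxE; apply: sinv_sum => w; apply: sinvZ; exact: sinv_wsym.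
Qed.

Lemma sinv_J b x : sinv x -> sinv (J b x).
Proof.
move=> sx u i j v; rewrite !cf_J sx mulrCA; congr (_ * ((-1) ^+ nat_of_bool _ * _)).
by rewrite !wp_cat !wp_cons; bcases.
Qed.

End Words.

(** * Symmetrization of invariants *)

Section SymTheory.
Variables (R : comNzRingType) (V : superspace).
Implicit Types (i j k l : V) (u v w p q : seq V) (x y z s t : T R V).
Local Notation T := (T R V).

(** The number operator: taking out the first letter and inserting it in any of the
    places of w gives back the same coefficient of an invariant. *)
Lemma sum_ins_der x w : sinv x ->
  cf (\sum_i ins i (der i x)) w = (size w)%:R * cf x w.
Proof.
elim: w x => [|k w IH] x sx; rewrite cf_sum.
  by rewrite big1 ?mul0r // => i _; exact: cf_ins_nil.
transitivity (\sum_i ((i == k)%:R * cf (der i x) w + cf (ins i (der i (der k x))) w)).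
  apply: eq_bigr => i _; rewrite -cf_der der_ins cfD !cfZ (derC k i sx).
  by rewrite insZ cfZ mulrA -signr_addb andbC addbb mul1r.
rewrite big_split /= (bigD1 k) //= eqxx mul1r big1 ?addr0; last first.
  by move=> i /negPf ->; rewrite mul0r.
by rewrite -cf_sum IH ?cf_der; [rewrite -natr1 mulrDl mul1r addrC|exact: sinv_der].
Qed.

(** A tensor is the sum of its letters times its left derivatives; for an
    invariant these derivatives are again invariant, and the number operator gives
    the factor that is missing in the factorial. *)
Lemma cf_sym_sinv x w : sinv x -> cf (sym x) w = (size w)`!%:R * cf x w.
Proof.
have cf_ins_deg i n y y' : (forall v, size v = n -> cf y v = cf y' v) ->
  forall v, size v = n.+1 -> cf (ins i y) v = cf (ins i y') v.
  elim: n y y' => [|n IHn] y y' yy' [|a v] //= [sv];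
    rewrite -!cf_der !der_ins !cfD !cfZ (yy' _ sv).
    by rewrite (size0nil sv) !cf_ins_nil.
  by rewrite (IHn _ (der a y')) // => b sb; rewrite !cf_der yy' //= sb.
move=> sx; move: {-1}(size w) (erefl (size w)) => n.
elim: n w x sx => [|n IH] w x sx sw.
  rewrite (size0nil sw) {1}[x]letters symD symZ.
  rewrite sym1 sym_sum cfD cfZ -mon0 cf_mon cf_sum big1 ?addr0.
    by rewrite mulr1 mul1r.
  by move=> i _; rewrite sym_let cf_ins_nil.
rewrite {1}[x]letters symD symZ.
rewrite sym1 sym_sum cfD cfZ -mon0 cf_mon cf_sum.
have -> : ([::] == w) = false by case: w sw => [|? ?].
rewrite mulr0 add0r.
transitivity (\sum_i cf (ins i (n`!%:R *: der i x)) w).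
  apply: eq_bigr => i _; rewrite sym_let; apply: (cf_ins_deg i n) => // v sv.
  by rewrite IH ?sv ?cfZ //; exact: sinv_der.
under eq_bigr => i _ do rewrite insZ cfZ.
rewrite -mulr_sumr -cf_sum sum_ins_der // sw factS natrM mulrA.
by congr (_ * _); rewrite mulrC.
Qed.

Definition degscale (c : nat -> R) : T -> T := linx (fun w => c (size w) *: mon R w).

Lemma lin_degscale c : islin (degscale c). Proof. exact: lin_linx. Qed.

Lemma degscale_mon c w : degscale c (mon R w) = c (size w) *: mon R w.
Proof. exact: linx_mon. Qed.

Lemma cf_degscale c x w : cf (degscale c x) w = c (size w) * cf x w.
Proof.
move: x; apply: cf_eq => [||u]; [exact: lin_degscale| |].
  by move=> a x y; rewrite cfD cfZ mulrDr mulrCA.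
by rewrite degscale_mon cfZ cf_mon; case: eqP => [->|_] //; rewrite !mulr0.
Qed.

Lemma degscale_let c i x :
  degscale c (let1 R i * x) = let1 R i * degscale (fun n => c n.+1) x.
Proof.
move: x; apply: tens_eq => [||w]; [by apply: (lin_app (lin_degscale _)); lin| |].
  by apply: lin_mulr; exact: lin_degscale.
by rewrite -mon_cons !degscale_mon /= -scalerAr -mon_cons.
Qed.

Lemma degscale_ins c i x :
  degscale c (ins i x) = ins i (degscale (fun n => c n.+1) x).
Proof.
move: x; apply: tens_eq => [||w].
- by apply: (lin_app (lin_degscale _)); exact: lin_ins.
- by apply: (lin_app (lin_ins i)); exact: lin_degscale.
rewrite degscale_mon insZ ins_mon.
elim: w c => [|j w IH] c; first by rewrite /= degscale_mon.
rewrite /= (islinD (lin_degscale c)) degscale_mon (islinZ (lin_degscale c)).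
by rewrite degscale_let IH /= -scalerAr scalerDr !scalerA mulrC.
Qed.

Lemma sinv_degscale c x : sinv x -> sinv (degscale c x).
Proof. by move=> sx u i j v; rewrite !cf_degscale sx mulrCA !size_cat. Qed.

Section Swapping.
Variables (W : lmodType R) (f : seq V -> W).
Hypothesis sf : swapping f.

Lemma swapping_cat p u v q :
  f (p ++ u ++ v ++ q) = (-1) ^+ (wp u && wp v) *: f (p ++ v ++ u ++ q).
Proof.
have one i : forall v p q,
    f (p ++ i :: v ++ q) = (-1) ^+ (spar i && wp v) *: f (p ++ v ++ i :: q).
  elim=> [|j v' IH] p' q' /=; first by rewrite wp_nil andbF scale1r.
  rewrite sf -cat1s catA IH scalerA -signr_addb -!catA /=.
  by rewrite wp_cons andb_addr.
elim: u p => [|i u IH] p; first by rewrite wp_nil scale1r.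
rewrite /= -cat1s catA IH -!catA /= one scalerA -signr_addb wp_cons.
by congr ((-1) ^+ nat_of_bool _ *: _); bcases.
Qed.

Lemma swapping_ins i x : linx f (ins i x) =
  linx (fun w => (size w).+1%:R *: f (i :: w)) x.
Proof.
move: x; apply: tens_eq => [||w].
- by apply: (lin_app (lin_linx _)); exact: lin_ins.
- exact: lin_linx.
rewrite ins_mon linx_mon; elim: w f sf => [|j w IH] g sg /=.
  by rewrite linx_mon scale1r.
have lin_consj x : linx g (let1 R j * x) = linx (fun w => g (j :: w)) x.
  move: x; apply: tens_eq => [||w']; [by lin|exact: lin_linx|].
  by rewrite -mon_cons !linx_mon.
rewrite (islinD (lin_linx g)) (islinZ (lin_linx g)) linx_mon lin_consj IH.
  have /= -> := sg [::] i j w.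
  rewrite [RHS]scalerA mulrC -scalerA -scalerDr -{1}[g _]scale1r -scalerDl.
  by rewrite -[1 + _]/(1%:R + _) -natrD.
by move=> u a b v; exact: (sg (j :: u)).
Qed.
End Swapping.

Lemma ins_J b i x : ins i (J b x) = (-1) ^+ (b && spar i) *: J b (ins i x).
Proof.
move: x; apply: tens_eq => [||w].
- by apply: (lin_app (lin_ins i)); exact: lin_J.
- by apply: lin_scale; apply: (lin_app (lin_J b)); exact: lin_ins.
elim: w => [|j w IH].
  by rewrite mon0 J1 ins1 J_let scalerA -signr_addb addbb scale1r.
rewrite mon_cons JM J_let -scalerAl insZ !ins_let IH.
rewrite -scalerAr JD JZ !JM !J_let.
rewrite !scalerDr -!scalerAl -!scalerAr -?scalerAl !scalerA -?signr_addb.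
by congr (_ + _); bcases.
Qed.

Lemma sym_J b x : sym (J b x) = J b (sym x).
Proof.
move: x; apply: tens_eq => [||w].
- by apply: (lin_app (@lin_sym R V)); exact: lin_J.
- by apply: (lin_app (lin_J b)); exact: lin_sym.
elim: w => [|i w IH]; first by rewrite mon0 J1 sym1 J1.
rewrite mon_cons JM J_let -scalerAl symZ !sym_let IH ins_J.
by rewrite scalerA -signr_addb addbb scale1r.
Qed.

Lemma sym_catC u v :
  sym (mon R u * mon R v) = (-1) ^+ (wp u && wp v) *: sym (mon R v * mon R u).
Proof.
rewrite !monM !sym_mon -[u ++ v]cats0 -catA.
by rewrite (swapping_cat (@swapping_wsym R V) [::]) /= cats0.
Qed.

Lemma sinv_catC x u v : sinv x ->
  cf x (u ++ v) = (-1) ^+ (wp u && wp v) * cf x (v ++ u).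
Proof.
move=> sx; rewrite -[u ++ v]cats0 -catA.
by rewrite (swapping_cat (sinv_swapping sx) [::]) /= cats0.
Qed.

End SymTheory.

Section Rational.
Variable V : superspace.
Implicit Types (i j k l : V) (u v w p q : seq V).
Local Notation T := (T rat V).
Implicit Types (x y z s t : T).

(** Division by the factorial of the degree, so that sym \o nrm is the identity on
    invariants. *)
Definition nrm : T -> T := degscale (fun n => n`!%:R^-1).

Lemma lin_nrm : islin nrm. Proof. exact: lin_degscale. Qed.

Lemma sym_nrm x : sinv x -> sym (nrm x) = x.
Proof.
move=> sx; apply/cfP => w; rewrite cf_sym_sinv; last exact: sinv_degscale.
by rewrite cf_degscale mulrA mulfV ?mul1r // pnatr_eq0 -lt0n fact_gt0.
Qed.

(** A linear map that is insensitive to signed swaps cannot see the difference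
    between a word and the average of its permutations. *)
Lemma swapping_sym (W : lmodType rat) (f : seq V -> W) x :
  swapping f -> linx f (nrm (sym x)) = linx f x.
Proof.
move=> sf; move: x; apply: tens_eq => [||w].
- by apply: (lin_app (lin_linx f)); apply: (lin_app lin_nrm); exact: lin_sym.
- exact: lin_linx.
rewrite sym_mon linx_mon; elim: w f sf => [|i w IH] f sf.
  by rewrite /= -mon0 /nrm degscale_mon fact0 invr1 scale1r linx_mon.
rewrite /= /nrm degscale_ins swapping_ins //.
rewrite -[RHS](IH (fun w => f (i :: w))); last by move=> u a b v; exact: (sf (i :: u)).
move: (wsym _ w); apply: tens_eq => [||v].
- by apply: (lin_app (lin_linx _)); exact: lin_degscale.
- by apply: (lin_app (lin_linx _)); exact: lin_nrm.
rewrite /nrm !degscale_mon !(islinZ (lin_linx _)) !linx_mon scalerA; congr (_ *: _).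
by rewrite factS natrM invfM mulrAC mulVf ?mul1r // pnatr_eq0.
Qed.

Lemma sym_eqP (W : lmodType rat) (f : seq V -> W) x y :
  swapping f -> sym x = sym y -> linx f x = linx f y.
Proof. by move=> sf xy; rewrite -(swapping_sym x sf) xy swapping_sym. Qed.

Lemma sym_eql x x' y : sym x = sym x' -> sym (x * y) = sym (x' * y).
Proof.
move=> xx'; move: y; apply: tens_eq => [||v].
- by apply: (lin_app (@lin_sym _ V)); lin.
- by apply: (lin_app (@lin_sym _ V)); lin.
have e z : sym (z * mon rat v) = linx (fun w => wsym rat (w ++ v)) z.
  move: z; apply: tens_eq => [||w]; [|exact: lin_linx|].
    by apply: (lin_app (@lin_sym _ V)); lin.
  by rewrite monM sym_mon linx_mon.
rewrite !e; apply: sym_eqP xx' => u i j w.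
by rewrite -!catA; exact: swapping_wsym.
Qed.

Lemma sym_eqr x x' y : sym x = sym x' -> sym (y * x) = sym (y * x').
Proof.
move=> xx'; move: y; apply: tens_eq => [||v].
- by apply: (lin_app (@lin_sym _ V)); lin.
- by apply: (lin_app (@lin_sym _ V)); lin.
have e z : sym (mon rat v * z) = linx (fun w => wsym rat (v ++ w)) z.
  move: z; apply: tens_eq => [||w]; [|exact: lin_linx|].
    by apply: (lin_app (@lin_sym _ V)); lin.
  by rewrite monM sym_mon linx_mon.
rewrite !e; apply: sym_eqP xx' => u i j w.
by rewrite !catA; exact: swapping_wsym.
Qed.

Lemma sym_nrm_sym x : sym (nrm (sym x)) = sym x.
Proof. by apply: sym_nrm; exact: sinv_sym. Qed.

End Rational.

(** * Products of tensor powers of an algebra *)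

Section TensorProductAlgebra.
Variables (R : comNzRingType) (A : superalgebra).
Local Notation V := (sspace A).
Local Notation T := (T R V).
Implicit Types (i j k l a b : V) (u v w : seq V) (x y z : T).

(** The structure constants of A. *)
Definition str i j k : R := (scoord (sbasis i * sbasis j : A) k)%:~R.
Definition lmul : V -> V -> T :=
  locked (fun i j => \sum_k str i j k *: let1 R k).

Lemma lmulE i j : lmul i j = \sum_k str i j k *: let1 R k.
Proof. by rewrite /lmul -lock. Qed.

Lemma str_neq0 i j k : str i j k != 0 -> spar k = spar i (+) spar j.
Proof.
by rewrite /str => nz; apply: sparM; apply: contraNneq nz => ->.
Qed.

Lemma str_sign i j k (W : lmodType R) (F : bool -> W) :
  str i j k *: F (spar k) = str i j k *: F (spar i (+) spar j).
Proof.
by case: (str i j k =P 0) => [->|/eqP /str_neq0 ->]; rewrite ?scale0r.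
Qed.

(** The product in the tensor powers of A, zero in different degrees.  The sign comes
    from moving the first letter of the second word past the rest of the first. *)
Fixpoint wtm (u w : seq V) : T :=
  match u, w with
  | [::], [::] => 1
  | i :: u', j :: w' => (-1) ^+ (wp u' && spar j) *: (lmul i j * wtm u' w')
  | _, _ => 0
  end.
Definition tm x y : T := linx (fun u => linx (wtm u) y) x.

Lemma tm_mon u w : tm (mon R u) (mon R w) = wtm u w.
Proof. by rewrite /tm !linx_mon. Qed.

Lemma lin_tml y : islin (fun x => tm x y). Proof. exact: lin_linx. Qed.
Lemma lin_tmr x : islin (tm x).
Proof.
move=> a y z; move: x; apply: tens_eq => [||u].
- exact: lin_tml.
- by apply: lin_add; [apply: lin_scale|]; exact: lin_tml.
by rewrite /tm !linx_mon lin_linx.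
Qed.

Lemma tmZl (c : T) (t : R) x : tm (t *: x) c = t *: tm x c.
Proof. exact: (islinZ (lin_tml c)). Qed.
Lemma tm0l (c : T) : tm 0 c = 0.
Proof. exact: (islin0 (lin_tml c)). Qed.
Lemma tmDl (c x y : T) : tm (x + y) c = tm x c + tm y c.
Proof. exact: (islinD (lin_tml c)). Qed.
Lemma tm_suml (c : T) (I : Type) (r : seq I) (p : pred I) (F : I -> T) :
  tm (\sum_(k <- r | p k) F k) c = \sum_(k <- r | p k) tm (F k) c.
Proof. exact: (islin_sum (lin_tml c)). Qed.
Lemma tmZr (c : T) (t : R) x : tm c (t *: x) = t *: tm c x.
Proof. exact: (islinZ (lin_tmr c)). Qed.
Lemma tm0r (c : T) : tm c 0 = 0.
Proof. exact: (islin0 (lin_tmr c)). Qed.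
Lemma tmDr (c x y : T) : tm c (x + y) = tm c x + tm c y.
Proof. exact: (islinD (lin_tmr c)). Qed.
Lemma tm_sumr (c : T) (I : Type) (r : seq I) (p : pred I) (F : I -> T) :
  tm c (\sum_(k <- r | p k) F k) = \sum_(k <- r | p k) tm c (F k).
Proof. exact: (islin_sum (lin_tmr c)). Qed.

Lemma tm_let i j x y :
  tm (let1 R i * x) (let1 R j * y) = lmul i j * tm (J (spar j) x) y.
Proof.
move: y; apply: tens_eq => [||w].
- by apply: (lin_app (lin_tmr _)); lin.
- by apply: lin_mulr; exact: lin_tmr.
move: x; apply: tens_eq => [||u].
- by apply: (lin_app (lin_tml _)); lin.
- by apply: lin_mulr; apply: (lin_app (lin_tml _)); exact: lin_J.
rewrite -!mon_cons tm_mon J_mon tmZl -scalerAr tm_mon /=.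
by rewrite andbC.
Qed.

Lemma tm1l (c : T) : tm 1 c = cf c [::] *: 1.
Proof.
move: c; apply: tens_eq => [||w].
- exact: lin_tmr.
- by move=> a x y; rewrite cfD cfZ scalerDl scalerA.
by rewrite -{1}mon0 tm_mon cf_mon; case: w => [|i w] /=; rewrite ?scale0r ?scale1r.
Qed.

Lemma tm1r (c : T) : tm c 1 = cf c [::] *: 1.
Proof.
move: c; apply: tens_eq => [||w].
- exact: lin_tml.
- by move=> a x y; rewrite cfD cfZ scalerDl scalerA.
by rewrite -{1}mon0 tm_mon cf_mon; case: w => [|i w] /=; rewrite ?scale0r ?scale1r.
Qed.

Lemma tm_let1 i x : tm (let1 R i * x) 1 = 0.
Proof. by rewrite tm1r cf_let scale0r. Qed.

Lemma tm_1let i x : tm 1 (let1 R i * x) = 0.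
Proof. by rewrite tm1l cf_let scale0r. Qed.

Lemma tm_letl i x (c : T) :
  tm (let1 R i * x) c = \sum_j lmul i j * tm (J (spar j) x) (der j c).
Proof.
rewrite {1}[c]letters tmDr tmZr tm_let1 scaler0.
by rewrite add0r tm_sumr; apply: eq_bigr => j _; rewrite tm_let.
Qed.

Lemma tm_letr j y (c : T) :
  tm c (let1 R j * y) = \sum_i lmul i j * tm (J (spar j) (der i c)) y.
Proof.
rewrite {1}[c]letters tmDl tmZl tm_1let scaler0.
by rewrite add0r tm_suml; apply: eq_bigr => i _; rewrite tm_let.
Qed.

Lemma J_lmul (b : bool) i j : J b (lmul i j) = (-1) ^+ (b && (spar i (+) spar j)) *: lmul i j.
Proof.
rewrite lmulE J_sum scaler_sumr; apply: eq_bigr => k _.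
rewrite JZ J_let.
by rewrite (str_sign i j k (fun s => (-1) ^+ (b && s) *: let1 R k)) !scalerA mulrC.
Qed.

Lemma J_tm (b : bool) x y : J b (tm x y) = tm (J b x) (J b y).
Proof.
move: y; apply: tens_eq => [||w].
- by apply: (lin_app (lin_J b)); exact: lin_tmr.
- by apply: (lin_app (lin_tmr _)); exact: lin_J.
move: x; apply: tens_eq => [||u].
- by apply: (lin_app (lin_J b)); exact: lin_tml.
- by apply: (lin_app (lin_tml _)); exact: lin_J.
elim: u w => [|i u IH] [|j w]; rewrite ?mon0 ?mon_cons ?J1 ?JM ?J_let.
- by rewrite tm1l JZ J1.
- by rewrite -!scalerAl tmZr !tm_1let J_0 scaler0.
- by rewrite -!scalerAl tmZl !tm_let1 J_0 scaler0.
rewrite tm_let JM J_lmul !J_mon tmZl JZ IH !J_mon.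
rewrite -!scalerAr -!scalerAl !tmZl !tmZr tm_let J_mon.
rewrite !tmZl -!scalerAr !scalerA -!signr_addb; bcases.
Qed.

Lemma der_J i (b : bool) x : der i (J b x) = (-1) ^+ (b && spar i) *: J b (der i x).
Proof.
apply/cfP => w; rewrite cfZ !(cf_der, cf_J) wp_cons mulrA -signr_addb; bcases.
Qed.

Lemma lmulM i j x : lmul i j * x = \sum_k str i j k *: (let1 R k * x).
Proof. by rewrite lmulE mulr_suml; apply: eq_bigr => k _; rewrite scalerAl. Qed.

Lemma sym_lmul i j x : sym (lmul i j * x) = \sum_k str i j k *: ins k (sym x).
Proof.
rewrite lmulM sym_sum; apply: eq_bigr => k _.
by rewrite symZ sym_let.
Qed.

Lemma sym_lmulC i a j b x :
  sym (lmul i a * (lmul j b * x)) =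
  (-1) ^+ ((spar i (+) spar a) && (spar j (+) spar b)) *:
     sym (lmul j b * (lmul i a * x)).
Proof.
rewrite !sym_lmul.
under eq_bigr do rewrite ins_sum scaler_sumr.
under [in RHS]eq_bigr do rewrite ins_sum scaler_sumr.
rewrite sum_exchange scaler_sumr; apply: eq_bigr => l _.
rewrite scaler_sumr; apply: eq_bigr => k _.
rewrite !insZ insC !scalerA; congr (_ *: _).
have [->|/str_neq0 ->] := eqVneq (str i a k) 0; first by rewrite !(mulr0, mul0r).
have [->|/str_neq0 ->] := eqVneq (str j b l) 0; first by rewrite !(mulr0, mul0r).
by rewrite [LHS]mulrC -?mulrA; congr (_ * _); rewrite mulrC.
Qed.

(** Swapping two letters of the left factor can be compensated by swapping the
    letters of the invariant right factor that they meet. *)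
Lemma swapping_tml (c : T) : sinv c -> swapping (fun w => sym (tm (mon R w) c)).
Proof.
move=> sc u; elim: u c sc => [|k u IH] c sc i j v /=; last first.
  rewrite !mon_cons !tm_letl !sym_sum scaler_sumr.
  apply: eq_bigr => l _; rewrite !sym_lmul scaler_sumr; apply: eq_bigr => m _.
  rewrite !J_mon !tmZl !symZ.
  rewrite (IH _ (sinv_der l sc)) !insZ !scalerA.
  by congr (_ *: _); rewrite !wp_cat !wp_cons; bcases.
have e a b : tm (mon R [:: a, b & v]) c = \sum_k \sum_l
    (-1) ^+ (spar b && spar k) *:
      (lmul a k * (lmul b l * tm (J (spar l) (J (spar k) (mon R v))) (der l (der k c)))).
  rewrite mon_cons tm_letl; apply: eq_bigr => k _.
  rewrite mon_cons JM J_let -scalerAl tmZl tm_letl.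
  rewrite scaler_sumr mulr_sumr; apply: eq_bigr => l _.
  by rewrite andbC -scalerAr.
rewrite !e sum_exchange !sym_sum scaler_sumr.
apply: eq_bigr => b _; rewrite !sym_sum scaler_sumr.
apply: eq_bigr => a _; rewrite !symZ sym_lmulC (derC b a sc).
rewrite (JC (spar b) (spar a)) tmZr -!scalerAr !symZ !scalerA.
by rewrite -!signr_addb; bcases.
Qed.

Lemma swapping_tmr (c : T) : sinv c -> swapping (fun w => sym (tm c (mon R w))).
Proof.
move=> sc u; elim: u c sc => [|k u IH] c sc i j v /=; last first.
  rewrite !mon_cons !tm_letr !sym_sum scaler_sumr.
  apply: eq_bigr => l _; rewrite !sym_lmul scaler_sumr; apply: eq_bigr => m _.
  rewrite (IH _ (sinv_J _ (sinv_der l sc))) !insZ !scalerA.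
  by rewrite mulrC.
have e a b : tm c (mon R [:: a, b & v]) = \sum_k \sum_l
    (-1) ^+ (spar a && spar l) *:
      (lmul k a * (lmul l b * tm (J (spar b) (J (spar a) (der l (der k c)))) (mon R v))).
  rewrite mon_cons tm_letr; apply: eq_bigr => k _.
  rewrite mon_cons tm_letr mulr_sumr; apply: eq_bigr => l _.
  by rewrite der_J JZ tmZl -!scalerAr.
rewrite !e sum_exchange !sym_sum scaler_sumr.
apply: eq_bigr => b _; rewrite !sym_sum scaler_sumr.
apply: eq_bigr => a _; rewrite !symZ sym_lmulC (derC b a sc).
rewrite (JC (spar j) (spar i)) !JZ tmZl -!scalerAr !symZ !scalerA.
by rewrite -!signr_addb; bcases.
Qed.

Lemma der_lmul k i j x : der k (lmul i j * x) = str i j k *: x.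
Proof.
rewrite lmulM der_sum (bigD1 k) //= derZ der_let.
rewrite eqxx scale1r big1 ?addr0 // => l /negPf ne.
by rewrite derZ der_let ne scale0r scaler0.
Qed.

Lemma der_tm k x y : der k (tm x y) =
  \sum_i \sum_j str i j k *: tm (J (spar j) (der i x)) (der j y).
Proof.
rewrite {1}[x]letters tmDl tmZl tm1l.
rewrite derD !derZ der1 !scaler0 add0r.
rewrite tm_suml der_sum; apply: eq_bigr => i _.
rewrite tm_letl der_sum; apply: eq_bigr => j _.
exact: der_lmul.
Qed.

(** Two left derivatives of a product are given by pairs of left derivatives of the
    factors, which supercommute on invariants. *)
Lemma sinv_tm x y : sinv x -> sinv y -> sinv (tm x y).
Proof.
move=> sx sy u; elim: u x y sx sy => [|k u IH] x y sx sy a b v /=; last first.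
  rewrite -!cf_der der_tm !cf_sum mulr_sumr; apply: eq_bigr => i _.
  rewrite !cf_sum mulr_sumr; apply: eq_bigr => j _; rewrite !cfZ.
  by rewrite (IH _ _ (sinv_J _ (sinv_der i sx)) (sinv_der j sy)) mulrCA.
have e p q : der q (der p (tm x y)) = \sum_i \sum_j \sum_k \sum_l
    (-1) ^+ (spar j && spar k) *: (str i j p *: (str k l q *:
      tm (J (spar l) (J (spar j) (der k (der i x)))) (der l (der j y)))).
  rewrite der_tm der_sum; apply: eq_bigr => i _.
  rewrite der_sum; apply: eq_bigr => j _.
  rewrite derZ der_tm scaler_sumr; apply: eq_bigr => k _.
  rewrite scaler_sumr; apply: eq_bigr => l _.
  rewrite der_J JZ tmZl !scalerA.
  by congr (_ *: _); rewrite mulrA mulrC.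
rewrite -!cf_der !e.
have swap (F : V -> V -> V -> V -> T) :
    \sum_i \sum_j \sum_k \sum_l F i j k l = \sum_k \sum_l \sum_i \sum_j F i j k l.
  under eq_bigr do rewrite sum_exchange.
  rewrite sum_exchange; apply: eq_bigr => k _.
  under eq_bigr do rewrite sum_exchange.
  by rewrite sum_exchange.
rewrite swap -cfZ; congr (cf _ _).
rewrite scaler_sumr; apply: eq_bigr => k _; rewrite scaler_sumr; apply: eq_bigr => l _.
rewrite scaler_sumr; apply: eq_bigr => i _; rewrite scaler_sumr; apply: eq_bigr => j _.
rewrite (derC _ _ sx) (derC _ _ sy) !JZ tmZl.
rewrite tmZr (JC (spar l) (spar j)) !scalerA; congr (_ *: _).
have [->|/str_neq0 ->] := eqVneq (str i j a) 0; first by rewrite !(mulr0, mul0r).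
have [->|/str_neq0 ->] := eqVneq (str k l b) 0; first by rewrite !(mulr0, mul0r).
move: (str i j a) (str k l b) => s1 s2.
by do 4!case: (spar _);
  rewrite /= ?expr0 ?expr1 ?(mul1r, mulr1, mulN1r, mulrN1, mulNr, mulrN, opprK) mulrC.
Qed.

Lemma wtm_size u w : size u != size w -> wtm u w = 0.
Proof.
elim: u w => [|i u IH] [|j w] //= ne.
by rewrite IH // mulr0 scaler0.
Qed.

Lemma degscale_wtm c u w : degscale c (wtm u w) = c (size u) *: wtm u w.
Proof.
elim: u w c => [|i u IH] [|j w] c /=;
    rewrite ?(islin0 (@lin_degscale R V _)) ?scaler0 //.
  by rewrite -mon0 degscale_mon.
rewrite (islinZ (@lin_degscale R V _)) lmulM (islin_sum (@lin_degscale R V _)).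
rewrite scalerA mulrC -scalerA; congr (_ *: _).
rewrite scaler_sumr; apply: eq_bigr => k _.
rewrite (islinZ (@lin_degscale R V _)) degscale_let IH -scalerAr !scalerA.
by rewrite mulrC.
Qed.

Lemma degscale_tml c x y : tm (degscale c x) y = degscale c (tm x y).
Proof.
move: y; apply: tens_eq => [||w].
- exact: lin_tmr.
- by apply: (lin_app (@lin_degscale R V _)); exact: lin_tmr.
move: x; apply: tens_eq => [||u].
- by apply: (lin_app (lin_tml _)); exact: lin_degscale.
- by apply: (lin_app (@lin_degscale R V _)); exact: lin_tml.
by rewrite degscale_mon tmZl tm_mon degscale_wtm.
Qed.

Lemma degscale_tmr c x y : tm x (degscale c y) = degscale c (tm x y).
Proof.
move: y; apply: tens_eq => [||w].
- by apply: (lin_app (lin_tmr _)); exact: lin_degscale.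
- by apply: (lin_app (@lin_degscale R V _)); exact: lin_tmr.
move: x; apply: tens_eq => [||u].
- exact: lin_tml.
- by apply: (lin_app (@lin_degscale R V _)); exact: lin_tml.
rewrite degscale_mon tmZr tm_mon degscale_wtm.
have [->|/wtm_size ->] := eqVneq (size u) (size w); first by [].
by rewrite !scaler0.
Qed.
End TensorProductAlgebra.

Section RationalAlgebra.
Variable A : superalgebra.
Local Notation V := (sspace A).
Local Notation T := (T rat V).
Implicit Types (x y c : T).

(** Symmetrizing the left factor only reorders letters, which the invariant right
    factor does not notice. *)
Lemma sym_tml x c : sinv c -> sym (tm x c) = tm (sym x) c.
Proof.
move=> sc; rewrite -[RHS]sym_nrm; last exact: sinv_tm (sinv_sym x) sc.
have e z : sym (tm z c) = linx (fun w => sym (tm (mon rat w) c)) z.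
  move: z; apply: tens_eq => [||w]; [|exact: lin_linx|by rewrite linx_mon].
  by apply: (lin_app (@lin_sym _ V)); exact: lin_tml.
by rewrite /nrm -degscale_tml !e (swapping_sym _ (swapping_tml sc)).
Qed.

Lemma sym_tmr x c : sinv c -> sym (tm c x) = tm c (sym x).
Proof.
move=> sc; rewrite -[RHS]sym_nrm; last exact: sinv_tm sc (sinv_sym x).
have e z : sym (tm c z) = linx (fun w => sym (tm c (mon rat w))) z.
  move: z; apply: tens_eq => [||w]; [|exact: lin_linx|by rewrite linx_mon].
  by apply: (lin_app (@lin_sym _ V)); exact: lin_tmr.
by rewrite /nrm -degscale_tmr !e (swapping_sym _ (swapping_tmr sc)).
Qed.
End RationalAlgebra.

(** * Maps of letters, removal of letters and coproducts *)

Section LetterMap.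
Variables (R : comNzRingType) (V W : superspace) (f : V -> W).
Implicit Types (i j : V) (u v w : seq V) (x y z : T R V).

Definition lmap : T R V -> T R W := linx (fun w => mon R (map f w)).

Lemma lin_lmap : islin lmap. Proof. exact: lin_linx. Qed.
Lemma lmapZ a x : lmap (a *: x) = a *: lmap x.
Proof. exact: (islinZ lin_lmap). Qed.
Lemma lmap0 : lmap 0 = 0.
Proof. exact: (islin0 lin_lmap). Qed.
Lemma lmapD x y : lmap (x + y) = lmap x + lmap y.
Proof. exact: (islinD lin_lmap). Qed.
Lemma lmap_sum (I : Type) (r : seq I) (p : pred I) (F : I -> T R V) :
  lmap (\sum_(k <- r | p k) F k) = \sum_(k <- r | p k) lmap (F k).
Proof. exact: (islin_sum lin_lmap). Qed.
Lemma lmap_mon w : lmap (mon R w) = mon R (map f w). Proof. exact: linx_mon. Qed.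
Lemma lmap_let i : lmap (let1 R i) = let1 R (f i). Proof. exact: lmap_mon. Qed.
Lemma lmap1 : lmap 1 = 1. Proof. by rewrite -mon0 lmap_mon mon0. Qed.

Lemma lmapM x y : lmap (x * y) = lmap x * lmap y.
Proof.
move: x; apply: tens_eq => [||u]; [by apply: (lin_app lin_lmap); lin| |].
  by apply: lin_mull; exact: lin_lmap.
move: y; apply: tens_eq => [||v]; [by apply: (lin_app lin_lmap); lin| |].
  by apply: lin_mulr; exact: lin_lmap.
by rewrite monM !lmap_mon map_cat monM.
Qed.

Lemma lmap_degscale c x : lmap (degscale c x) = degscale c (lmap x).
Proof.
move: x; apply: tens_eq => [||u].
- by apply: (lin_app lin_lmap); exact: lin_degscale.
- by apply: (lin_app (@lin_degscale R W c)); exact: lin_lmap.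
by rewrite degscale_mon lmapZ lmap_mon degscale_mon size_map.
Qed.

Lemma cf_lmap_inj (injf : injective f) x w : cf (lmap x) (map f w) = cf x w.
Proof.
move: x; apply: cf_eq => [||u]; [exact: lin_lmap|exact: lin_cf|].
by rewrite lmap_mon !cf_mon (inj_eq (inj_map injf)).
Qed.

Lemma der_lmap_inj (injf : injective f) i x : der (f i) (lmap x) = lmap (der i x).
Proof.
move: x; apply: tens_eq => [||u].
- by apply: (lin_app (lin_der _)); exact: lin_lmap.
- by apply: (lin_app lin_lmap); exact: lin_der.
rewrite lmap_mon !der_mon; case: u => [|j u] /=; first by rewrite lmap0.
by rewrite lmapZ lmap_mon (inj_eq injf).
Qed.

Lemma der_lmap_out k x : (forall i, f i != k) -> der k (lmap x) = 0.
Proof.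
move=> nk; move: x; apply: tens_eq => [||u]; [|exact: lin_cst0|].
  by apply: (lin_app (lin_der _)); exact: lin_lmap.
rewrite lmap_mon der_mon; case: u => [|j u] //=.
by rewrite (negPf (nk j)) scale0r.
Qed.

Hypothesis pf : forall i, spar (f i) = spar i.

Lemma wp_map w : wp (map f w) = wp w.
Proof. by elim: w => [|i w IH] //=; rewrite ?wp_nil // !wp_cons pf IH. Qed.

Lemma lmap_J (b : bool) x : lmap (J b x) = J b (lmap x).
Proof.
move: x; apply: tens_eq => [||u].
- by apply: (lin_app lin_lmap); exact: lin_J.
- by apply: (lin_app (lin_J b)); exact: lin_lmap.
by rewrite J_mon lmapZ lmap_mon J_mon wp_map.
Qed.

Lemma lmap_ins i x : lmap (ins i x) = ins (f i) (lmap x).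
Proof.
move: x; apply: tens_eq => [||u].
- by apply: (lin_app lin_lmap); exact: lin_ins.
- by apply: (lin_app (lin_ins _)); exact: lin_lmap.
elim: u => [|j u IH]; first by rewrite mon0 lmap1 !ins1 lmap_let.
rewrite mon_cons ins_let lmapM lmap_let ins_let -IH.
by rewrite lmapD lmapZ !lmapM !lmap_let !pf.
Qed.

Lemma lmap_sym x : lmap (sym x) = sym (lmap x).
Proof.
move: x; apply: tens_eq => [||u].
- by apply: (lin_app lin_lmap); exact: lin_sym.
- by apply: (lin_app (@lin_sym R W)); exact: lin_lmap.
elim: u => [|j u IH]; first by rewrite mon0 lmap1 !sym1 lmap1.
by rewrite mon_cons lmapM !sym_let lmap_ins IH lmap_let sym_let.
Qed.
End LetterMap.

Lemma sinv_lmap (V W : superspace) (f : V -> W) (pf : forall i, spar (f i) = spar i)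
  (x : T rat V) : sinv x -> sinv (lmap f x).
Proof. by move=> sx; rewrite -(sym_nrm sx) (lmap_sym pf); exact: sinv_sym. Qed.

Section Removal.
Variables (R : comNzRingType) (V : superspace).
Implicit Types (i j k : V) (u v w : seq V) (x y z : T R V).

(** Removal of one occurrence of a letter from any place.  This is a derivation of
    the tensor algebra, in contrast to the left derivative. *)
Fixpoint wrmv k (w : seq V) : T R V :=
  if w is i :: w' then
    (i == k)%:R *: mon R w' + (-1) ^+ (spar i && spar k) *: (let1 R i * wrmv k w')
  else 0.
Definition rmv k : T R V -> T R V := linx (wrmv k).

Lemma lin_rem k : islin (rmv k). Proof. exact: lin_linx. Qed.

Lemma rem1 k : rmv k 1 = 0.
Proof. by rewrite -mon0 /rmv linx_mon. Qed.

Lemma rem_let k i x : rmv k (let1 R i * x) =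
  (i == k)%:R *: x + (-1) ^+ (spar i && spar k) *: (let1 R i * rmv k x).
Proof.
move: x; apply: tens_eq => [||w].
- by apply: (lin_app (lin_rem k)); lin.
- apply: lin_add; first by lin.
  by apply: lin_scale; apply: lin_mulr; exact: lin_rem.
by rewrite -mon_cons /rmv !linx_mon.
Qed.

(** Every letter of a word comes first in the same number of its permutations, so the
    left derivative of a symmetrization is the symmetrization of a removal. *)
Lemma der_sym k x : der k (sym x) = sym (rmv k x).
Proof.
move: x; apply: tens_eq => [||w].
- by apply: (lin_app (lin_der k)); exact: lin_sym.
- by apply: (lin_app (@lin_sym R V)); exact: lin_rem.
elim: w => [|i w IH].
  by rewrite mon0 sym1 der1 rem1 sym0.
rewrite mon_cons sym_let der_ins rem_let symD.
by rewrite !symZ sym_let IH.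
Qed.

Lemma remM k x y : rmv k (x * y) = rmv k x * y + J (spar k) x * rmv k y.
Proof.
move: x; apply: tens_eq => [||w].
- by apply: (lin_app (lin_rem k)); lin.
- apply: lin_add; first by apply: lin_mull; exact: lin_rem.
  by apply: lin_mull; exact: lin_J.
elim: w => [|i w IH]; first by rewrite mon0 J1 rem1 !mul1r mul0r add0r.
rewrite mon_cons rem_let JM J_let -mulrA rem_let IH !mulrDl -!scalerAl -!mulrA.
by rewrite mulrDr scalerDr addrA [spar k && _]andbC.
Qed.

(** For an invariant, all places from which a letter can be removed are alike. *)
Lemma cf_rem_sinv k x w : sinv x -> cf (rmv k x) w = (size w).+1%:R * cf x (k :: w).
Proof.
elim: w x => [|a w IH] x sx; rewrite {1}[x]letters (islinD (lin_rem k));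
  rewrite (islinZ (lin_rem k)) rem1 scaler0 add0r (islin_sum (lin_rem k)) cf_sum.
  rewrite (bigD1 k) //= big1 ?addr0 => [|i /negPf ne].
    by rewrite rem_let cfD !cfZ cf_let eqxx mulr0 addr0 cf_der.
  by rewrite rem_let cfD !cfZ cf_let ne mulr0 mul0r addr0.
transitivity (\sum_i ((i == k)%:R * cf x [:: i, a & w] + (i == a)%:R *
   ((-1) ^+ (spar i && spar k) * ((size w).+1%:R * cf x [:: i, k & w])))).
  apply: eq_bigr => i _; rewrite rem_let cfD !cfZ cf_let cf_der.
  by rewrite (IH _ (sinv_der i sx)) cf_der mulrCA.
rewrite big_split /= (bigD1 k) //= eqxx mul1r big1 ?addr0; last first.
  by move=> i /negPf ->; rewrite mul0r.
rewrite (bigD1 a) //= eqxx mul1r big1 ?addr0; last first.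
  by move=> i /negPf ->; rewrite mul0r.
have /= -> := sx [::] a k w.
rewrite [X in _ + _ * X]mulrCA [X in _ + X]mulrA -signr_addb addbb mul1r.
by rewrite -[in RHS]natr1 mulrDl mul1r addrC.
Qed.

End Removal.

Section RemovalMap.
Variables (R : comNzRingType) (V W : superspace) (f : V -> W).
Hypothesis pf : forall i, spar (f i) = spar i.

Lemma rem_lmap_inj (injf : injective f) k (x : T R V) :
  rmv (f k) (lmap f x) = lmap f (rmv k x).
Proof.
move: x; apply: tens_eq => [||w].
- by apply: (lin_app (lin_rem _)); exact: lin_lmap.
- by apply: (lin_app (@lin_lmap R V W f)); exact: lin_rem.
elim: w => [|i w IH]; first by rewrite mon0 lmap1 !rem1 lmap0.
rewrite mon_cons lmapM lmap_let !rem_let IH (inj_eq injf) !pf.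
by rewrite lmapD !lmapZ lmapM lmap_let.
Qed.

Lemma rem_lmap_out k (x : T R V) : (forall i, f i != k) -> rmv k (lmap f x) = 0.
Proof.
move=> nk; move: x; apply: tens_eq => [||w].
- by apply: (lin_app (lin_rem _)); exact: lin_lmap.
- exact: lin_cst0.
elim: w => [|i w IH]; first by rewrite mon0 lmap1 rem1.
by rewrite mon_cons lmapM lmap_let rem_let IH (negPf (nk i)) mulr0 !scaler0 scale0r addr0.
Qed.
End RemovalMap.

Section Deconcatenation.
Variables (R : comNzRingType) (V : superspace) (W : lmodType R).
Implicit Types (i j k : V) (u v w : seq V) (x y z : T R V) (G : seq V -> seq V -> W).

(** Cutting a word in all places is the coproduct; this evaluates a bilinear map on
    it. *)
Definition wdsum G w : W := \sum_(m < (size w).+1) G (take m w) (drop m w).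
Definition dsum G : T R V -> W := linx (wdsum G).

Lemma lin_dsum G : islin (dsum G). Proof. exact: lin_linx. Qed.

Lemma dsum_mon G w : dsum G (mon R w) = wdsum G w. Proof. exact: linx_mon. Qed.

Lemma eq_dsum G G' x : (forall u v, G u v = G' u v) -> dsum G x = dsum G' x.
Proof.
move=> GG; rewrite /dsum !linxE; apply: eq_bigr => w _; congr (_ *: _).
by apply: eq_bigr => m _.
Qed.

Lemma dsum_eq0 G x : (forall u v, G u v = 0) -> dsum G x = 0.
Proof.
move=> G0; rewrite /dsum linxE big1 // => w _.
by rewrite /wdsum big1 ?scaler0.
Qed.

Lemma dsumZ G c x : dsum (fun u v => c *: G u v) x = c *: dsum G x.
Proof.
rewrite /dsum !linxE scaler_sumr; apply: eq_bigr => w _.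
by rewrite /wdsum -scaler_sumr !scalerA mulrC.
Qed.

Lemma dsum_J G (b : bool) x :
  dsum G (J b x) = dsum (fun u v => (-1) ^+ (b && (wp u (+) wp v)) *: G u v) x.
Proof.
move: x; apply: tens_eq => [||w]; [|exact: lin_dsum|].
  by apply: (lin_app (lin_dsum _)); exact: lin_J.
rewrite J_mon (islinZ (lin_dsum _)) !dsum_mon scaler_sumr; apply: eq_bigr => m _.
by rewrite -wp_cat cat_take_drop.
Qed.

(** The cut is before the first letter or behind it; this allows induction on the
    first factor by left derivatives. *)
Lemma dsum_rec G x : dsum G x = linx (fun w => G [::] w) x +
  \sum_k dsum (fun u v => G (k :: u) v) (der k x).
Proof.
move: x; apply: tens_eq => [||w]; first exact: lin_dsum.
  apply: lin_add; first exact: lin_linx.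
  by apply: lin_sum => k; apply: (lin_app (lin_dsum _)); exact: lin_der.
rewrite dsum_mon linx_mon /wdsum big_ord_recl take0 drop0; congr (_ + _).
case: w => [|k w].
  by rewrite big_ord0 big1 // => k _; rewrite der_mon (islin0 (lin_dsum _)).
rewrite [RHS](bigD1 k) //= der_mon /= eqxx scale1r dsum_mon [X in _ = _ + X]big1 ?addr0 //.
by move=> i /negPf ne; rewrite der_mon /= eq_sym ne scale0r (islin0 (lin_dsum _)).
Qed.

Definition splits x : seq (seq V * seq V) :=
  [seq (take m w, drop m w) | w <- supp x, m <- iota 0 (size w).+1].

Lemma splits_uniq x : uniq (splits x).
Proof.
apply: allpairs_uniq_dep => [|w _|]; [exact: supp_uniq|exact: iota_uniq|].
move=> [w m] [w' m'] /allpairsPdep [w1 [m1 [_ lm e1]]].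
move=> /allpairsPdep [w2 [m2 [_ lm' e2]]] /= [et ed].
case: e1 => ? ?; case: e2 => ? ?; subst.
have ww : w1 = w2 by rewrite -(cat_take_drop m1 w1) et ed cat_take_drop.
subst; move: lm lm'; rewrite !mem_iota !add0n !ltnS /= => lm lm'.
by have := congr1 size et; rewrite !size_takel // => ->.
Qed.

Lemma mem_splits x (p : seq V * seq V) :
  (p \in splits x) = (cf x (p.1 ++ p.2) != 0).
Proof.
rewrite -mem_supp; apply/allpairsPdep/idP => [[w [m [ws _ ->]]]|ps].
  by rewrite cat_take_drop.
exists (p.1 ++ p.2), (size p.1); split=> //.
  by rewrite mem_iota ltnS size_cat leq_addr.
by rewrite take_size_cat // drop_size_cat // -surjective_pairing.
Qed.

Lemma dsumE G x :
  dsum G x = \sum_(p <- splits x) cf x (p.1 ++ p.2) *: G p.1 p.2.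
Proof.
rewrite /dsum linxE big_allpairs_dep; apply: eq_bigr => w _ /=.
rewrite /wdsum scaler_sumr -(big_mkord xpredT (fun m => cf x w *: G (take m w) (drop m w))).
by rewrite /index_iota subn0; apply: eq_bigr => m _; rewrite cat_take_drop.
Qed.

Lemma dsumEw G x (D : seq (seq V * seq V)) : uniq D -> {subset splits x <= D} ->
  dsum G x = \sum_(p <- D) cf x (p.1 ++ p.2) *: G p.1 p.2.
Proof.
move=> uD sD; rewrite dsumE [RHS](bigID (mem (splits x))) /=.
rewrite [X in _ = _ + X]big1 ?addr0.
  rewrite -[RHS]big_filter; apply: perm_big; apply: uniq_perm.
  - exact: splits_uniq.
  - exact: filter_uniq.
  by move=> p; rewrite mem_filter; case: (boolP (p \in splits x)) => // /sD ->.
by move=> p; rewrite mem_splits negbK => /eqP ->; rewrite scale0r.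
Qed.

(** Exchanging the two parts of a word changes the coefficient of an invariant only by
    a sign. *)
Lemma dsumC G x : sinv x ->
  dsum G x = dsum (fun u v => (-1) ^+ (wp u && wp v) *: G v u) x.
Proof.
move=> sx; rewrite !dsumE.
pose sw (p : seq V * seq V) := (p.2, p.1).
have swK : involutive sw by case.
have cfsw p : cf x ((sw p).1 ++ (sw p).2) =
    (-1) ^+ (wp p.1 && wp p.2) * cf x (p.1 ++ p.2).
  by rewrite (sinv_catC _ _ sx) andbC.
have pr : perm_eq (splits x) (map sw (splits x)).
  apply: uniq_perm; rewrite ?(map_inj_uniq (inv_inj swK)) ?splits_uniq //.
  move=> p; rewrite -{2}[p]swK (mem_map (inv_inj swK)) !mem_splits cfsw.
  by case: (_ && _); rewrite ?mulN1r ?oppr_eq0 // mul1r.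
rewrite [LHS](perm_big _ pr) big_map; apply: eq_bigr => p _.
by rewrite cfsw scalerA mulrC.
Qed.

End Deconcatenation.

Section DeconcatenationLinear.
Variables (R : comNzRingType) (V : superspace) (U W : lmodType R).
Implicit Types (x : T R V) (G : seq V -> seq V -> U).

Lemma dsum_app (F : U -> W) G x : islin F ->
  F (dsum G x) = dsum (fun u v => F (G u v)) x.
Proof.
move=> lF; rewrite /dsum !linxE islin_sum //; apply: eq_bigr => w _.
by rewrite islinZ // /wdsum islin_sum.
Qed.

Lemma lin_dsum_par (I : lmodType R) (F : I -> seq V -> seq V -> W) x :
  (forall u v, islin (fun y => F y u v)) -> islin (fun y => dsum (F y) x).
Proof.
move=> lF a y z; rewrite /dsum !linxE scaler_sumr -big_split; apply: eq_bigr => w _.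
rewrite /= !scalerA mulrC -scalerA -scalerDr; congr (_ *: _).
by rewrite /wdsum scaler_sumr -big_split; apply: eq_bigr => m _; rewrite lF.
Qed.
End DeconcatenationLinear.

Lemma dsum_exchange (R : comNzRingType) (V V' : superspace) (W : lmodType R)
    (F : seq V -> seq V -> seq V' -> seq V' -> W) (x : T R V) (y : T R V') :
  dsum (fun u v => dsum (F u v) y) x =
  dsum (fun u' v' => dsum (fun u v => F u v u' v') x) y.
Proof.
rewrite (dsumE _ x) (dsumE _ y).
under eq_bigr => p _ do rewrite dsumE scaler_sumr.
rewrite sum_exchange; apply: eq_bigr => q _.
rewrite dsumE scaler_sumr; apply: eq_bigr => p _.
by rewrite !scalerA mulrC.
Qed.

(** * Products of shuffles in the trivial extension *)

Section SymRat.
Variable V : superspace.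
Implicit Types (x y z : T rat V).

Lemma sym_mulC x v : sym (x * mon rat v) = sym (mon rat v * J (wp v) x).
Proof.
move: x; apply: tens_eq => [||u].
- by apply: (lin_app (@lin_sym _ V)); lin.
- by apply: (lin_app (@lin_sym _ V)); apply: lin_mulr; exact: lin_J.
by rewrite sym_catC J_mon -scalerAr symZ andbC.
Qed.

Lemma sym_mulC_homog (q : bool) x y :
  J true y = (-1) ^+ q *: y -> sym (y * x) = sym (J q x * y).
Proof.
move=> hy; move: x; apply: tens_eq => [||u].
- by apply: (lin_app (@lin_sym _ V)); lin.
- by apply: (lin_app (@lin_sym _ V)); apply: lin_mull; exact: lin_J.
rewrite sym_mulC J_mon; case: (wp u); rewrite ?andbF ?J0 ?scale1r // andbT hy.
by rewrite -scalerAr -scalerAl.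
Qed.

Lemma sym_nrm_mulr x y : sym (x * nrm (sym y)) = sym (x * y).
Proof. by apply: sym_eqr; exact: sym_nrm_sym. Qed.

Lemma sym_nrm_mull x y : sym (nrm (sym x) * y) = sym (x * y).
Proof. by apply: sym_eql; exact: sym_nrm_sym. Qed.

End SymRat.

Lemma degscale_J (R : comNzRingType) (V : superspace) c (b : bool) (x : T R V) :
  degscale c (J b x) = J b (degscale c x).
Proof. by apply/cfP => w; rewrite cf_degscale !cf_J cf_degscale mulrCA. Qed.

Section Trivext.
Variable (R : comNzRingType) (X : superalgebra).
Local Notation V := (sspace X).
Local Notation VT := (sspace (trivext X)).

Definition il (i : V) : VT := inl i.
Definition ir (i : dualsp V) : VT := inr i.

Lemma il_inj : injective il. Proof. by move=> i j []. Qed.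
Lemma ir_inj : injective ir. Proof. by move=> i j []. Qed.
Lemma spar_il i : spar (il i) = spar i. Proof. by []. Qed.
Lemma spar_ir i : spar (ir i) = spar i. Proof. by []. Qed.

Definition iX : T R V -> T R VT := lmap il.
Definition iD : T R (dualsp V) -> T R VT := lmap ir.

Lemma vpair0l (x : X) : vpair 0 x = 0.
Proof. by rewrite /vpair big1 // => l _; rewrite ffunE mul0r. Qed.

Lemma str_ll i j k : str R (il i) (il j) k =
  if k is inl k' then str R i j k' else 0.
Proof.
rewrite /str /= ffunE; case: k => k //=.
by rewrite ffunE ffunE ffunE !vpair0l addr0.
Qed.

Lemma str_rr i j k : str R (ir i) (ir j) k = 0.
Proof.
rewrite /str /= ffunE; case: k => k /=; first by rewrite mulr0 scoord0 ffunE.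
by rewrite ffunE !ffunE mulr0 mul0r !vpair0r addr0.
Qed.

Lemma lmul_rr i j : lmul R (ir i) (ir j) = 0.
Proof. by rewrite lmulE big1 // => k _; rewrite str_rr scale0r. Qed.

Lemma lmul_ll i j : lmul R (il i) (il j) = iX (lmul R i j).
Proof.
rewrite !lmulE /iX lmap_sum big_sumType /=.
rewrite [X in _ + X]big1 ?addr0 => [|k _]; last by rewrite str_ll scale0r.
by apply: eq_bigr => k _; rewrite str_ll lmapZ lmap_let.
Qed.

Lemma iX_tm x y : iX (tm x y) = tm (iX x) (iX y).
Proof.
move: y; apply: tens_eq => [||w].
- by apply: (lin_app (@lin_lmap _ _ _ il)); exact: lin_tmr.
- by apply: (lin_app (lin_tmr _)); exact: lin_lmap.
move: x; apply: tens_eq => [||u].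
- by apply: (lin_app (@lin_lmap _ _ _ il)); exact: lin_tml.
- by apply: (lin_app (lin_tml _)); exact: lin_lmap.
rewrite /iX !lmap_mon !tm_mon; elim: u w => [|i u IH] [|j w] /=;
  rewrite ?lmap0 ?lmap1 //.
rewrite lmapZ lmapM IH lmul_ll.
by rewrite (wp_map spar_il).
Qed.

(** Products of two dual vectors vanish, so a dual letter has to meet a letter of X. *)
Lemma tm_iD_letl i x c : tm (let1 R (ir i) * x) c =
  \sum_k lmul R (ir i) (il k) * tm (J (spar k) x) (der (il k) c).
Proof.
rewrite tm_letl big_sumType /= [X in _ + X]big1 ?addr0 // => k _.
by rewrite lmul_rr mul0r.
Qed.

End Trivext.

Section Phi.
Variable X : superalgebra.
Local Notation V := (sspace X).
Local Notation VT := (sspace (trivext X)).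
Implicit Types (x eta xi : T rat V) (y : T rat (dualsp V)).

(** For invariant x, the shuffle product of x with the symmetrization of y. *)
Definition Phi x y : T rat VT := sym (nrm (iX x) * iD y).

Lemma lin_Phil y : islin (fun x => Phi x y).
Proof.
apply: (lin_app (@lin_sym _ VT)); apply: lin_mull.
by apply: (lin_app (@lin_nrm VT)); exact: lin_lmap.
Qed.

Lemma lin_Phir x : islin (Phi x).
Proof. by apply: (lin_app (@lin_sym _ VT)); apply: lin_mulr; exact: lin_lmap. Qed.

Lemma sinv_Phi x y : sinv (Phi x y). Proof. exact: sinv_sym. Qed.

(** Only the factor x has letters of X, and division by the factorial turns the removal
    of a letter from an invariant into a left derivative. *)
Lemma der_Phi k eta y : sinv eta -> der (il k) (Phi eta y) = Phi (der k eta) y.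
Proof.
move=> se; have e : rmv k (nrm eta) = nrm (der k eta).
  apply/cfP => w; rewrite cf_rem_sinv; last exact: sinv_degscale.
  rewrite !cf_degscale cf_der /= factS natrM invfM mulrA mulrA divff ?mul1r //.
  by rewrite pnatr_eq0.
rewrite der_sym remM /iD (@rem_lmap_out _ _ _ (@ir X)) // mulr0 addr0.
rewrite /Phi; congr (sym (_ * _)); rewrite /iX /nrm -!lmap_degscale.
by rewrite (rem_lmap_inj (@spar_il X) (@il_inj X)) [rmv _ _]e.
Qed.

(** All letters of the dual word a have to meet letters of X in the other factor, and
    these all come from eta; what is left of eta forms, with y, again a product Phi. *)
Lemma tm_iD_Phi a (x : T rat VT) eta y : sinv eta ->
  tm (iD (mon rat a) * x) (Phi eta y) =
  dsum (fun w1 w2 => tm (iD (mon rat a)) (iX (mon rat w1)) *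
                     tm (J (wp w1) x) (Phi (mon rat w2) y)) eta.
Proof.
elim: a x eta => [|i a IH] x eta se.
  rewrite mon0 /iD lmap1 mul1r dsum_rec [X in _ + X]big1 ?addr0 => [|k _].
    transitivity (linx (fun w => tm x (Phi (mon rat w) y)) eta).
      move: eta {se}; apply: tens_eq => [||w]; [|exact: lin_linx|by rewrite linx_mon].
      by apply: (lin_app (lin_tmr _)); exact: lin_Phil.
    by apply: eq_linx => w; rewrite mon0 /iX lmap1 tm1l -mon0 cf_mon eqxx scale1r
      mon0 mul1r wp_nil J0.
  by apply: dsum_eq0 => u v; rewrite /iX lmap_mon /= mon_cons tm_1let mul0r.
rewrite mon_cons /iD lmapM lmap_let -mulrA tm_iD_letl dsum_rec.
rewrite [X in _ = X + _](_ : _ = 0) ?add0r; last first.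
  by rewrite linxE big1 // => w _; rewrite mon0 /iX lmap1 tm_let1 mul0r scaler0.
apply: eq_bigr => k _; rewrite der_Phi // JM lmap_mon J_mon -scalerAl.
rewrite tmZl -lmap_mon -/(iD _) IH; last exact: sinv_der.
rewrite -scalerAr (dsum_app (F := fun z => lmul rat (ir i) (il k) * z)); last by lin.
rewrite -dsumZ; apply: eq_dsum => u v.
rewrite /iX !lmap_mon /= mon_cons /iD lmap_mon tm_let J_mon tmZl.
by rewrite JJ wp_cons addbC -scalerAr -scalerAl !mulrA.
Qed.

(** The letters of the word w in X are met by an initial part of x, and z by the
    rest. *)
Lemma tm_split x w z : tm (iX x) (iX (mon rat w) * z) =
  dsum (fun u v => (-1) ^+ (wp v && wp w) *:
     (tm (iX (mon rat u)) (iX (mon rat w)) * tm (iX (mon rat v)) z)) x.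
Proof.
elim: w x => [|j w IH] x.
  rewrite mon0 /iX lmap1 mul1r dsum_rec [X in _ + X]big1 ?addr0 => [|k _].
    transitivity (linx (fun w => tm (iX (mon rat w)) z) x).
      move: x; apply: tens_eq => [||w]; [|exact: lin_linx|by rewrite linx_mon].
      by apply: (lin_app (lin_tml _)); exact: lin_lmap.
    apply: eq_linx => w; rewrite mon0 lmap1 tm1l -mon0 cf_mon eqxx scale1r.
    by rewrite mon0 mul1r wp_nil andbF scale1r.
  apply: dsum_eq0 => u v; rewrite lmap_mon /= mon_cons tm_let1 mul0r.
  by rewrite scaler0.
rewrite mon_cons /iX lmapM lmap_let -mulrA tm_letr big_sumType /=.
rewrite [X in _ + X]big1 ?addr0 => [|k _]; last first.
  rewrite (@der_lmap_out _ _ _ (@il X)) // J_0.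
  by rewrite tm0l mulr0.
rewrite dsum_rec [X in _ = X + _](_ : _ = 0) ?add0r; last first.
  by rewrite linxE big1 // => u _; rewrite mon0 lmap1 tm_1let mul0r !scaler0.
apply: eq_bigr => i _; rewrite (der_lmap_inj (@il_inj X)) -(lmap_J (@spar_il X)).
rewrite -/(iX _) -/(iX (mon rat w)) IH dsum_J.
rewrite (dsum_app (F := fun z => lmul rat (il i) (il j) * z)); last by lin.
apply: eq_dsum => u v.
rewrite /iX [in RHS]lmap_mon /= mon_cons tm_let -lmap_mon -(lmap_J (@spar_il X)).
rewrite J_mon lmapZ tmZl.
rewrite wp_cons -!scalerAr -!scalerAl !scalerA -!signr_addb !mulrA spar_il.
by bcases.
Qed.

Lemma sym_tm_homog a u w1 w2 (z : T rat VT) :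
  sym (tm (iD (mon rat a)) (iX (mon rat w2)) *
       (tm (iX (mon rat u)) (iX (mon rat w1)) * z)) =
  (-1) ^+ ((wp a (+) wp w2) && (wp u (+) wp w1)) *:
  sym (tm (iX (mon rat u)) (iX (mon rat w1)) *
       (tm (iD (mon rat a)) (iX (mon rat w2)) * z)).
Proof.
have homX q : J q (tm (iD (mon rat a)) (iX (mon rat w2))) =
    (-1) ^+ (q && (wp a (+) wp w2)) *: tm (iD (mon rat a)) (iX (mon rat w2)).
  rewrite J_tm /iD /iX -(lmap_J (@spar_il X)) -(lmap_J (@spar_ir X)) !J_mon.
  rewrite !lmapZ tmZl tmZr.
  by rewrite scalerA -signr_addb andb_addr.
have homY q : J q (tm (iX (mon rat u)) (iX (mon rat w1))) =
    (-1) ^+ (q && (wp u (+) wp w1)) *: tm (iX (mon rat u)) (iX (mon rat w1)).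
  rewrite J_tm /iX -!(lmap_J (@spar_il X)) !J_mon.
  rewrite !lmapZ tmZl tmZr.
  by rewrite scalerA -signr_addb andb_addr.
rewrite !mulrA -symZ scalerAl; apply: sym_eql.
by rewrite (sym_mulC_homog _ (homX true)) homY -scalerAl.
Qed.

(** The product formula of the double.  The factor Phi xi a is the symmetrization of
    the dual word a followed by xi / n!, and symmetrization can be postponed until
    after the product with an invariant. *)
Lemma Phi_mul xi eta a y : sinv xi -> sinv eta ->
  tm (Phi xi (mon rat a)) (Phi eta y) =
  dsum (fun u1 u2 => dsum (fun w1 w2 =>
    (-1) ^+ ((wp u1 && (wp u2 (+) (wp w1 (+) wp w2) (+) wp a)) (+) (wp w1 && wp a)) *:
    sym (nrm (iX (tm (mon rat u2) (mon rat w1))) *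
         (tm (iD (mon rat a)) (iX (mon rat w2)) * tm (iX (mon rat u1)) (iD y)))) eta) xi.
Proof.
move=> sxi seta.
(* The word a is moved to the front, where it meets eta first. *)
have -> : Phi xi (mon rat a) = sym (iD (mon rat a) * J (wp a) (nrm (iX xi))).
  by rewrite /Phi /iD lmap_mon sym_mulC (wp_map (@spar_ir X)).
rewrite -sym_tml; last exact: sinv_Phi.
rewrite tm_iD_Phi // (dsum_app _ _ (@lin_sym _ VT)).
transitivity (dsum (fun w1 w2 => dsum (fun u1 u2 =>
    (-1) ^+ ((wp w1 (+) wp a) && (wp u1 (+) wp u2) (+) (wp u2 && wp w2)) *:
    ((size w2)`!%:R^-1 *: sym (tm (iD (mon rat a)) (iX (mon rat w1)) *
        (tm (iX (mon rat u1)) (iX (mon rat w2)) * tm (iX (mon rat u2)) (iD y))))) xi) eta).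
  apply: eq_dsum => w1 w2.
  rewrite JJ -degscale_J /iX -lmap_J // -/(iX _) degscale_tml.
  rewrite /Phi -sym_tmr; last first.
    by apply: sinv_lmap => //; exact: sinv_J.
  rewrite sym_nrm_mulr /nrm /iX -lmap_degscale degscale_mon.
  rewrite lmapZ -scalerAl tmZr.
  rewrite -scalerAr symZ -!/(iX _) tm_split dsum_J.
  rewrite (dsum_app (F := fun z => sym (tm (iD (mon rat a)) (iX (mon rat w1)) * z))); last first.
    by apply: (lin_app (@lin_sym _ VT)); lin.
  rewrite -dsumZ; apply: eq_dsum => u1 u2.
  rewrite -!scalerAr !symZ !scalerA; congr (_ *: _).
  by rewrite -signr_addb mulrC.
(* The formula of the double has the two halves of both coproducts in the
   opposite order. *)
rewrite -dsum_exchange dsumC //; apply: eq_dsum => u1 u2.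
rewrite dsumC // -dsumZ; apply: eq_dsum => w1 w2.
rewrite sym_tm_homog // iX_tm /nrm -degscale_tmr /iX -lmap_degscale degscale_mon.
rewrite lmapZ tmZr -scalerAl.
rewrite symZ !scalerA.
congr (_ *: _); rewrite mulrAC -!signr_addb; congr (_ * _).
by bcases.
Qed.
End Phi.

(** * Permutations, invariants and shuffles *)

Lemma odd_sum (I : finType) (P : pred I) (f g : I -> nat) :
  (forall i, P i -> odd (f i) = odd (g i)) ->
  odd (\sum_(i | P i) f i)%N = odd (\sum_(i | P i) g i)%N.
Proof. by move=> fg; elim/big_rec2: _ => // i x y Pi; rewrite !oddD fg // => ->. Qed.

Section PermSign.
Variable (V : superspace) (d : nat).
Implicit Types (g h k : 'S_d) (w : d.-tuple V) (a b c : 'I_d).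

Definition pact g w : d.-tuple V := [tuple tnth w (g a) | a < d].

Lemma pactM g h w : pact h (pact g w) = pact (h * g)%g w.
Proof. by apply: eq_from_tnth => a; rewrite !tnth_mktuple permM. Qed.

Lemma pact1 w : pact 1%g w = w.
Proof. by apply: eq_from_tnth => a; rewrite tnth_mktuple perm1. Qed.

Lemma pact_inj g : injective (pact g).
Proof.
move=> w w' e; rewrite -[w]pact1 -[w']pact1 -[1%g](mulVg g) -!pactM.
by rewrite e.
Qed.

(** For symmetric F this counts unordered pairs, hence it is unchanged under
    reindexing by a permutation. *)
Definition npairs (F : 'I_d -> 'I_d -> bool) : nat :=
  (\sum_(a < d) \sum_(c < d | a < c) F a c)%N.

Lemma npairs_perm F k : (forall a c, F a c = F c a) ->
  npairs (fun a c => F (k a) (k c)) = npairs F.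
Proof.
have dbl G : (forall a c, G a c = G c a) ->
    ((npairs G).*2 = \sum_(a < d) \sum_(c < d | c != a) G a c)%N.
  move=> sG; rewrite -addnn {2}/npairs.
  have -> : (\sum_(a < d) \sum_(c < d | a < c) G a c = \sum_(a < d) \sum_(c < d | c < a) G a c)%N.
    rewrite (exchange_big_dep xpredT) //=; apply: eq_bigr => c _.
    by apply: eq_bigr => a _; rewrite sG.
  rewrite -big_split; apply: eq_bigr => a _ /=.
  rewrite [RHS](bigID (fun c : 'I_d => a < c)%N) /=; congr (_ + _)%N; apply: eq_bigl => c;
   by rewrite -(inj_eq val_inj) /=; lia.
move=> sF; apply: double_inj; rewrite !dbl //.
rewrite [RHS](reindex_inj (@perm_inj _ k)); apply: eq_bigr => a _.
rewrite [RHS](reindex_inj (@perm_inj _ k)); apply: eq_bigl => c.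
by rewrite (inj_eq perm_inj).
Qed.

Lemma odd_npairsD F G : odd (npairs (fun a c => F a c (+) G a c)) =
  odd (npairs F) (+) odd (npairs G).
Proof.
rewrite -oddD /npairs -big_split /=.
apply: odd_sum => a _; rewrite -big_split; apply: odd_sum => c _.
by rewrite oddD !oddb.
Qed.

Definition flips k a c := (a < c)%N (+) (k a < k c)%N.

Lemma flipsC k a c : a != c -> flips k a c = flips k c a.
Proof.
move=> ne; rewrite /flips.
have ne' : k a != k c by rewrite (inj_eq perm_inj).
by move: ne ne'; rewrite -!(inj_eq val_inj) /=; lia.
Qed.

Definition asg w g : bool := odd (act_sign w g).

Lemma asgE w g : asg w g = odd (npairs (fun a c =>
  [&& flips g^-1 a c, spar (tnth w a) & spar (tnth w c)])).
Proof.
rewrite /asg /act_sign /npairs; congr odd; apply: eq_bigr => a _.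
rewrite big_mkcondr /=; apply: eq_bigr => c ac.
rewrite /flips ac addTb -leqNgt.
have ne : (g^-1%g c : nat) != g^-1%g a.
  by rewrite (inj_eq val_inj) (inj_eq perm_inj) neq_ltn ac orbT.
by move: ne; case: ltngtP => // _ _; case: (spar _); case: (spar _).
Qed.

(** Cocycle identity: a pair of positions is flipped by a product iff it is flipped by
    exactly one of the factors. *)
Lemma asgM w g h : asg w (h * g)%g = asg w g (+) asg (pact g w) h.
Proof.
rewrite !asgE.
pose F a c := [&& flips h^-1 a c, spar (tnth w (g a)), spar (tnth w (g c)) & a != c].
have -> : odd (npairs (fun a c => [&& flips h^-1 a c, spar (tnth (pact g w) a)
      & spar (tnth (pact g w) c)])) = odd (npairs (fun a c => F (g^-1%g a) (g^-1%g c))).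
  rewrite npairs_perm => [|a c]; last first.
    rewrite /F andbCA [in RHS]andbCA; case: eqVneq => [->|ne] //.
    by rewrite flipsC // [in RHS]andbCA; do !case: (spar _); rewrite ?andbF ?andbT.
  congr odd; apply: eq_bigr => a _; apply: eq_bigr => c ac.
  rewrite /F !tnth_mktuple; have -> : a != c by rewrite neq_ltn ac.
  by rewrite andbT.
rewrite -odd_npairsD; congr odd; apply: eq_bigr => a _; apply: eq_bigr => c ac.
rewrite /F !permKV (inj_eq perm_inj).
have -> : a != c by rewrite neq_ltn ac.
rewrite andbT /flips invMg !permM ac.
by do 2!case: (spar _); rewrite ?andbF ?andbT //; do 2!case: (_ < _)%N.
Qed.

Lemma asg1 w : asg w 1%g = false.
Proof.
rewrite asgE /npairs; apply/negbTE; rewrite big1 // => a _; rewrite big1 // => c ac.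
by rewrite /flips invg1 !perm1 addbb.
Qed.

End PermSign.

Lemma tperm_adjacent_mono d (x y a c : 'I_d) : y = x.+1 :> nat ->
  (a < c)%N -> (a, c) != (x, y) -> (tperm x y a < tperm x y c)%N.
Proof.
have ne (u v : 'I_d) : u <> v -> (u : nat) <> v by move=> uv /val_inj.
move=> yx; case: (tpermP x y a) => [->|->|/ne ax /ne ay];
  case: (tpermP x y c) => [->|->|/ne cx /ne cy]; rewrite xpair_eqE -!val_eqE /=; lia.
Qed.

Section PermSwapping.
Variables (R : comNzRingType) (V : superspace) (W : lmodType R) (f : seq V -> W).
Hypothesis sf : swapping f.

Lemma adjacent_action d (x y : 'I_d) (w : d.-tuple V) : y = x.+1 :> nat ->
  [/\ tval w = take x w ++ [:: tnth w x, tnth w y & drop y.+1 w],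
    tval (pact (tperm x y) w) = take x w ++ [:: tnth w y, tnth w x & drop y.+1 w] &
    asg w (tperm x y) = spar (tnth w x) && spar (tnth w y)].
Proof.
move=> yx.
have sw := size_tuple w; have lx := ltn_ord x; have ly := ltn_ord y.
pose i0 := tnth w x.
have wE : tval w = take x w ++ [:: tnth w x, tnth w y & drop y.+1 w].
  rewrite -{1}(cat_take_drop x w) (drop_nth i0) ?sw // -yx (drop_nth i0) ?sw //.
  by rewrite !(tnth_nth i0).
split=> //.
  apply: (@eq_from_nth _ i0) => [|k].
    rewrite size_tuple size_cat /= size_take size_drop sw lx; lia.
  rewrite size_tuple => kd; have -> : nth i0 (pact (tperm x y) w) k =
      nth i0 w (tperm x y (Ordinal kd)).
    by rewrite -(tnth_nth i0 _ (Ordinal kd)) tnth_mktuple (tnth_nth i0).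
  rewrite {1}wE !nth_cat size_take sw lx.
  case: tpermP => [/(congr1 val) /= -> | /(congr1 val) /= -> |
                   /eqP nx /eqP ny] /=.
  - by rewrite yx ltnn subnn ltnNge leqnSn /= subSnn.
  - by rewrite yx ltnn subnn ltnNge leqnSn /= subSnn.
  rewrite -!(inj_eq val_inj) /= in nx ny; case: ltnP => // xk.
  have -> : (k - x = (k - y.+1).+2)%N by lia.
  by [].
rewrite asgE /npairs (bigD1 x) //= (bigD1 y) /= ?yx // tpermV.
rewrite {1}/flips tpermL tpermR yx ltnSn ltnNge leqnSn /=.
rewrite !big1 ?addn0 ?oddb // => [a ax|c /andP [xc cy]].
  rewrite big1 // => c ac; rewrite /flips ac tperm_adjacent_mono //.
  by rewrite xpair_eqE (negPf ax).
rewrite /flips xc tperm_adjacent_mono //.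
by rewrite xpair_eqE (negPf cy) andbF.
Qed.

(** Adjacent transpositions generate, and both sides are compatible with products. *)
Lemma swapping_perm d (g : 'S_d) (w : d.-tuple V) :
  f (pact g w) = (-1) ^+ asg w g *: f w.
Proof.
pose Q (g : 'S_d) := forall w : d.-tuple V, f (pact g w) = (-1) ^+ asg w g *: f w.
have Q1 : Q 1%g by move=> v; rewrite pact1 asg1 scale1r.
have QM g1 g2 : Q g1 -> Q g2 -> Q (g1 * g2)%g.
  by move=> q1 q2 v; rewrite -pactM q1 q2 scalerA -signr_addb asgM addbC.
have Qadj (x y : 'I_d) : y = x.+1 :> nat -> Q (tperm x y).
  move=> yx v; have [e1 e2 ->] := adjacent_action v yx.
  by rewrite [in RHS]e1 e2 sf andbC.
(* A transposition at distance n.+1 is conjugate to one at distance n. *)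
have Qlt n : forall x y : 'I_d, y = (x + n).+1 :> nat -> Q (tperm x y).
  elim: n => [|n IH] x y yx; first by apply: Qadj; rewrite yx addn0.
  have lz : ((x + n).+1 < d)%N by have := ltn_ord y; lia.
  pose z := Ordinal lz.
  have zy : tperm z y = (tperm z y)^-1%g by rewrite tpermV.
  have -> : tperm x y = (tperm z y * tperm x z * tperm z y)%g.
    rewrite {1}zy -mulgA -[(_^-1 * _)%g]/(tperm x z ^ tperm z y)%g tpermJ tpermL.
    by rewrite tpermD // -(inj_eq val_inj) /=; lia.
  have Qzy : Q (tperm z y) by apply: Qadj; rewrite /= yx addnS.
  by apply: QM (QM _ _ Qzy (IH _ _ _)) Qzy.
have Qt (x y : 'I_d) : Q (tperm x y).
  have [xy|yx|/val_inj ->] := ltngtP x y; last by rewrite tperm1.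
    by apply: (Qlt (y - x.+1)%N); lia.
  by rewrite tpermC; apply: (Qlt (x - y.+1)%N); lia.
suff: Q g by apply.
case: (prod_tpermP g) => ts -> _; elim: ts => [|t ts IH]; first by rewrite big_nil.
by rewrite big_cons; apply: QM.
Qed.
End PermSwapping.

Section Invariants.
Variables (R : comNzRingType) (V : superspace).
Implicit Types (t : tens R V) (x : T R V).

Lemma sign_asg d (w : d.-tuple V) g : (-1) ^+ act_sign w g = (-1) ^+ asg w g :> R.
Proof. by rewrite /asg signr_odd. Qed.

Definition wa d (g : 'S_d) (w : d.-tuple V) : T R V :=
  (-1) ^+ asg w g *: mon R (pact g w).

Lemma of_wact d (g : 'S_d) (w : d.-tuple V) : of_tens (wact R g w) = wa g w.
Proof. by rewrite /wact malgUE of_tensZ sign_asg. Qed.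

Lemma of_tact d (g : 'S_d) t : of_tens (tact g t) =
  \sum_(w : d.-tuple V) cf (of_tens t) w *: wa g w.
Proof.
rewrite /tact of_tens_sum; apply: eq_bigr => w _.
by rewrite of_tensZ of_wact /cf of_tensK.
Qed.

Lemma of_tdeg d t : of_tens (tdeg d t) =
  \sum_(w : d.-tuple V) cf (of_tens t) w *: mon R w.
Proof.
rewrite /tdeg of_tens_sum; apply: eq_bigr => w _.
by rewrite malgUE of_tensZ /cf of_tensK.
Qed.

Lemma cf_sum_tuple d (F : d.-tuple V -> R) (v : d.-tuple V) :
  cf (\sum_(w : d.-tuple V) F w *: mon R w) v = F v.
Proof.
rewrite cf_sum (bigD1 v) //= cfZ cf_mon eqxx mulr1 big1 ?addr0 // => w ne.
by rewrite cfZ cf_mon (inj_eq val_inj) (negPf ne) mulr0.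
Qed.

Lemma cf_sum_wa d (g : 'S_d) (F : d.-tuple V -> R) (w : d.-tuple V) :
  cf (\sum_(v : d.-tuple V) F v *: wa g v) (pact g w) = (-1) ^+ asg w g * F w.
Proof.
rewrite cf_sum (bigD1 w) // -[RHS]addr0; congr (_ + _).
  by rewrite !cfZ cf_mon eqxx mulr1 mulrC.
rewrite big1 // => v /andP [_ ne].
by rewrite !cfZ cf_mon (inj_eq val_inj) (inj_eq (@pact_inj V d g)) (negPf ne) !mulr0.
Qed.

Lemma cf_pact x d (g : 'S_d) (w : d.-tuple V) : sinv x ->
  cf x (pact g w) = (-1) ^+ asg w g * cf x w.
Proof. by move=> sx; exact: (swapping_perm (sinv_swapping sx)). Qed.

(** One direction uses adjacent transpositions only, the other one that they
    generate the symmetric group. *)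
Lemma inv_sinv t : Defs.inv t <-> sinv (of_tens t).
Proof.
split=> [it u i j v|st d g]; last first.
  apply: (can_inj (@of_tensK R V)); rewrite of_tact of_tdeg.
  rewrite [RHS](reindex_inj (@pact_inj V d g)); apply: eq_bigr => w _.
  by rewrite cf_pact // /wa scalerA mulrC.
pose w := in_tuple (u ++ [:: i, j & v]).
have lx : (size u < size (u ++ [:: i, j & v]))%N by rewrite size_cat /=; lia.
have ly : ((size u).+1 < size (u ++ [:: i, j & v]))%N by rewrite size_cat /=; lia.
pose x := Ordinal lx; pose y := Ordinal ly.
have [//|e1 e2 e3] := @adjacent_action V _ x y w.
have wx : tnth w x = i by rewrite (tnth_nth i) /= nth_cat ltnn subnn.
have wy : tnth w y = j by rewrite (tnth_nth i) /= nth_cat ltnNge leqnSn /= subSnn.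
have dw : drop y.+1 w = v by rewrite /= drop_cat ltnNge -addn2 leq_addr /= addKn /= drop0.
rewrite wx wy in e3.
have {}e2 : tval (pact (tperm x y) w) = u ++ [:: j, i & v].
  by rewrite e2 wx wy dw /= take_size_cat.
have := congr1 (fun s => cf (of_tens s) (pact (tperm x y) w)) (it _ (tperm x y)).
rewrite of_tact of_tdeg cf_sum_wa cf_sum_tuple e3 e2 => <-.
by rewrite mulrA -signr_addb addbb mul1r.
Qed.
End Invariants.

Section Shortest.
Variables d e : nat.
Implicit Types (g h : 'S_(d + e)) (a b c : 'I_(d + e)).

Definition same_block a b := (a < d)%N == (b < d)%N.

Lemma young_block h a : h \in young d e -> (h a < d)%N = (a < d)%N.
Proof. by rewrite inE => /forallP /(_ a) /eqP. Qed.

Lemma youngM g h : g \in young d e -> h \in young d e -> (g * h)%g \in young d e.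
Proof.
move=> yg yh; rewrite inE; apply/forallP => a.
by rewrite permM !young_block.
Qed.

Lemma youngV h : h \in young d e -> (h^-1)%g \in young d e.
Proof.
move=> yh; rewrite inE; apply/forallP => a.
by rewrite -(young_block (h^-1%g a) yh) permKV.
Qed.

(** A shortest coset representative lists the elements of each block in
   increasing order: otherwise two consecutive elements of a block could be
   exchanged, which removes exactly one inversion. *)
Lemma shortest_mono g a b : g \in shortest d e -> same_block a b -> (a < b)%N ->
  ((g^-1)%g a < (g^-1)%g b)%N.
Proof.
rewrite inE => /forallP sg.
have adj (x y : 'I_(d + e)) : y = x.+1 :> nat -> same_block x y -> ((g^-1)%g x < (g^-1)%g y)%N.
  move=> yx bxy; rewrite ltnNge; apply/negP => gyx.
  have ne : x != y by rewrite -val_eqE /= yx; lia.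
  have {gyx} gyx : ((g^-1)%g y < (g^-1)%g x)%N.
    by rewrite ltn_neqAle gyx andbT val_eqE (inj_eq perm_inj) eq_sym.
  have ys : tperm x y \in young d e.
    rewrite inE; apply/forallP => z; by case: tpermP => [->|->|] //; rewrite (eqP bxy).
  have /implyP/(_ ys) := sg (tperm x y); apply/negP; rewrite -ltnNge.
  (* Exchanging x and y loses the inversion between them and creates none. *)
  apply: proper_card; apply/properP; split.
    apply/subsetP => -[p q]; rewrite !inE /= => /andP [pq]; rewrite pq /= !permM => gs.
    rewrite ltnNge; apply/negP => gpq.
    have {gpq} gpq : (g p < g q)%N.
      rewrite ltn_neqAle gpq andbT val_eqE (inj_eq perm_inj) -val_eqE /=; lia.
    have [[gp gq]|nxy] := eqVneq (g p, g q) (x, y).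
      by move: gyx; rewrite -gp -gq !permK; lia.
    by have := ltn_trans gs (tperm_adjacent_mono yx gpq nxy); rewrite ltnn.
  exists ((g^-1)%g y, (g^-1)%g x); rewrite !inE /= ?permM ?permKV ?tpermL ?tpermR.
    by rewrite gyx yx ltnSn.
  by rewrite yx gyx /= -leqNgt leqnSn.
move=> bab ab; have [n] := ubnP (b - a); elim: n b bab ab => // n IH b bab ab bn.
have [ba|ba] := eqVneq (b : nat) a.+1; first exact: adj.
have lc : (b.-1 < d + e)%N by have := ltn_ord b; lia.
pose c := Ordinal lc.
have cb : b = c.+1 :> nat by rewrite /=; lia.
have bac : same_block a c by move: bab; rewrite /same_block /=; lia.
have bcb : same_block c b by move: bab; rewrite /same_block /=; lia.
by apply: ltn_trans (IH c bac _ _) (adj _ _ cb bcb); rewrite /=; lia.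
Qed.

(** Take an element of minimal length in the coset. *)
Lemma shortest_exists g : exists2 g0, g0 \in shortest d e &
  exists2 h, h \in young d e & g = (g0 * h)%g.
Proof.
pose A := [set (g * h)%g | h in young d e].
have gA : g \in A.
  apply/imsetP; exists 1%g; rewrite ?mulg1 // inE; apply/forallP => a.
  by rewrite perm1.
case: (arg_minnP (@perm_length _) gA) => g0 /imsetP [h yh g0E] ming0.
exists g0; last first.
  by exists (h^-1)%g; [exact: youngV|rewrite g0E mulgK].
rewrite inE; apply/forallP => k; apply/implyP => yk; apply: ming0.
apply/imsetP; exists (h * k)%g; first exact: youngM.
by rewrite g0E mulgA.
Qed.

Lemma mono_perm1 n (k : 'S_n) :
  (forall a b : 'I_n, (a < b)%N -> (k a < k b)%N) -> k = 1%g.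
Proof.
have le_k (h : 'S_n) : (forall a b : 'I_n, (a < b)%N -> (h a < h b)%N) ->
    forall m (a : 'I_n), a = m :> nat -> (m <= h a)%N.
  move=> hm; elim=> // m IH a am; have lm : (m < n)%N by have := ltn_ord a; lia.
  apply: leq_ltn_trans (hm (Ordinal lm) a _); [exact: IH|rewrite /=; lia].
move=> km; apply/permP => a; rewrite perm1; apply/val_inj/eqP; rewrite eqn_leq.
rewrite [X in _ && X](le_k k km _ a erefl) andbT.
have km' (x y : 'I_n) : (x < y)%N -> (k^-1%g x < k^-1%g y)%N.
  move=> xy; rewrite ltnNge; apply/negP => le.
  have: (k^-1%g y < k^-1%g x)%N.
    by rewrite ltn_neqAle le andbT val_eqE (inj_eq perm_inj) -val_eqE /=; lia.
  by move/km; rewrite !permKV; lia.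
by have := le_k _ km' _ (k a) erefl; rewrite permK.
Qed.

(** The quotient of two shortest representatives of a coset is monotone on both
    blocks, which it preserves; so it is the identity. *)
Lemma shortest_unique g0 g1 h : g0 \in shortest d e -> g1 \in shortest d e ->
  h \in young d e -> g1 = (g0 * h)%g -> h = 1%g.
Proof.
move=> s0 s1 yh g1E; apply: invg_inj; rewrite invg1; apply: mono_perm1 => a b ab.
have yV := youngV yh.
have [bab|nb] := boolP (same_block a b).
  have bh : same_block (h^-1%g a) (h^-1%g b) by rewrite /same_block !young_block.
  rewrite ltnNge; apply/negP => le.
  have lt : (h^-1%g b < h^-1%g a)%N.
    by rewrite ltn_neqAle le andbT val_eqE (inj_eq perm_inj) -val_eqE /=; lia.
  have bh' : same_block (h^-1%g b) (h^-1%g a) by rewrite /same_block eq_sym.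
  have := shortest_mono s0 bh' lt; have := shortest_mono s1 bab ab.
  by rewrite g1E invMg !permM => l1 l2; have := ltn_trans l1 l2; rewrite ltnn.
have ad : (a < d)%N by move: nb; rewrite /same_block; lia.
have bd : (b < d)%N = false by move: nb; rewrite /same_block; lia.
have := young_block a yV; have := young_block b yV; rewrite ad bd => hb ha.
by apply: leq_trans ha _; rewrite leqNgt hb.
Qed.

Lemma shortest_young (M : nmodType) (F : 'S_(d + e) -> M) :
  \sum_(g in shortest d e) \sum_(h in young d e) F (g * h)%g = \sum_g F g.
Proof.
rewrite pair_big /=.
pose m (p : 'S_(d + e) * 'S_(d + e)) := (p.1 * p.2)%g.
have im : {in setX (shortest d e) (young d e) &, injective m}.
  move=> [g h] [g' h'] /setXP [sg yh] /setXP [sg' yh']; rewrite /m /= => e'.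
  have e1 : g' = (g * (h * h'^-1))%g by rewrite mulgA e' mulgK.
  have hh := shortest_unique sg sg' (youngM yh (youngV yh')) e1.
  by rewrite e1 hh mulg1 -[h](mulgKV h') hh mul1g.
transitivity (\sum_(p in setX (shortest d e) (young d e)) F (m p)).
  by apply: eq_bigl => -[a b]; rewrite in_setX.
rewrite -(big_imset F im); apply: eq_bigl => g; apply/imsetP.
have [g0 s0 [h yh ->]] := shortest_exists g.
by exists (g0, h); rewrite // in_setX s0.
Qed.

End Shortest.

Section BlockSum.
Variables d e : nat.

Definition bsum_fun (h1 : 'S_d) (h2 : 'S_e) (a : 'I_(d + e)) : 'I_(d + e) :=
  match split a with inl i => lshift e (h1 i) | inr j => rshift d (h2 j) end.

Lemma bsum_inj h1 h2 : injective (bsum_fun h1 h2).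
Proof.
rewrite /bsum_fun => a b; case: (splitP a) => [i ai|i ai]; case: (splitP b) => [j bj|j bj] /(congr1 val) /=.
- by move=> /val_inj/perm_inj ij; apply: val_inj; rewrite /= ai bj ij.
- by have := ltn_ord (h1 i); lia.
- by have := ltn_ord (h1 j); lia.
- by move=> /addnI/val_inj/perm_inj ij; apply: val_inj; rewrite /= ai bj ij.
Qed.

Definition bsum h1 h2 : 'S_(d + e) := perm (@bsum_inj h1 h2).

Lemma bsum_l h1 h2 i : bsum h1 h2 (lshift e i) = lshift e (h1 i).
Proof. by rewrite permE /bsum_fun -[lshift e i]/(unsplit (inl i)) unsplitK. Qed.

Lemma bsum_r h1 h2 j : bsum h1 h2 (rshift d j) = rshift d (h2 j).
Proof. by rewrite permE /bsum_fun -[rshift d j]/(unsplit (inr j)) unsplitK. Qed.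

Lemma ord_addP (P : 'I_(d + e) -> Prop) :
  (forall i, P (lshift e i)) -> (forall j, P (rshift d j)) -> forall a, P a.
Proof. by move=> Pl Pr a; rewrite -(splitK a); case: (split a). Qed.

Lemma bsumV h1 h2 : (bsum h1 h2)^-1%g = bsum h1^-1%g h2^-1%g.
Proof.
apply/permP; apply: ord_addP => i; apply: (@perm_inj _ (bsum h1 h2)); rewrite permKV.
  by rewrite !bsum_l permKV.
by rewrite !bsum_r permKV.
Qed.

Lemma bsum_young h1 h2 : bsum h1 h2 \in young d e.
Proof.
rewrite inE; apply/forallP; apply: ord_addP => i; rewrite ?bsum_l ?bsum_r /=.
  by rewrite !ltn_ord.
by rewrite !ltnNge !leq_addr.
Qed.

Lemma young_bsum (h : 'S_(d + e)) : h \in young d e -> exists h1 h2, h = bsum h1 h2.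
Proof.
move=> yh.
have hd (k : 'I_e) : (d <= h (rshift d k))%N.
  by rewrite leqNgt young_block // -leqNgt leq_addr.
have hl i : (h (lshift e i) < d)%N by rewrite young_block //= ltn_ord.
have hr j : (h (rshift d j) - d < e)%N.
  by have := ltn_ord (h (rshift d j)); have := hd j; lia.
have il : injective (fun i => Ordinal (hl i)).
  by move=> i j /(congr1 val) /= /val_inj/perm_inj/lshift_inj.
have ir : injective (fun i => Ordinal (hr i)).
  move=> i j /(congr1 val) /= eij.
  have /val_inj/perm_inj/rshift_inj // : (h (rshift d i) : nat) = h (rshift d j).
  by have := hd i; have := hd j; lia.
exists (perm il), (perm ir); apply/permP; apply: ord_addP => i.
  by rewrite bsum_l permE; apply: val_inj.
rewrite bsum_r permE; apply: val_inj => /=.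
by have := hd i; lia.
Qed.

Lemma sum_young (M : nmodType) (F : 'S_(d + e) -> M) :
  \sum_(h in young d e) F h = \sum_h1 \sum_h2 F (bsum h1 h2).
Proof.
rewrite pair_big /=.
pose m (p : 'S_d * 'S_e) := bsum p.1 p.2.
have im : injective m.
  move=> [g h] [g' h'] /permP eq; rewrite /m /= in eq; congr pair; apply/permP => i.
    by have := eq (lshift e i); rewrite !bsum_l => /lshift_inj.
  by have := eq (rshift d i); rewrite !bsum_r => /rshift_inj.
transitivity (\sum_(h in m @: setT) F h); last first.
  rewrite big_imset => [|p q _ _ /im //]; by apply: eq_bigl => p; rewrite inE.
apply: eq_bigl => h; apply/idP/imsetP => [/young_bsum [h1 [h2 ->]]|[p _ ->]].
  by exists (h1, h2); rewrite ?inE.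
exact: bsum_young.
Qed.

Lemma pact_bsum (V : superspace) (u : d.-tuple V) (v : e.-tuple V) h1 h2 :
  pact (bsum h1 h2) (cat_tuple u v) = cat_tuple (pact h1 u) (pact h2 v).
Proof.
apply: eq_from_tnth; apply: ord_addP => i; rewrite tnth_mktuple ?bsum_l ?bsum_r.
  by rewrite !tnth_lshift tnth_mktuple.
by rewrite !tnth_rshift tnth_mktuple.
Qed.

Lemma asg_bsum (V : superspace) (u : d.-tuple V) (v : e.-tuple V) h1 h2 :
  asg (cat_tuple u v) (bsum h1 h2) = asg u h1 (+) asg v h2.
Proof.
rewrite !asgE -oddD /npairs big_split_ord /=; congr (odd (_ + _)); apply: eq_bigr => i _.
  rewrite big_mkcond big_split_ord /= [X in (_ + X)%N]big1 ?addn0 => [|j _].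
    rewrite -big_mkcond; apply: eq_bigr => j _.
    by rewrite /flips bsumV !bsum_l !tnth_lshift.
  case: ifP => // _; rewrite /flips bsumV bsum_l bsum_r /=.
  have := ltn_ord i; have := ltn_ord (h1^-1%g i) => l1 l2.
  by rewrite !ltn_addr.
rewrite big_mkcond big_split_ord /= [X in (X + _)%N]big1 ?add0n => [|j _].
  rewrite -big_mkcond; apply: eq_big => j; first by rewrite ltn_add2l.
  by move=> _; rewrite /flips bsumV !bsum_r !tnth_rshift /= !ltn_add2l.
by case: ifP => // ij; have := ltn_ord j; lia.
Qed.

End BlockSum.

Lemma of_lext (R : comNzRingType) (U W : superspace) (f : word U -> tens R W) s :
  of_tens (lext f s) = linx (fun w => of_tens (f w)) (of_tens s).
Proof.
move: s; apply: lin_eq => [||w].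
- by apply: (lin_app (@lin_of R W)); exact: lin_lext.
- by apply: (lin_app (lin_linx _)); exact: lin_of.
by rewrite lextU -[of_tens << w >>]/(mon R w) linx_mon.
Qed.

Section ShuffleProduct.
Variables (R : comNzRingType) (V : superspace).
Implicit Types (u v : seq V) (x y : T R V).

Definition wsh (u v : seq V) : T R V :=
  \sum_(g in shortest (size u) (size v)) wa R g (cat_tuple (in_tuple u) (in_tuple v)).

Definition shf x y : T R V := linx (fun u => linx (wsh u) y) x.

Lemma wsh_tuple d e (u : d.-tuple V) (v : e.-tuple V) :
  wsh u v = \sum_(g in shortest d e) wa R g (cat_tuple u v).
Proof.
case: u => u pu; case: v => v pv; move: (eqP pu) (eqP pv) => du ev; subst d e.
have eu : Tuple pu = in_tuple u by exact: val_inj.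
have ev : Tuple pv = in_tuple v by exact: val_inj.
by rewrite eu ev; exact: erefl.
Qed.

Lemma lin_shfl y : islin (fun x => shf x y). Proof. exact: lin_linx. Qed.
Lemma lin_shfr x : islin (shf x).
Proof.
move=> a y z; move: x; apply: tens_eq => [||u].
- exact: lin_shfl.
- by apply: lin_add; [apply: lin_scale|]; exact: lin_shfl.
by rewrite /shf !linx_mon lin_linx.
Qed.

Lemma shf_mon u v : shf (mon R u) (mon R v) = wsh u v.
Proof. by rewrite /shf !linx_mon. Qed.

Lemma of_shuffle (s t : tens R V) : of_tens (shuffle s t) = shf (of_tens s) (of_tens t).
Proof.
rewrite /shuffle of_lext; apply: eq_linx => u; rewrite of_lext; apply: eq_linx => v.
rewrite of_tens_sum; apply: eq_bigr => g _.
exact: of_wact.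
Qed.

End ShuffleProduct.

Section Shuffle.
Variable V : superspace.
Implicit Types (t : tens rat V) (x y : T rat V).

(** Call P the sum over all permutations.  It is invariant, so sym P is d! P; but
    sym P is also d! times the symmetrization of w, since sym does not distinguish the
    permutations of w. *)
Lemma sum_wa d (w : d.-tuple V) : \sum_(g : 'S_d) wa rat g w = wsym rat w.
Proof.
set P := LHS.
have cfP0 (v : seq V) : size v != d -> cf P v = 0.
  move=> ne; rewrite /P cf_sum big1 // => g _; rewrite cfZ cf_mon.
  by case: eqP => [vE|_]; [rewrite -vE size_tuple eqxx in ne|rewrite mulr0].
have waM (g h : 'S_d) : wa rat (h * g)%g w =
    (-1) ^+ asg w g *: wa rat h (pact g w).
  by rewrite /wa scalerA -signr_addb -asgM pactM.
have tactP (h : 'S_d) : of_tens (tact h (to_tens P)) = P.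
  rewrite of_tact to_tensK /P.
  under eq_bigr => v _ do rewrite cf_sum scaler_suml.
  rewrite sum_exchange [RHS](reindex_inj (mulgI h)); apply: eq_bigr => g _.
  rewrite (bigD1 (pact g w)) //= -[RHS]addr0; congr (_ + _).
    by rewrite cfZ cf_mon eqxx mulr1 waM.
  rewrite big1 // => v ne; rewrite cfZ cf_mon (inj_eq val_inj) eq_sym (negPf ne).
  by rewrite mulr0 scale0r.
have sP : sinv P.
  rewrite -[P]to_tensK; apply/inv_sinv => k h.
  apply: (can_inj (@of_tensK rat V)); have [kd|ne] := eqVneq k d; last first.
    rewrite of_tact of_tdeg !big1 // => v _; rewrite to_tensK cfP0 ?scale0r //;
    by rewrite size_tuple.
  subst k; rewrite tactP -[LHS](tactP 1%g) of_tact of_tdeg; apply: eq_bigr => v _.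
  by rewrite /wa pact1 asg1 scale1r.
have symP : sym P = d`!%:R *: wsym rat w.
  rewrite /P sym_sum -card_Sn -sum1_card natr_sum scaler_suml.
  apply: eq_big => [g|g _]; first by rewrite inE.
  rewrite /wa symZ sym_mon (swapping_perm (@swapping_wsym rat V)).
  by rewrite scalerA -signr_addb addbb.
apply/cfP => v; have := congr1 (fun x => cf x v) symP; rewrite cf_sym_sinv // cfZ.
have nz n : n`!%:R != 0 :> rat by rewrite pnatr_eq0 -lt0n fact_gt0.
have [->|/cfP0 ->] := eqVneq (size v) d; first exact: mulfI.
by rewrite mulr0 => /esym/eqP; rewrite mulf_eq0 (negPf (nz _)) => /eqP ->.
Qed.

(** The sum over all permutations of the concatenation of two words, organized by the
    cosets of the permutations of the two blocks. *)
Lemma shf_sym x y : shf (sym x) (sym y) = sym (x * y).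
Proof.
move: y; apply: tens_eq => [||v].
- by apply: (lin_app (@lin_shfr _ _ _)); exact: lin_sym.
- by apply: (lin_app (@lin_sym rat V)); lin.
move: x; apply: tens_eq => [||u].
- by apply: (lin_app (@lin_shfl _ _ _)); exact: lin_sym.
- by apply: (lin_app (@lin_sym rat V)); lin.
rewrite monM !sym_mon -[u]/(tval (in_tuple u)) -[v]/(tval (in_tuple v)).
rewrite -[tval (in_tuple u) ++ tval (in_tuple v)]/(tval (cat_tuple (in_tuple u) (in_tuple v))).
rewrite -!sum_wa -shortest_young (islin_sum (@lin_shfl _ _ _)).
under eq_bigr => h1 _ do rewrite (islin_sum (@lin_shfr _ _ _)).
under [RHS]eq_bigr => g _ do rewrite sum_young.
rewrite [RHS]exchange_big /=; apply: eq_bigr => h1 _.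
rewrite [RHS]exchange_big /=; apply: eq_bigr => h2 _.
rewrite /wa (islinZ (@lin_shfr _ _ _)) (islinZ (@lin_shfl _ _ _)) shf_mon wsh_tuple !scaler_sumr.
apply: eq_bigr => g _; rewrite -pactM asgM asg_bsum pact_bsum !scalerA -!signr_addb.
by congr ((-1) ^+ nat_of_bool _ *: _); do 3!case: (asg _ _).
Qed.

Lemma shf_sinv x y : sinv x -> sinv y -> shf x y = sym (nrm x * nrm y).
Proof. by move=> sx sy; rewrite -shf_sym !sym_nrm. Qed.
End Shuffle.

(** * Products and pairings in coordinates *)

Section Brackets.
Variables U W : superspace.

(** A recursive form of the parity of bracket. *)
Fixpoint brk (u : seq U) (w : seq W) : bool :=
  if u is i :: u' then if w is j :: w' then (wp u' && spar j) (+) brk u' w' else false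
  else false.

Lemma bracket_brk d (u : d.-tuple U) (w : d.-tuple W) : odd (bracket u w) = brk u w.
Proof.
rewrite /bracket; elim: d u w => [|d IH] u w.
  by rewrite tuple0 (tuple0 w) /= big_ord0.
case/tupleP: u => i u; case/tupleP: w => j w /=; rewrite -IH.
rewrite big_ord_recl [X in (X + _)%N]big1 ?add0n //.
transitivity (odd (\sum_(c < d) (spar (tnth u c) * spar j +
   \sum_(a < d | (a < c)%N) spar (tnth u c) * spar (tnth w a)))%N).
  congr odd; apply: eq_bigr => c _; rewrite big_mkcond big_ord_recl /=.
  rewrite tnthS tnth0; congr (_ + _)%N; rewrite -big_mkcond /=.
  by apply: eq_big => a //= _; rewrite tnthS.
rewrite big_split oddD /=; congr (_ (+) _).
rewrite -big_distrl oddM oddb /=; congr (odd _ && _).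
by rewrite /wpar big_tuple.
Qed.

End Brackets.

Section Coefficients.
Variables (R : comNzRingType) (V : superspace).
Implicit Types (x : T R V).

Lemma linx_tuple (W : lmodType R) (g : seq V -> W) n x :
  (forall w, size w != n -> g w = 0) ->
  linx g x = \sum_(w : n.-tuple V) cf x w *: g w.
Proof.
move=> g0; move: x; apply: tens_eq => [||v]; first exact: lin_linx.
  by apply: lin_sum => w a x y; rewrite cfD cfZ scalerDl scalerA.
rewrite linx_mon; have [vn|ne] := eqVneq (size v) n.
  subst n; rewrite (bigD1 (in_tuple v)) //= cf_mon eqxx scale1r big1 ?addr0 // => w ne.
  rewrite cf_mon; case: eqP => [e|_]; last by rewrite scale0r.
  by case/eqP: ne; apply: val_inj; exact: esym e.
rewrite g0 // big1 // => w _; rewrite cf_mon; case: eqP => [e|_]; last by rewrite scale0r.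
by case/eqP: ne; rewrite e size_tuple.
Qed.

Lemma cf_of (s : tens R V) w : cf (of_tens s) w = s@_(w : word V).
Proof. by rewrite /cf of_tensK. Qed.

End Coefficients.

Section Products.
Variables (R : comNzRingType) (A : superalgebra).
Local Notation V := (sspace A).
Implicit Types (i j : V) (u v w k : seq V) (x y : T R V).

Fixpoint prd (u w k : seq V) : R :=
  match u, w, k with
  | [::], [::], [::] => 1
  | i :: u', j :: w', l :: k' => str R i j l * prd u' w' k'
  | _, _, _ => 0
  end.

Lemma cf_lmul i j x w : cf (lmul R i j * x) w =
  if w is k :: w' then str R i j k * cf x w' else 0.
Proof.
case: w => [|k w]; last by rewrite -cf_der der_lmul cfZ.
by rewrite lmulM cf_sum big1 // => l _; rewrite cfZ cf_let mulr0.
Qed.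

Lemma cf_wtm u w k : cf (wtm R u w) k = (-1) ^+ brk u w * prd u w k.
Proof.
elim: u w k => [|i u IH] [|j w] k /=; rewrite ?cf0 ?mulr0 //.
  by rewrite -mon0 cf_mon mul1r; case: k.
rewrite cfZ cf_lmul; case: k => [|l k]; rewrite ?mulr0 // IH.
by rewrite signr_addb -!mulrA; congr (_ * _); rewrite mulrCA.
Qed.

Lemma prod_prd d (u w k : d.-tuple V) :
  \prod_(a < d) str R (tnth u a) (tnth w a) (tnth k a) = prd u w k.
Proof.
elim: d u w k => [|d IH] u w k.
  by rewrite tuple0 (tuple0 w) (tuple0 k) big_ord0.
case/tupleP: u => i u; case/tupleP: w => j w; case/tupleP: k => l k /=.
rewrite big_ord_recl !tnth0 -IH; congr (_ * _); apply: eq_bigr => a _.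
by rewrite !tnthS.
Qed.

Lemma prd_size u w k : size k != size u -> prd u w k = 0.
Proof.
by elim: u w k => [|i u IH] [|j w] [|l k] //= ne; rewrite IH ?mulr0.
Qed.

Lemma of_wmul d (u w : d.-tuple V) : of_tens (wmul R u w) = wtm R u w.
Proof.
rewrite /wmul of_tens_sum.
under eq_bigr => k _ do rewrite malgUE of_tensZ.
apply/cfP => k; rewrite cf_wtm -bracket_brk signr_odd cf_sum.
have [kd|ne] := eqVneq (size k) d.
  rewrite -kd in u w *; rewrite (bigD1 (in_tuple k)) //= [X in _ + X]big1 ?addr0 => [|v ne].
    by rewrite cfZ [X in _ * X]cf_mon eqxx mulr1 -[prd u w k]/(prd u w (in_tuple k)) -prod_prd.
  rewrite cfZ [X in _ * X]cf_mon; case: eqP => [e|_]; last by rewrite mulr0.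
  by case/eqP: ne; apply: val_inj.
rewrite prd_size ?size_tuple // mulr0 big1 // => v _.
rewrite cfZ [X in _ * X]cf_mon; case: eqP => [e|_]; last by rewrite mulr0.
by case/eqP: ne; rewrite -e size_tuple.
Qed.

Lemma of_tmul (s t : tens R V) : of_tens (tmul s t) = tm (of_tens s) (of_tens t).
Proof.
rewrite /tmul of_tens_sum [in RHS](malg_sum s) of_tens_sum.
rewrite tm_suml; apply: eq_bigr => u _.
rewrite !(islinZ (@lin_of R V), islinZ (lin_tml _)) -[of_tens << u >>]/(mon R u).
rewrite /tm linx_mon (@linx_tuple _ _ _ _ (size u)) => [|w ne]; last first.
  by rewrite wtm_size // eq_sym.
rewrite of_tens_sum scaler_sumr; apply: eq_bigr => w _.
by rewrite of_tensZ of_wmul scalerA cf_of.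
Qed.

End Products.

Section Pairing.
Variables (R : comNzRingType) (V : superspace).
Implicit Types (i j : V) (u v w : seq V) (x : T R (dualsp V)) (y : T R V).

(** The sign of the pairing of a word with its dual word. *)
Definition eps w : bool := brk w w.

Lemma eps_cons i w : eps (i :: w) = (wp w && spar i) (+) eps w.
Proof. by []. Qed.

(** Invariance of this sign makes the pairing with an invariant insensitive to signed
    swaps. *)
Lemma eps_swap u i j v : eps (u ++ [:: i, j & v]) = eps (u ++ [:: j, i & v]).
Proof.
elim: u => [|k u IH] /=; last by rewrite !eps_cons IH !wp_cat !wp_cons [spar i (+) _]addbCA.
rewrite !eps_cons !wp_cons; do !case: (spar _); by case: (wp v); case: (eps v).
Qed.

(** The pairing of the tensor algebras of the dual space and of the space. *)
Definition pr x y : R := linx (fun w : seq (dualsp V) => (-1) ^+ eps w * cf y w : R^o) x.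

Lemma lin_prl y : islin (fun x => pr x y : R^o). Proof. exact: lin_linx. Qed.

Lemma pr_mon (w : seq (dualsp V)) y : pr (mon R w) y = (-1) ^+ eps w * cf y w.
Proof. by rewrite /pr linx_mon. Qed.

Lemma wpairE d (u : d.-tuple (dualsp V)) (w : d.-tuple V) :
  wpair R u w = (-1) ^+ eps w *+ (tval u == tval w).
Proof.
rewrite /wpair; case: (tval u =P tval w) => [uw|ne].
  rewrite big1 ?mulr1 ?mulr1n => [|a _].
    by rewrite -signr_odd bracket_brk uw.
  have -> : tnth u a = tnth w a by rewrite (tnth_nth (tnth w a) u a) uw -tnth_nth.
  by rewrite eqxx.
have [a ua] : exists a, tnth u a != tnth w a.
  apply/existsP; apply: contra_notT ne; rewrite negb_exists => /forallP e.
  by congr tval; apply: eq_from_tnth => a; apply/eqP; move: (e a); rewrite negbK.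
by rewrite mulr0n (bigD1 a) //= (negPf ua) mul0r mulr0.
Qed.

Lemma of_tpair (x : tens R (dualsp V)) (t : tens R V) :
  tpair x t = pr (of_tens x) (of_tens t).
Proof.
rewrite /tpair [in RHS](malg_sum x) of_tens_sum.
rewrite (islin_sum (lin_prl _)); apply: eq_bigr => u _.
rewrite of_tensZ (islinZ (lin_prl _)) -[of_tens << u >>]/(mon R u) pr_mon.
rewrite (bigD1 (in_tuple u)) //= big1 ?addr0 => [|w ne].
  rewrite wpairE eqxx mulr1n cf_of -[RHS]/(_ * _) -mulrA.
  by congr (_ * _); exact: mulrC.
rewrite wpairE; case: eqP => [e|_]; last by rewrite mulr0.
by case/eqP: ne; apply: val_inj; exact: esym e.
Qed.

Lemma of_of_form d (F : d.-tuple V -> R) :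
  of_tens (of_form F) = \sum_(w : d.-tuple V) ((-1) ^+ eps w * F w) *: mon R (w : seq (dualsp V)).
Proof.
rewrite /of_form of_tens_sum; apply: eq_bigr => w _.
by rewrite malgUE of_tensZ wpairE eqxx.
Qed.

Lemma swapping_pr y : sinv y ->
  swapping (V := dualsp V) (fun w : seq (dualsp V) => (-1) ^+ eps w * cf y w : R^o).
Proof.
move=> sy u i j v; rewrite (eps_swap u i j v) (sy u i j v).
exact: mulrCA.
Qed.

End Pairing.

Section Perp.
Variable V : superspace.
Implicit Types (x : T rat (dualsp V)) (y : T rat V).

Lemma pr_sym_eq x x' y : sinv y -> sym x = sym x' -> pr x y = pr x' y.
Proof. by move=> sy e; exact: (sym_eqP (swapping_pr sy) e). Qed.

(** Over the rationals one can pair x with a twist of its own symmetrization; the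
    result is a sum of squares with positive weights. *)
Lemma pr_perp x : (forall y, sinv y -> pr x y = 0) -> sym x = 0.
Proof.
move=> xperp; set s := sym x.
pose y : T rat V := linx (fun w : seq (dualsp V) => (-1) ^+ eps w *: mon rat (w : seq V)) s.
have cfy (w : seq V) : cf y w = (-1) ^+ eps w * cf s (w : seq (dualsp V)).
  rewrite /y; move: (s); apply: cf_eq => [||u]; first exact: lin_linx.
    by move=> a p q; rewrite cfD cfZ mulrDr mulrCA.
  by rewrite linx_mon cfZ !cf_mon; case: eqP => [->|_] //; rewrite !mulr0.
have ss : sinv s by exact: sinv_sym.
have sy : sinv y.
  move=> u i j v; rewrite !cfy (ss u i j v) (@eps_swap V u i j v).
  by rewrite mulrCA.
have h := xperp y sy; move: h; rewrite (@pr_sym_eq x (nrm s)) ?sym_nrm_sym //.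
rewrite /pr linxE => h; apply/cfP => w; rewrite cf0.
have pos (v : seq (dualsp V)) : cf (nrm s) v *: ((-1) ^+ eps v * cf y v : rat^o) =
    (size v)`!%:R^-1 * cf s v ^+ 2.
  rewrite cfy mulrA -signr_addb addbb mul1r cf_degscale -[LHS]/(_ * _) -mulrA.
  by rewrite expr2.
move: h; under eq_bigr => v _ do rewrite pos.
move/eqP; rewrite psumr_eq0 => [|v _]; last first.
  by rewrite mulr_ge0 ?invr_ge0 ?ler0n // sqr_ge0.
have nzf : ((size w)`!%:R : rat)^-1 != 0 by rewrite invr_eq0 pnatr_eq0 -lt0n fact_gt0.
move/allP => all0; have [//|nz] := eqVneq (cf s w) 0.
have /all0 : w \in supp (nrm s) by rewrite mem_supp cf_degscale mulf_neq0.
by rewrite /= mulf_eq0 sqrf_eq0 (negPf nz) (negPf nzf).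
Qed.

End Perp.

(** * The bimodule structure on the dual *)

Arguments sspace : simpl never.

Section Actions.
Variables (R : comNzRingType) (X : superalgebra).
Local Notation V := (sspace X).
Local Notation VT := (sspace (trivext X)).
Implicit Types (i j k l : V) (u v w : seq V).

Lemma vpair_delta i (x : X) : vpair [ffun m => (i == m)%:R] x = scoord x i.
Proof.
rewrite /vpair (bigD1 i) //= ffunE eqxx mul1r big1 ?addr0 // => m ne.
by rewrite ffunE eq_sym (negPf ne) mul0r.
Qed.

Lemma str_rl i k l : str R (ir i : VT) (il k) (ir l) = str R k l i.
Proof.
rewrite /str /= ffunE /= !ffunE vpair_delta.
by rewrite (_ : vpair 0 _ = 0) ?add0r // vpair0l.
Qed.

Lemma str_rl0 i k l : str R (ir i : VT) (il k) (il l) = 0.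
Proof. by rewrite /str /= ffunE /= mul0r scoord0 ffunE. Qed.

Lemma str_lr i k l : str R (il k : VT) (ir i) (ir l) = str R l k i.
Proof.
rewrite /str /= ffunE /= !ffunE vpair_delta.
by rewrite (_ : vpair 0 _ = 0) ?addr0 // vpair0l.
Qed.

Lemma str_lr0 i k l : str R (il k : VT) (ir i) (il l) = 0.
Proof. by rewrite /str /= ffunE /= mulr0 scoord0 ffunE. Qed.

(** Products are even, so signs may be computed from the parity of the factors. *)
Lemma cf_wtm_wp (A : superalgebra) (u v w : seq (sspace A)) (e : bool -> bool) :
  (-1) ^+ e (wp w) * cf (wtm R u v) w = (-1) ^+ e (wp u (+) wp v) * cf (wtm R u v) w.
Proof.
elim: u v w e => [|i u IH] [|j v] w e /=; rewrite ?cf0 ?mulr0 //.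
  by rewrite -mon0 cf_mon; case: w => [|k w]; rewrite ?mulr0 ?wp_nil.
rewrite cfZ cf_lmul; case: w => [|k w]; rewrite ?mulr0 //.
have [->|/str_neq0 sk] := eqVneq (str R i j k) 0; first by rewrite !mul0r !mulr0.
rewrite !wp_cons [LHS]mulrCA [RHS]mulrCA; congr (_ * _).
rewrite [LHS]mulrCA [RHS]mulrCA; congr (_ * _).
rewrite (IH v w (fun b => e (spar k (+) b))) sk.
by rewrite addbACA.
Qed.

(** Multiplying a dual word by a word of X from the right is dual to multiplying by that
    word from the left, letter by letter; what remains is to compare signs. *)
Lemma cf_tm_rl (u v w : seq V) :
  cf (tm (mon R (map (@ir X) u)) (mon R (map (@il X) v))) (map (@ir X) w) =
  (-1) ^+ (eps w (+) eps u) * cf (wtm R v w) u.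
Proof.
rewrite tm_mon; elim: u v w => [|i u IH] [|k v] [|l w] /=; rewrite ?cf0 ?mulr0 //;
  try by rewrite ?(cfZ, cf_lmul) ?cf0 ?mulr0 // -?mon0 ?cf_mon ?mulr0 ?mul1r.
rewrite !cfZ !cf_lmul str_rl IH (wp_map (@spar_ir X)) !eps_cons /=.
have [->|/str_neq0 sk] := eqVneq (str R k l i) 0; first by rewrite !mul0r !mulr0.
rewrite [LHS]mulrCA [RHS]mulrA [RHS]mulrCA; congr (_ * _).
rewrite !mulrA -!signr_addb.
rewrite sk (@cf_wtm_wp X v w u (fun b => (b && spar k) (+) (eps w (+) eps u))).
rewrite (@cf_wtm_wp X v w u (fun b => wp w && spar l (+) eps w (+)
  (b && (spar k (+) spar l) (+) eps u) (+) wp v && spar l)).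
congr (_ * _); case: (eps w); case: (eps u); bcases.
Qed.

Lemma cf_tm_lr (u v w : seq V) :
  cf (tm (mon R (map (@il X) v)) (mon R (map (@ir X) u))) (map (@ir X) w) =
  (-1) ^+ (eps w (+) eps u) * cf (wtm R w v) u.
Proof.
rewrite tm_mon; elim: u v w => [|i u IH] [|k v] [|l w] /=; rewrite ?cf0 ?mulr0 //;
  try by rewrite ?(cfZ, cf_lmul) ?cf0 ?mulr0 // -?mon0 ?cf_mon ?mulr0 ?mul1r.
rewrite !cfZ !cf_lmul str_lr IH (wp_map (@spar_il X)) !eps_cons /=.
have [->|/str_neq0 sk] := eqVneq (str R l k i) 0; first by rewrite !mul0r !mulr0.
rewrite [LHS]mulrCA [RHS]mulrA [RHS]mulrCA; congr (_ * _).
rewrite !mulrA -!signr_addb.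
rewrite sk (@cf_wtm_wp X w v u (fun b => wp w && spar l (+) eps w (+)
  (b && (spar l (+) spar k) (+) eps u) (+) wp w && spar k)).
congr (_ * _); case: (eps w); case: (eps u); bcases.
Qed.

(** A dual vector times a vector is a dual vector. *)
Lemma tm_rl_image (u v : seq V) :
  exists z, tm (iD (@mon R (dualsp V) u)) (iX (mon R v)) = @iD R X z.
Proof.
rewrite /iX /iD !lmap_mon tm_mon; elim: u v => [|i u IH] [|k v] /=.
- by exists 1; rewrite lmap1.
- by exists 0; rewrite lmap0.
- by exists 0; rewrite lmap0.
have [z ->] := IH v.
exists ((-1) ^+ (wp [seq ir i | i <- u] && spar k) *:
  ((\sum_l str R (ir i : VT) (il k) (ir l) *: let1 R (l : dualsp V)) * z)).
rewrite lmapZ lmapM lmulE lmap_sum.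
rewrite big_sumType [X in (X + _) * _]big1 /= ?add0r => [|l _]; last first.
  by rewrite str_rl0 scale0r.
do 2![congr (_ *: _)|congr (_ * _)]; apply: eq_bigr => l _.
by rewrite lmapZ lmap_let.
Qed.

Lemma tm_lr_image (u v : seq V) :
  exists z, tm (iX (mon R v)) (iD (@mon R (dualsp V) u)) = @iD R X z.
Proof.
rewrite /iX /iD !lmap_mon tm_mon; elim: u v => [|i u IH] [|k v] /=.
- by exists 1; rewrite lmap1.
- by exists 0; rewrite lmap0.
- by exists 0; rewrite lmap0.
have [z ->] := IH v.
exists ((-1) ^+ (wp [seq il i | i <- v] && spar i) *:
  ((\sum_l str R (il k : VT) (ir i) (ir l) *: let1 R (l : dualsp V)) * z)).
rewrite lmapZ lmapM lmulE lmap_sum.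
rewrite big_sumType [X in (X + _) * _]big1 /= ?add0r => [|l _]; last first.
  by rewrite str_lr0 scale0r.
do 2![congr (_ *: _)|congr (_ * _)]; apply: eq_bigr => l _.
by rewrite lmapZ lmap_let.
Qed.

Lemma cf_wtm_size (A : superalgebra) (u v w : seq (sspace A)) :
  size w != size v -> cf (wtm R u v) w = 0.
Proof.
move=> ne; have [uv|ne'] := eqVneq (size u) (size v); last by rewrite wtm_size // cf0.
by rewrite cf_wtm prd_size ?mulr0 // uv.
Qed.

Lemma cf_wtm_size' (A : superalgebra) (u v w : seq (sspace A)) :
  size w != size u -> cf (wtm R u v) w = 0.
Proof. by move=> ne; rewrite cf_wtm prd_size ?mulr0. Qed.

Lemma sum_tuple_eq (U : superspace) n (z : T R U) (F : seq U -> R) :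
  (forall w : seq U, cf z w = F w) -> (forall w : seq U, size w != n -> F w = 0) ->
  \sum_(w : n.-tuple U) F w *: mon R w = z.
Proof.
move=> zF F0; apply/cfP => w; rewrite zF; have [wn|ne] := eqVneq (size w) n.
  by subst n; exact: (cf_sum_tuple (fun v : (size w).-tuple U => F v) (in_tuple w)).
rewrite F0 // cf_sum big1 // => v _; rewrite cfZ cf_mon.
by case: eqP => [e|_]; rewrite ?mulr0 //; case/eqP: ne; rewrite -e size_tuple.
Qed.

(** The right action of X on the dual is the product of the trivial extension.  That
    this persists in all tensor powers rests on the signs of both sides, see
    cf_tm_rl. *)
Lemma of_tract (x : tens R (dualsp V)) (xi : tens R V) :
  iD (of_tens (tract x xi)) = tm (iD (of_tens x)) (iX (of_tens xi)).
Proof.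
rewrite /tract of_lext; move: (of_tens x) => {}x; move: x; apply: tens_eq => [||u].
- by apply: (lin_app (@lin_lmap _ _ _ _)); exact: lin_linx.
- by apply: (lin_app (lin_tml _)); exact: lin_lmap.
rewrite linx_mon of_of_form.
under eq_bigr => w _ do rewrite of_tpair of_tmul -[of_tens << u >>]/(mon R u) pr_mon
  -[of_tens << word_of w >>]/(mon R w).
move: (of_tens xi) => {}xi; move: xi; apply: tens_eq => [||v].
- apply: (lin_app (@lin_lmap _ _ _ _)); apply: lin_sum => w a p q.
  by rewrite lin_tml cfD cfZ !mulrDr scalerDl scalerA ![_ * (a * _)]mulrCA.
- by apply: (lin_app (lin_tmr _)); exact: lin_lmap.
have [z ez] := tm_rl_image u v; rewrite ez; congr (iD _).
rewrite /iX /iD !lmap_mon in ez.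
apply: (@sum_tuple_eq (dualsp V) (size u) z
  (fun w => (-1) ^+ eps w * ((-1) ^+ eps u * cf (tm (mon R v) (mon R (w : seq V))) u))) => w.
  by rewrite -(cf_lmap_inj (@ir_inj X)) -ez cf_tm_rl signr_addb -mulrA tm_mon.
by move=> ne; rewrite tm_mon cf_wtm_size ?mulr0 // eq_sym.
Qed.

Lemma of_tlact (x : tens R (dualsp V)) (xi : tens R V) :
  iD (of_tens (tlact xi x)) = tm (iX (of_tens xi)) (iD (of_tens x)).
Proof.
rewrite /tlact of_lext; move: (of_tens x) => {}x; move: x; apply: tens_eq => [||u].
- by apply: (lin_app (@lin_lmap _ _ _ _)); exact: lin_linx.
- by apply: (lin_app (lin_tmr _)); exact: lin_lmap.
rewrite linx_mon of_of_form.
under eq_bigr => w _ do rewrite of_tpair of_tmul -[of_tens << u >>]/(mon R u) pr_mon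
  -[of_tens << word_of w >>]/(mon R w).
move: (of_tens xi) => {}xi; move: xi; apply: tens_eq => [||v].
- apply: (lin_app (@lin_lmap _ _ _ _)); apply: lin_sum => w a p q.
  by rewrite lin_tmr cfD cfZ !mulrDr scalerDl scalerA ![_ * (a * _)]mulrCA.
- by apply: (lin_app (lin_tml _)); exact: lin_lmap.
have [z ez] := tm_lr_image u v; rewrite ez; congr (iD _).
rewrite /iX /iD !lmap_mon in ez.
apply: (@sum_tuple_eq (dualsp V) (size u) z
  (fun w => (-1) ^+ eps w * ((-1) ^+ eps u * cf (tm (mon R (w : seq V)) (mon R v)) u))) => w.
  by rewrite -(cf_lmap_inj (@ir_inj X)) -ez cf_tm_lr signr_addb -mulrA tm_mon.
by move=> ne; rewrite tm_mon cf_wtm_size' ?mulr0 // eq_sym.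
Qed.
End Actions.

(** * Integral elements *)

Section BaseChange.
Variable V : superspace.
Implicit Types (x y : T int V) (w : seq V).

(** Extension of scalars from the integers to the rationals. *)
Definition bc x : T rat V := \sum_(w <- supp x) (cf x w)%:~R *: mon rat w.

Lemma cf_bc x w : cf (bc x) w = (cf x w)%:~R.
Proof.
rewrite /bc cf_sum; have [ws|nw] := boolP (w \in supp x).
  rewrite (bigD1_seq w) ?supp_uniq //= cfZ cf_mon eqxx mulr1 big1 ?addr0 // => v ne.
  by rewrite cfZ cf_mon (negPf ne) mulr0.
rewrite big_seq big1 => [|v vs]; last first.
  by rewrite cfZ cf_mon; case: eqP => [vw|_]; [rewrite -vw vs in nw|rewrite mulr0].
by move: nw; rewrite mem_supp negbK => /eqP ->.
Qed.

Lemma bcD x y : bc (x + y) = bc x + bc y.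
Proof. by apply/cfP => w; rewrite cfD !cf_bc cfD rmorphD. Qed.

Lemma bc0 : bc 0 = 0.
Proof. by apply/cfP => w; rewrite cf_bc !cf0. Qed.

Lemma bcB x y : bc (x - y) = bc x - bc y.
Proof. by apply/cfP => w; rewrite cfB !cf_bc cfB rmorphB. Qed.

Lemma bcZ a x : bc (a *: x) = a%:~R *: bc x.
Proof. by apply/cfP => w; rewrite cfZ !cf_bc cfZ rmorphM. Qed.

Lemma bc_sum (I : Type) (r : seq I) (p : pred I) (F : I -> T int V) :
  bc (\sum_(i <- r | p i) F i) = \sum_(i <- r | p i) bc (F i).
Proof. by elim/big_rec2: _ => [|i x y _ <-]; rewrite ?bc0 ?bcD. Qed.

Lemma bc_mon w : bc (mon int w) = mon rat w.
Proof. by apply/cfP => v; rewrite cf_bc !cf_mon; case: eqP. Qed.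

Lemma bc_inj : injective bc.
Proof.
by move=> x y e; apply/cfP => w; apply: (intr_inj (R := rat)); rewrite -!cf_bc e.
Qed.

Lemma sinv_bc x : sinv (bc x) <-> sinv x.
Proof.
split=> s u i j v; last first.
  by rewrite !cf_bc s rmorphM /= rmorph_sign.
by apply: (intr_inj (R := rat)); rewrite rmorphM /= rmorph_sign -!cf_bc.
Qed.
End BaseChange.

Lemma bc_linx (V W : superspace) (f : seq V -> T int W) (x : T int V) :
  bc (linx f x) = linx (fun w => bc (f w)) (bc x).
Proof.
rewrite linxE bc_sum {2}/bc (islin_sum (lin_linx _)); apply: eq_bigr => w _.
by rewrite bcZ (islinZ (lin_linx _)) linx_mon.
Qed.

Lemma bcM (V : superspace) (x y : T int V) : bc (x * y) = bc x * bc y.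
Proof.
rewrite [x]tens_sum [y]tens_sum mulr_suml !bc_sum mulr_suml; apply: eq_bigr => u _.
rewrite mulr_sumr bc_sum mulr_sumr; apply: eq_bigr => v _.
rewrite -scalerAl -scalerAr monM !bcZ !bc_mon -scalerAl -scalerAr monM.
by [].
Qed.

Lemma bc_let (V : superspace) (i : V) : bc (let1 int i) = let1 rat i.
Proof. exact: bc_mon. Qed.

Lemma bc_tm (A : superalgebra) (x y : T int (sspace A)) : bc (tm x y) = tm (bc x) (bc y).
Proof.
rewrite /tm bc_linx; apply: eq_linx => u; rewrite bc_linx; apply: eq_linx => w.
elim: u w => [|i u IH] [|j w] /=; rewrite ?bc0 -?mon0 ?bc_mon //.
rewrite bcZ bcM IH rmorph_sign !lmulE bc_sum; do 2![congr (_ *: _)|congr (_ * _)].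
apply: eq_bigr => k _; rewrite bcZ bc_let; congr (_ *: _).
by rewrite /str intz.
Qed.

Lemma bc_shf (V : superspace) (x y : T int V) : bc (shf x y) = shf (bc x) (bc y).
Proof.
rewrite /shf bc_linx; apply: eq_linx => u; rewrite bc_linx; apply: eq_linx => w.
by rewrite /wsh bc_sum; apply: eq_bigr => g _; rewrite /wa bcZ bc_mon rmorph_sign.
Qed.

Lemma bc_lmap (V W : superspace) (f : V -> W) (x : T int V) :
  bc (lmap f x) = lmap f (bc x).
Proof. by rewrite /lmap bc_linx; apply: eq_linx => w; rewrite bc_mon. Qed.

Section Integral.
Variable V : superspace.
Implicit Types (s t : tens int V) (x y : T rat V) (w : seq V).

Definition ofZ s : T rat V := of_tens (extQ s).

Lemma ofZ_bc s : ofZ s = bc (of_tens s).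
Proof.
rewrite /ofZ /extQ of_tens_sum /bc /supp of_tensK.
apply: eq_bigr => w _; rewrite malgUE of_tensZ cf_of.
by [].
Qed.

Lemma cf_ofZ s w : cf (ofZ s) w = (s@_(w : word V))%:~R.
Proof. by rewrite ofZ_bc cf_bc cf_of. Qed.

Lemma ofZ_inj : injective ofZ.
Proof.
move=> s t; rewrite !ofZ_bc => /bc_inj e.
by rewrite -[s](@of_tensK int V) e of_tensK.
Qed.

Lemma ofZB s t : ofZ (s - t) = ofZ s - ofZ t.
Proof. by rewrite !ofZ_bc of_tensB bcB. Qed.

Lemma ofZ0 : ofZ 0 = 0.
Proof. by rewrite ofZ_bc of_tens0 bc0. Qed.

Lemma ofZM s t : ofZ (s * t) = ofZ s * ofZ t.
Proof. by rewrite !ofZ_bc of_tensM bcM. Qed.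

Lemma ofZ1 : ofZ 1 = 1.
Proof. by rewrite ofZ_bc of_tens1 -!mon0 bc_mon. Qed.

Lemma ofZX s n : ofZ (s ^+ n) = ofZ s ^+ n.
Proof. by elim: n => [|n IH]; rewrite ?expr0 ?ofZ1 // !exprS ofZM IH. Qed.

Lemma inv_ofZ s : Defs.inv s <-> sinv (ofZ s).
Proof. by rewrite ofZ_bc sinv_bc; exact: inv_sinv. Qed.

Lemma ofZ_shuffle s t : ofZ (shuffle s t) = shf (ofZ s) (ofZ t).
Proof. by rewrite !ofZ_bc of_shuffle bc_shf. Qed.

Definition integral x := forall w, cf x w \is a Num.int.

Lemma integral_ofZ s : integral (ofZ s).
Proof. by move=> w; rewrite cf_ofZ; exact: intr_int. Qed.

(** The floor of the coefficients is used for integral elements only, where it does not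
    lose anything. *)
Definition toZ x : tens int V :=
  \sum_(w <- supp x) << Num.floor (cf x w) *g (w : word V) >>.

Lemma toZ_coef x w : (toZ x)@_(w : word V) = Num.floor (cf x w).
Proof.
rewrite /toZ -cf_of of_tens_sum.
under eq_bigr => v _ do rewrite malgUE of_tensZ -[of_tens _]/(mon int v).
rewrite cf_sum; have [ws|nw] := boolP (w \in supp x).
  rewrite (bigD1_seq w) ?supp_uniq //= cfZ cf_mon eqxx mulr1 big1 ?addr0 // => v ne.
  by rewrite cfZ cf_mon (negPf ne) mulr0.
rewrite big_seq big1 => [|v vs]; last first.
  by rewrite cfZ cf_mon; case: eqP => [vw|_]; [rewrite -vw vs in nw|rewrite mulr0].
by move: nw; rewrite mem_supp negbK => /eqP ->; rewrite floor0.
Qed.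

Lemma ofZK x : integral x -> ofZ (toZ x) = x.
Proof. by move=> ix; apply/cfP => w; rewrite cf_ofZ toZ_coef floorK. Qed.

Lemma integralB x y : integral x -> integral y -> integral (x - y).
Proof. by move=> ix iy w; rewrite cfB rpredB. Qed.

Lemma integral_shf x y : integral x -> integral y -> integral (shf x y).
Proof.
by move=> ix iy; rewrite -(ofZK ix) -(ofZK iy) -ofZ_shuffle; exact: integral_ofZ.
Qed.

Lemma integral_J (b : bool) x : integral x -> integral (J b x).
Proof. by move=> ix w; rewrite cf_J rpredM // rpredX ?rpredN ?rpred1. Qed.

End Integral.

Lemma ofZ_tmul (A : superalgebra) (s t : tens int (sspace A)) :
  ofZ (tmul s t) = tm (ofZ s) (ofZ t).
Proof. by rewrite !ofZ_bc of_tmul bc_tm. Qed.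

Lemma of_tmap (R : comNzRingType) (V W : superspace) (f : V -> W) (s : tens R V) :
  of_tens (tmap f s) = lmap f (of_tens s).
Proof. by rewrite /tmap of_lext; apply: eq_linx. Qed.

Lemma ofZ_tmap (V W : superspace) (f : V -> W) (s : tens int V) :
  ofZ (tmap f s) = lmap f (ofZ s).
Proof. by rewrite !ofZ_bc of_tmap bc_lmap. Qed.

Lemma integral_tm (A : superalgebra) (x y : T rat (sspace A)) :
  integral x -> integral y -> integral (tm x y).
Proof.
by move=> ix iy; rewrite -(ofZK ix) -(ofZK iy) -ofZ_tmul; exact: integral_ofZ.
Qed.

Lemma integral_lmap (V W : superspace) (f : V -> W) (x : T rat V) :
  integral x -> integral (lmap f x).
Proof. by move=> ix; rewrite -(ofZK ix) -ofZ_tmap; exact: integral_ofZ. Qed.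

(** * The ideal defining the symmetric algebra *)

Section TensVectors.
Variables (R : comNzRingType) (V : superspace).

Lemma of_tvec (v : {ffun V -> R}) : of_tens (tvec v) = \sum_i v i *: let1 R i.
Proof.
rewrite /tvec of_tens_sum; apply: eq_bigr => i _.
by rewrite malgUE of_tensZ.
Qed.

Definition delta (i : V) : {ffun V -> R} := [ffun j => (i == j)%:R].

Lemma of_tvec_delta i : of_tens (tvec (delta i)) = let1 R i.
Proof.
rewrite of_tvec (bigD1 i) //= ffunE eqxx scale1r big1 ?addr0 // => j /negPf ne.
by rewrite ffunE eq_sym ne scale0r.
Qed.

Lemma of_tact_homog d (g : 'S_d) (t : tens R V) (F : d.-tuple V -> R) :
  of_tens t = \sum_w F w *: mon R w -> of_tens (tact g t) = \sum_w F w *: wa R g w.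
Proof.
move=> tF; rewrite of_tact; apply: eq_bigr => w _.
by rewrite tF cf_sum_tuple.
Qed.

Lemma of_tvec2 (v u : {ffun V -> R}) : of_tens (tvec v * tvec u) =
  \sum_(w : 2.-tuple V) (v (tnth w ord0) * u (tnth w ord_max)) *: mon R w.
Proof.
rewrite of_tensM !of_tvec mulr_suml.
rewrite (reindex (fun p : V * V => [tuple p.1; p.2])) /=; last first.
  exists (fun w : 2.-tuple V => (tnth w ord0, tnth w ord_max)) => [[i j] _|w _] //.
  by case/tupleP: w => i w; case/tupleP: w => j w; rewrite (tuple0 w); apply: val_inj.
rewrite -(pair_bigA _ (fun i j => (v (tnth [tuple i; j] ord0) *
   u (tnth [tuple i; j] ord_max)) *: mon R [tuple i; j])) /=.
apply: eq_bigr => i _; rewrite mulr_sumr; apply: eq_bigr => j _.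
by rewrite -scalerAl -scalerAr monM scalerA.
Qed.

Lemma sym_tact2 (v u : {ffun V -> R}) : sym (of_tens (tvec v * tvec u)) =
  sym (of_tens (tact (tperm ord0 ord_max : 'S_2) (tvec v * tvec u))).
Proof.
rewrite (of_tact_homog _ (of_tvec2 v u)) of_tvec2.
rewrite !sym_sum; apply: eq_bigr => w _.
rewrite !symZ !sym_mon.
rewrite (swapping_perm (@swapping_wsym _ V)).
by rewrite (scalerA ((-1) ^+ _)) -signr_addb addbb scale1r.
Qed.
End TensVectors.

Section SymIdeal.
Variable V : superspace.
Implicit Types (x y z : T rat V) (t : tens rat V) (i j : V) (w : seq V).

(** Symmetrization does not notice signed swaps; and the square of an odd vector equals
    its own negative up to a swap. *)
Lemma sym_ideal_sym t : sym_ideal t -> sym (of_tens t) = 0.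
Proof.
elim=> {t} [v u|v ov|a b _ ha _ hb|a x _ hx|a x _ hx].
- rewrite of_tensB sym_sub.
  by apply/eqP; rewrite subr_eq0; apply/eqP; exact: sym_tact2.
- rewrite of_tensM; set y := of_tens (tvec v).
  have Jy : J true y = (-1) ^+ true *: y.
    rewrite /y of_tvec J_sum scaler_sumr; apply: eq_bigr => i _.
    rewrite JZ J_let.
    have [->|/ov ->] := eqVneq (v i) 0; first by rewrite !scale0r scaler0.
    by rewrite !scalerA mulrC.
  have := sym_mulC_homog y Jy; rewrite Jy -scalerAl symZ.
  move/eqP; rewrite expr1 scaleN1r -subr_eq0 opprK -mulr2n -scaler_nat.
  by rewrite scaler_eq0 pnatr_eq0 /= => /eqP.
- by rewrite of_tensB sym_sub ha hb subr0.
- rewrite of_tensM (sym_eqr (x' := 0)) ?mulr0 ?sym0 //.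
- rewrite of_tensM (sym_eql (x' := 0)) ?mul0r ?sym0 //.
Qed.

Definition sideal x := sym_ideal (to_tens x).

Lemma sideal0 : sideal 0.
Proof.
rewrite /sideal to_tens0.
have z : tvec (0 : {ffun V -> rat}) = 0.
  by rewrite /tvec big1 // => i _; rewrite ffunE monalgU0.
rewrite -[X in sym_ideal X](mul0r (0 : tens rat V)) -z.
by apply: sym_odd => i; rewrite ffunE eqxx.
Qed.

Lemma sidealB x y : sideal x -> sideal y -> sideal (x - y).
Proof. by rewrite /sideal to_tensB; exact: symB. Qed.

Lemma sidealD x y : sideal x -> sideal y -> sideal (x + y).
Proof.
move=> kx ky; have -> : x + y = x - (0 - y) by rewrite sub0r opprK.
apply: sidealB kx _; exact: sidealB sideal0 ky.
Qed.

Lemma to_tensM x y : to_tens (x * y) = to_tens x * to_tens y.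
Proof. by apply: (can_inj (@of_tensK _ V)); rewrite of_tensM !to_tensK. Qed.

Lemma sidealMl x y : sideal x -> sideal (y * x).
Proof. by rewrite /sideal to_tensM; exact: symMl. Qed.

Lemma sidealMr x y : sideal x -> sideal (x * y).
Proof. by rewrite /sideal to_tensM; exact: symMr. Qed.

Lemma sidealZ a x : sideal x -> sideal (a *: x).
Proof. by move=> kx; rewrite -[x]mul1r scalerAl; exact: sidealMl. Qed.

Lemma sideal_sum (I : Type) (r : seq I) (F : I -> T rat V) :
  (forall k, sideal (F k)) -> sideal (\sum_(k <- r) F k).
Proof. by move=> kF; elim/big_ind: _ => // [|x y]; [exact: sideal0|exact: sidealD]. Qed.

Lemma sideal_comm i j :
  sideal (let1 rat i * let1 rat j - (-1) ^+ (spar i && spar j) *: (let1 rat j * let1 rat i)).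
Proof.
have := sym_comm (delta rat i) (delta rat j); congr sym_ideal.
apply: (can_inj (@of_tensK _ V)); rewrite to_tensK of_tensB.
rewrite of_tensM !of_tvec_delta; congr (_ - _).
have e : of_tens (tvec (delta rat i) * tvec (delta rat j)) = \sum_(w : 2.-tuple V)
    (w == [tuple i; j])%:R *: mon rat w.
  rewrite of_tensM !of_tvec_delta (bigD1 [tuple i; j]) //= eqxx scale1r monM.
  by rewrite big1 ?addr0 // => w /negPf ->; rewrite scale0r.
rewrite (of_tact_homog _ e) (bigD1 [tuple i; j]) //= eqxx scale1r big1 ?addr0; last first.
  by move=> w /negPf ->; rewrite scale0r.
have [//|_ e2 e3] := @adjacent_action V 2 ord0 ord_max [tuple i; j].
rewrite /wa e3 e2 /= monM.
by rewrite !(tnth_nth i).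
Qed.

(** Modulo the ideal, a letter may be moved to the front from any place. *)
Lemma sideal_ins i w : sideal (ins i (mon rat w) - (size w).+1%:R *: mon rat (i :: w)).
Proof.
elim: w => [|j w IH].
  by rewrite mon0 ins1 scale1r subrr; exact: sideal0.
rewrite mon_cons ins_let -mon_cons.
set s := (-1) ^+ _.
have -> : let1 rat i * mon rat (j :: w) + s *: (let1 rat j * ins i (mon rat w)) -
    (size (j :: w)).+1%:R *: mon rat [:: i, j & w] =
  s *: (let1 rat j * (ins i (mon rat w) - (size w).+1%:R *: mon rat (i :: w))) -
  ((size w).+1%:R *: ((let1 rat i * let1 rat j - s *: (let1 rat j * let1 rat i)) * mon rat w)).
  rewrite mulrBr mulrBl -!scalerAl -!scalerAr -!mulrA -!mon_cons !scalerBr.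
  set a := mon rat [:: i, j & w]; set b := let1 rat j * _.
  set c := mon rat [:: j, i & w].
  rewrite /= -[(size w).+2%:R]natr1 [(_ + 1) *: a]scalerDl scale1r.
  rewrite !scalerA [_ * s]mulrC opprB [RHS]addrA subrK [a + _]addrC.
  by rewrite opprD addrACA subrr addr0.
apply: sidealB; apply: sidealZ; first exact: sidealMl.
by apply: sidealMr; exact: sideal_comm.
Qed.

Lemma sideal_nrm_ins i x : sideal (nrm (ins i x) - let1 rat i * nrm x).
Proof.
rewrite (tens_sum x).
rewrite ins_sum !(islin_sum (@lin_nrm V)) mulr_sumr -sumrB.
apply: sideal_sum => w; rewrite insZ !(islinZ (@lin_nrm V)).
rewrite -scalerAr -scalerBr; apply: sidealZ.
rewrite /nrm degscale_ins !degscale_mon -scalerAr -mon_cons insZ.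
have -> : (size w)`!%:R^-1 = ((size w).+1)`!%:R^-1 * (size w).+1%:R :> rat.
  by rewrite factS natrM invfM mulrAC mulVf ?mul1r // pnatr_eq0.
by rewrite -scalerA -scalerBr; apply: sidealZ; exact: sideal_ins.
Qed.

(** Modulo the ideal, inserting a letter is multiplying by it, up to the number of
    places; so symmetrization is multiplication by the factorial of the degree. *)
Lemma sideal_nrm_sym x : sideal (x - nrm (sym x)).
Proof.
rewrite (tens_sum x).
rewrite sym_sum (islin_sum (@lin_nrm V)) -sumrB.
apply: sideal_sum => w; rewrite symZ (islinZ (@lin_nrm V)) -scalerBr.
apply: sidealZ; elim: w => [|i w IH].
  by rewrite mon0 sym1 -mon0 /nrm degscale_mon /= fact0 invr1 scale1r subrr; exact: sideal0.
rewrite mon_cons sym_let; set y := sym _ in IH *.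
have -> : let1 rat i * mon rat w - nrm (ins i y) =
  let1 rat i * (mon rat w - nrm y) - (nrm (ins i y) - let1 rat i * nrm y).
  by rewrite mulrBr opprB addrA subrK.
by apply: sidealB; [exact: sidealMl|exact: sideal_nrm_ins].
Qed.

Lemma sym_eq0_ideal t : sym (of_tens t) = 0 -> sym_ideal t.
Proof.
move=> s0; have := sideal_nrm_sym (of_tens t).
by rewrite s0 (islin0 (@lin_nrm V)) subr0 /sideal of_tensK.
Qed.
End SymIdeal.

(** * Orbit sums *)

Section IntegerClosure.
Variables (M : lmodType rat) (P : M -> Prop).
Hypothesis P0 : P 0.
Hypothesis PB : forall x y, P x -> P y -> P (x - y).

Lemma closedD x y : P x -> P y -> P (x + y).
Proof.
by move=> px py; rewrite -[y]opprK -[- y]sub0r; apply: (PB px (PB P0 py)).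
Qed.

Lemma closed_sum (I : Type) (r : seq I) (Q : pred I) (F : I -> M) :
  (forall k, Q k -> P (F k)) -> P (\sum_(k <- r | Q k) F k).
Proof. by move=> PF; apply: big_ind => //; exact: closedD. Qed.

Lemma closed_int a x : a \is a Num.int -> P x -> P (a *: x).
Proof.
move=> /intrP [c ->] px.
have Pn n : P (n%:R *: x).
  elim: n => [|n IH]; first by rewrite scale0r.
  by rewrite -natr1 scalerDl scale1r; exact: closedD.
case: c => n; first by rewrite -pmulrn; exact: Pn.
by rewrite NegzE mulrNz scaleNr -sub0r; apply: PB => //; rewrite -pmulrn; exact: Pn.
Qed.
End IntegerClosure.

Section Supports.
Variable V : superspace.
Implicit Types (x y z : T rat V) (i j : V) (u v w : seq V).

Lemma cf_perm v w : perm_eq v w -> exists b : bool, forall y, sinv y ->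
  cf y v = (-1) ^+ b * cf y w.
Proof.
move=> /(tuple_permP (t := in_tuple w)) [p vp].
by exists (asg (in_tuple w) p) => y sy; rewrite vp -(cf_pact p (in_tuple w) sy).
Qed.

Lemma cf_wsym_perm u v : cf (wsym rat u) v != 0 -> perm_eq v u.
Proof.
rewrite -[u]/(tval (in_tuple u)) -sum_wa cf_sum; apply: contraR => np.
apply/eqP; apply: big1 => g _; rewrite cfZ cf_mon.
have [e|_] := eqVneq; last by rewrite mulr0.
case/negP: np; apply/(tuple_permP (t := in_tuple u)); exists g.
by rewrite -e.
Qed.

Lemma cf_odd_twice y i v : sinv y -> spar i -> cf y [:: i, i & v] = 0.
Proof.
move=> sy oi; have := sy [::] i i v; rewrite /= oi expr1 mulN1r => /eqP.
by rewrite -subr_eq0 opprK -mulr2n mulrn_eq0 /= => /eqP.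
Qed.

(** The words that can occur in an invariant, see cf_adm. *)
Definition adm w := [forall i, spar i ==> (count_mem i w <= 1)%N].

Lemma cf_adm y w : sinv y -> cf y w != 0 -> adm w.
Proof.
move=> sy nz; apply/forallP => i; apply/implyP => oi; rewrite leqNgt.
apply: contra nz => c2.
have iw : i \in w by rewrite -has_pred1 has_count; exact: ltn_trans c2.
have iw' : i \in rem i w.
  rewrite -has_pred1 has_count count_rem iw /= eqxx.
  by rewrite subn_gt0.
have p : perm_eq w [:: i, i & rem i (rem i w)].
  by rewrite (permPl (perm_to_rem iw)) perm_cons perm_to_rem.
by have [b ->] := cf_perm p; rewrite // cf_odd_twice // mulr0.
Qed.

Lemma lin_iter_der m i : islin (iter m (@der rat V i)).
Proof.
elim: m => [|m IH] a x y //.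
have lmd := lin_app (lin_der i) IH.
exact: lmd.
Qed.

Lemma der_iter_ins i m x : der i x = 0 -> (spar i -> (m <= 1)%N) ->
  iter m (der i) (iter m (ins i) x) = m`!%:R *: x.
Proof.
move=> dx; elim: m x dx => [|m IH] x dx om; first by rewrite fact0 scale1r.
have om' : spar i -> (m <= 1)%N by move/om; exact: leqW.
suff e : der i (iter m.+1 (ins i) x) = m.+1%:R *: iter m (ins i) x.
  by rewrite iterSr e (islinZ (lin_iter_der m i)) IH // scalerA factS natrM.
elim: m om {IH om'} => [|m IH] om.
  by rewrite /= der_ins dx ins0 scaler0 addr0 eqxx.
rewrite iterS der_ins eqxx IH; last by move/om.
have -> : spar i && spar i = false by case: (boolP (spar i)) => // /om.
by rewrite insZ -iterS !scale1r -[m.+2%:R]natr1 scalerDl scale1r addrC.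
Qed.

Lemma cf_iter_der i m x v : cf (iter m (der i) x) v = cf x (nseq m i ++ v).
Proof. by elim: m x v => [|m IH] x v //; rewrite iterSr IH cf_der. Qed.

Lemma wsym_nseq i m w : wsym rat (nseq m i ++ w) = iter m (ins i) (wsym rat w).
Proof. by elim: m => [|m IH] //=; rewrite IH. Qed.

Lemma der_wsym_out i w : i \notin w -> der i (wsym rat w) = 0.
Proof.
move=> iw; apply/cfP => v; rewrite cf_der cf0; apply/eqP; apply: contraR iw.
by move/cf_wsym_perm/perm_mem <-; rewrite mem_head.
Qed.
End Supports.

Section Sorted.
Variables (V : superspace) (e : seq V).
Hypothesis uniq_e : uniq e.
Implicit Types (x y z : T rat V) (i j : V) (u v w : seq V) (m : V -> nat).

Definition sword (s : seq V) m : seq V := flatten [seq nseq (m i) i | i <- s].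

Lemma count_sword s m i : uniq s -> count_mem i (sword s m) = if i \in s then m i else 0%N.
Proof.
rewrite /sword; elim: s => [|j s IH] //= /andP [js us].
rewrite count_cat IH // count_nseq /=.
have [->|ne] := eqVneq i j; first by rewrite mem_head /= ?eqxx (negPf js) mul1n addn0.
by rewrite inE (negPf ne) /=.
Qed.

(** A block of m equal even letters is mapped to itself by m! permutations; the
    derivatives strip off the blocks one by one. *)
Lemma cf_wsym_sword s m : uniq s -> (forall i, spar i -> (m i <= 1)%N) ->
  cf (wsym rat (sword s m)) (sword s m) = \prod_(i <- s) (m i)`!%:R.
Proof.
move=> us om; elim: s us => [|i s IH] /= => [_|/andP [is_ us]].
  by rewrite big_nil /sword /= -mon0 cf_mon eqxx.
rewrite /sword /= -/(sword s m) wsym_nseq -cf_iter_der der_iter_ins ?cfZ.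
- by rewrite IH // big_cons.
- apply: der_wsym_out; apply/negP => /flattenP [t /mapP [j js ->]] /nseqP [ij _].
  by rewrite ij js in is_.
exact: om.
Qed.

(** A monomial in divided powers of letters. *)
Definition dmon m : T rat V := \prod_(i <- e) ((m i)`!%:R^-1 *: let1 rat i ^+ m i).

Lemma mon_nseq n i : mon rat (nseq n i) = let1 rat i ^+ n.
Proof. by elim: n => [|n IH] /=; [rewrite mon0 expr0|rewrite mon_cons IH exprS]. Qed.

Lemma dmonE m : dmon m = (\prod_(i <- e) (m i)`!%:R)^-1 *: mon rat (sword e m).
Proof.
rewrite /dmon /sword; elim: e => [|i s IH]; first by rewrite !big_nil mon0 invr1 scale1r.
rewrite !big_cons IH /= -monM mon_nseq invfM -scalerAl -scalerAr scalerA.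
by [].
Qed.

(** The sum of all rearrangements of w with signs, each taken once: the divided powers
    cancel the repetitions. *)
Definition orb w : T rat V := sym (dmon (fun i => count_mem i w)).
Definition srt w := sword e (fun i => count_mem i w).

Lemma sinv_orb w : sinv (orb w). Proof. exact: sinv_sym. Qed.

Lemma orbE w : orb w = (\prod_(i <- e) (count_mem i w)`!%:R)^-1 *: wsym rat (srt w).
Proof. by rewrite /orb dmonE symZ sym_mon. Qed.

Lemma cf_orb_perm w v : cf (orb w) v != 0 -> perm_eq v (srt w).
Proof.
rewrite orbE cfZ mulf_eq0 negb_or => /andP [_]; exact: cf_wsym_perm.
Qed.

Lemma cf_orb_srt w : adm w -> cf (orb w) (srt w) = 1.
Proof.
move/forallP=> ow; rewrite orbE cfZ cf_wsym_sword // => [|i /(implyP (ow i))//].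
rewrite mulVf // prodf_seq_neq0; apply/allP => i _.
by rewrite pnatr_eq0 -lt0n fact_gt0.
Qed.

Lemma integral_orb w : adm w -> integral (orb w).
Proof.
move=> aw v; have [->|/cf_orb_perm/cf_perm [b bP]] := eqVneq (cf (orb w) v) 0.
  exact: rpred0.
by rewrite (bP _ (sinv_orb w)) cf_orb_srt // mulr1 rpred_sign.
Qed.

Lemma orb_homog (b : bool) w : J b (orb w) = (-1) ^+ (b && wp (srt w)) *: orb w.
Proof.
apply/cfP => v; rewrite cf_J cfZ.
have [->|/cf_orb_perm p] := eqVneq (cf (orb w) v) 0; first by rewrite !mulr0.
by rewrite /wp /wpar (perm_big _ p).
Qed.

Hypothesis all_e : forall i, i \in e.

Lemma perm_srt w : perm_eq w (srt w).
Proof.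
by apply/allP => i _ /=; rewrite count_sword // all_e.
Qed.

Lemma srt_perm u v : perm_eq u v -> srt u = srt v.
Proof.
move=> /seq.permP uv; rewrite /srt /sword; congr flatten; apply: eq_map => i.
by rewrite uv.
Qed.

Lemma srtK w : srt (srt w) = srt w.
Proof. by apply: srt_perm; rewrite perm_sym perm_srt. Qed.

(** An invariant is determined by its coefficients at sorted words, and an orbit sum has
    a single sorted word. *)
Lemma orb_expand y (D : seq (seq V)) : sinv y -> uniq D -> {subset supp y <= D} ->
  y = \sum_(v <- D | srt v == v) cf y v *: orb v.
Proof.
move=> sy uD sD; apply/cfP => w; rewrite cf_sum.
have [nz|nz] := boolP (cf y w == 0).
  rewrite (eqP nz) big1_seq // => v /andP [/eqP vs _]; rewrite cfZ.
  have [->|/cf_orb_perm p] := eqVneq (cf (orb v) w) 0; first by rewrite mulr0.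
  rewrite vs in p; have [b bP] := cf_perm p.
  move/eqP: nz; rewrite bP // => /eqP; rewrite mulf_eq0 signr_eq0 /= => /eqP ->.
  by rewrite mul0r.
have [b bP] := cf_perm (perm_srt w).
have nz' : cf y (srt w) != 0.
  by apply: contra nz; rewrite bP // => /eqP ->; rewrite mulr0.
rewrite -big_filter (bigD1_seq (srt w)) ?filter_uniq //=; last first.
  by rewrite mem_filter srtK eqxx sD // mem_supp.
rewrite big1_seq ?addr0; last first.
  move=> v /andP [vw]; rewrite mem_filter => /andP [/eqP vs _]; rewrite cfZ.
  have [->|/cf_orb_perm p] := eqVneq (cf (orb v) w) 0; first by rewrite mulr0.
  by case/eqP: vw; rewrite (srt_perm p) srtK.
rewrite cfZ (bP _ (sinv_orb _)) -{3}srtK cf_orb_srt ?mulr1; last exact: cf_adm nz'.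
by rewrite bP // mulrC.
Qed.

(** The coefficients at sorted words are integral, so this is an induction principle for
    integral invariants. *)
Lemma sinv_span (P : T rat V -> Prop) : P 0 -> (forall x y, P x -> P y -> P (x - y)) ->
  (forall w, adm w -> srt w = w -> P (orb w)) -> forall y, sinv y -> integral y -> P y.
Proof.
move=> P0 PB Po y sy iy.
rewrite (orb_expand sy (supp_uniq y) (fun _ => id)).
apply: (closed_sum P0 PB) => v /eqP vs.
have [->|nz] := eqVneq (cf y v) 0; first by rewrite scale0r.
by apply: (closed_int P0 PB) => //; apply: Po => //; exact: cf_adm nz.
Qed.

Definition ders u (x : T rat V) := foldl (fun y i => der i y) x u.
Lemma cf_ders u x v : cf (ders u x) v = cf x (u ++ v).
Proof. by elim: u x => [|i u IH] x //=; rewrite IH cf_der. Qed.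
Lemma sinv_ders u x : sinv x -> sinv (ders u x).
Proof. by elim: u x => [|i u IH] x sx //=; apply: IH; exact: sinv_der. Qed.

(** Both factors of the coproduct of an invariant are invariant, so both can be expanded
    in orbit sums; the coefficients are among those of the given element. *)
Lemma dsum_orb (W : lmodType rat) (G : seq V -> seq V -> W) x : sinv x ->
  exists D1 D2 : seq (seq V), dsum G x =
    \sum_(v <- D2 | srt v == v) \sum_(u <- D1 | srt u == u)
      cf x (u ++ v) *: linx (fun u' => linx (G u') (orb v)) (orb u).
Proof.
move=> sx; pose D1 := undup (map fst (splits x)); pose D2 := undup (map snd (splits x)).
have uD1 : uniq D1 by exact: undup_uniq.
have uD2 : uniq D2 by exact: undup_uniq.
have inD u v : cf x (u ++ v) != 0 -> (u \in D1) && (v \in D2).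
  move=> nz; rewrite !mem_undup; apply/andP; split; apply/mapP; exists (u, v) => //;
  by rewrite mem_splits.
exists D1, D2.
rewrite (@dsumEw _ _ _ _ _ (allpairs pair D1 D2)); first last.
- move=> [u v]; rewrite mem_splits /= => /inD /andP [h1 h2].
  by apply/allpairsP; exists (u, v).
- by apply: allpairs_uniq => // -[a b] [c d] _ _ /= [-> ->].
rewrite big_allpairs.
pose rsl v := \sum_(u <- D1) cf x (u ++ v) *: mon rat u.
have cf_rsl v u : cf (rsl v) u = cf x (u ++ v).
  rewrite /rsl cf_sum; have [uD|uD] := boolP (u \in D1).
    rewrite (bigD1_seq u) //= cfZ cf_mon eqxx mulr1 big1 ?addr0 // => u' /negPf ne.
    by rewrite cfZ cf_mon ne mulr0.
  rewrite big1_seq => [|u' /= u'D].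
    by apply/esym/eqP; apply: contraR uD => /inD /andP [].
  rewrite cfZ cf_mon; have [uu|_] := eqVneq; last by rewrite mulr0.
  by rewrite -?uu ?u'D // uu u'D in uD.
have s_rsl v : sinv (rsl v) by move=> a i j b; rewrite !cf_rsl -!catA; exact: sx.
transitivity (\sum_(u <- D1) \sum_(v <- D2 | srt v == v)
   cf x (u ++ v) *: linx (G u) (orb v)).
  apply: eq_bigr => u _ /=.
  have sD : {subset supp (ders u x) <= D2}.
    by move=> v; rewrite mem_supp cf_ders => /inD /andP [].
  transitivity (linx (G u) (ders u x)).
    by rewrite (linxEw _ uD2 sD); apply: eq_bigr => v _; rewrite cf_ders.
  rewrite {1}(orb_expand (sinv_ders u sx) uD2 sD) (islin_sum (lin_linx _)).
  by apply: eq_bigr => v _; rewrite (islinZ (lin_linx _)) cf_ders.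
rewrite exchange_big; apply: eq_bigr => v _ /=.
have sD : {subset supp (rsl v) <= D1}.
  by move=> u; rewrite mem_supp cf_rsl => /inD /andP [].
transitivity (linx (fun u => linx (G u) (orb v)) (rsl v)).
  by rewrite (linxEw _ uD1 sD); apply: eq_bigr => u _; rewrite cf_rsl.
rewrite {1}(orb_expand (s_rsl v) uD1 sD) (islin_sum (lin_linx _)).
by apply: eq_bigr => u _; rewrite (islinZ (lin_linx _)) cf_rsl.
Qed.

(** The form in which the coproduct is used: the coefficients in dsum_orb are integral,
    and orbit sums are integral and homogeneous. *)
Lemma dsum_span (W : lmodType rat) (P : W -> Prop) (G : seq V -> seq V -> W) x :
  P 0 -> (forall a b, P a -> P b -> P (a - b)) ->
  (forall y z, sinv y -> integral y -> sinv z -> integral z ->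
     (exists p, forall b : bool, J b y = (-1) ^+ (b && p) *: y) ->
     (exists p, forall b : bool, J b z = (-1) ^+ (b && p) *: z) ->
     P (linx (fun u => linx (G u) z) y)) ->
  sinv x -> integral x -> P (dsum G x).
Proof.
move=> P0 PB Po sx ix; have [D1 [D2 ->]] := dsum_orb G sx.
apply: (closed_sum P0 PB) => v /eqP vs; apply: (closed_sum P0 PB) => u /eqP us.
have [->|nz] := eqVneq (cf x (u ++ v)) 0; first by rewrite scale0r.
have /forallP auv := cf_adm sx nz.
have au : adm u.
  apply/forallP => i; apply/implyP => /(implyP (auv i)); rewrite count_cat.
  by apply: leq_trans; rewrite leq_addr.
have av : adm v.
  apply/forallP => i; apply/implyP => /(implyP (auv i)); rewrite count_cat.
  by apply: leq_trans; rewrite leq_addl.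
apply: (closed_int P0 PB) => //; apply: Po => //.
- exact: sinv_orb.
- exact: integral_orb.
- exact: sinv_orb.
- exact: integral_orb.
- by exists (wp (srt u)) => b; exact: orb_homog.
- by exists (wp (srt v)) => b; exact: orb_homog.
Qed.
End Sorted.

(** * Divided powers and symmetrization *)

Section Homogeneous.
Variable V : superspace.
Implicit Types (x y : T rat V) (p : bool).

Lemma thomP p (t : tens rat V) : thom p t <-> J true (of_tens t) = (-1) ^+ p *: of_tens t.
Proof.
split=> [ht|hJ w].
  apply/cfP => w; rewrite cf_J cfZ; have [->|nz] := eqVneq (cf (of_tens t) w) 0.
    by rewrite !mulr0.
  by rewrite /= /wp (ht w) // -mcoeff_neq0 -cf_of.
rewrite -mcoeff_neq0 -cf_of => nz; have := congr1 (fun x => cf x w) hJ.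
rewrite cf_J cfZ => /(mulIf nz) /=; rewrite /wp.
by case: (odd _); case: p {hJ} => //= /eqP; rewrite ?expr0 ?expr1 1?eq_sym eqrNxx oner_eq0.
Qed.

Lemma thom_ofZ p (t : tens int V) : thom p t <-> J true (ofZ t) = (-1) ^+ p *: ofZ t.
Proof.
rewrite -thomP; split=> h w; rewrite -mcoeff_neq0 => nz; apply: h.
  by move: nz; rewrite -cf_of cf_ofZ intr_eq0 mcoeff_neq0.
by rewrite -mcoeff_neq0 -cf_of cf_ofZ intr_eq0 mcoeff_neq0 -mcoeff_neq0.
Qed.
End Homogeneous.

Section Vectors.
Variable V : superspace.
Implicit Types (x y : T rat V) (v : {ffun V -> int}) (i : V) (m : nat).

Lemma ofZ_tvec v : ofZ (tvec v) = \sum_i (v i)%:~R *: let1 rat i.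
Proof.
rewrite ofZ_bc of_tvec bc_sum; apply: eq_bigr => i _.
by rewrite bcZ bc_let.
Qed.

Lemma ofZ_delta i : ofZ (tvec (delta int i)) = let1 rat i.
Proof. by rewrite ofZ_bc of_tvec_delta bc_let. Qed.

Lemma cf_tvec v x w : cf (ofZ (tvec v) * x) w =
  if w is j :: w' then (v j)%:~R * cf x w' else 0.
Proof.
rewrite ofZ_tvec mulr_suml cf_sum.
case: w => [|j w].
  by rewrite big1 // => i _; rewrite -scalerAl cfZ cf_let mulr0.
rewrite (bigD1 j) //= -scalerAl cfZ cf_let eqxx mul1r big1 ?addr0 // => i /negPf ne.
by rewrite -scalerAl cfZ cf_let ne mul0r mulr0.
Qed.

Lemma cf_tvecX v m w : cf (ofZ (tvec v) ^+ m) w =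
  if size w == m then \prod_(i <- w) (v i)%:~R else 0.
Proof.
elim: m w => [|m IH] w; first by rewrite expr0 -mon0 cf_mon; case: w => [|i w]; rewrite ?big_nil.
rewrite exprS cf_tvec; case: w => [|i w] //=.
by rewrite IH eqSS big_cons; case: ifP => //; rewrite mulr0.
Qed.

Lemma sinv_tvecX v m : even_vec v -> sinv (ofZ (tvec v) ^+ m).
Proof.
move=> ev a i j b; rewrite !cf_tvecX !size_cat /=; case: ifP => _; last by rewrite mulr0.
rewrite !big_cat !big_cons /=; have [->|/ev/negPf ->] := eqVneq (v i) 0.
  by rewrite !(mul0r, mulr0).
by rewrite /= mul1r; congr (_ * _); rewrite mulrCA.
Qed.

Lemma of_tensX (t : tens rat V) m : of_tens (t ^+ m) = of_tens t ^+ m.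
Proof. by elim: m => [|m IH]; rewrite ?expr0 ?of_tens1 // !exprS of_tensM IH. Qed.

Lemma of_divpow v m : of_tens (divpow v m) = m`!%:R^-1 *: ofZ (tvec v) ^+ m.
Proof. by rewrite /divpow of_tensZ of_tensX. Qed.

(** The power of an even vector is invariant, hence multiplied by m! under sym. *)
Lemma sym_divpow v m : even_vec v -> sym (of_tens (divpow v m)) = ofZ (tvec v) ^+ m.
Proof.
move=> ev; rewrite of_divpow symZ; apply/cfP => w.
rewrite cfZ cf_sym_sinv; last exact: sinv_tvecX.
rewrite cf_tvecX; case: eqP => [->|_]; last by rewrite !mulr0.
by rewrite mulKf // pnatr_eq0 -lt0n fact_gt0.
Qed.

Lemma sym_tvec v : sym (ofZ (tvec v)) = ofZ (tvec v).
Proof.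
rewrite ofZ_tvec sym_sum; apply: eq_bigr => i _.
by rewrite symZ -[let1 _ _]mulr1 sym_let sym1 ins1 mulr1.
Qed.

Lemma divpow0 v : divpow v 0 = 1.
Proof. by rewrite /divpow fact0 invr1 scale1r expr0. Qed.

Lemma even_delta i : ~~ spar i -> even_vec (delta int i).
Proof. by move=> ei j; rewrite ffunE; have [<-|] := eqVneq i j. Qed.
Lemma odd_delta i : spar i -> odd_vec (delta int i).
Proof. by move=> ei j; rewrite ffunE; have [<-|] := eqVneq i j. Qed.

Lemma dsym1 : dsym (1 : tens rat V).
Proof.
rewrite -(divpow0 0); apply: zalg_gen; apply: dsym_even => i.
by rewrite ffunE eqxx.
Qed.

Lemma dsym_dmon (e : seq V) (m : V -> nat) : (forall i, spar i -> (m i <= 1)%N) ->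
  dsym (to_tens (dmon e m)).
Proof.
move=> om; rewrite /dmon; elim: e => [|i e IH].
  by rewrite big_nil -of_tens1 of_tensK; exact: dsym1.
rewrite big_cons to_tensM; apply: zalgM => //.
have {IH} -> : to_tens ((m i)`!%:R^-1 *: let1 rat i ^+ m i) = divpow (delta int i) (m i).
  by apply: (can_inj (@of_tensK _ V)); rewrite to_tensK of_divpow ofZ_delta.
have [oi|ei] := boolP (spar i); last by apply: zalg_gen; apply: dsym_even; exact: even_delta.
(* An odd letter has exponent 0 or 1. *)
have := om i oi; case: (m i) => [|[|//]] _; first by rewrite divpow0; exact: dsym1.
rewrite /divpow (_ : 1`! = 1%N) // invr1 scale1r expr1; apply: zalg_gen; apply: dsym_odd.
exact: odd_delta.
Qed.

(** Both the shuffle product and the symmetrizations of the generators are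
    integral. *)
Lemma dsym_integral (t : tens rat V) : dsym t -> integral (sym (of_tens t)).
Proof.
elim=> {t} [x [v m ev|v ov|t it]||s t _ is_ _ it|s t _ is_ _ it].
- by rewrite sym_divpow // -ofZX; exact: integral_ofZ.
- by rewrite -[of_tens _]/(ofZ _) sym_tvec; exact: integral_ofZ.
- by move=> w; rewrite sym_ideal_sym // cf0.
- by move=> w; rewrite of_tens0 sym0 cf0.
- rewrite of_tensB sym_sub.
  exact: integralB.
- by rewrite of_tensM -shf_sym; exact: integral_shf.
Qed.

(** Orbit sums are symmetrizations of monomials in divided powers, and odd letters are
    not repeated in them. *)
Lemma dsym_surj y : sinv y -> integral y -> exists2 t, dsym t & sym (of_tens t) = y.
Proof.
move: y; apply: (@sinv_span V (enum V) (enum_uniq _) (mem_enum V)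
  (fun y => exists2 t, dsym t & sym (of_tens t) = y)).
- by exists 0; [exact: zalg0|rewrite of_tens0 sym0].
- move=> y z [s ds <-] [t dt <-]; exists (s - t); first exact: zalgB.
  by rewrite of_tensB sym_sub.
move=> w aw _; exists (to_tens (dmon (enum V) (fun i => count_mem i w))).
  by apply: dsym_dmon => i; apply/implyP; exact: (forallP aw).
by rewrite to_tensK.
Qed.

Lemma ideal_sym_eq (s t : tens rat V) :
  sym_ideal (s - t) <-> sym (of_tens s) = sym (of_tens t).
Proof.
split=> [/sym_ideal_sym|st].
  by rewrite of_tensB sym_sub => /eqP; rewrite subr_eq0 => /eqP.
apply: sym_eq0_ideal.
by rewrite of_tensB sym_sub st subrr.
Qed.

Lemma integral_dsym (t : tens rat V) : integral (sym (of_tens t)) -> dsym t.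
Proof.
move=> it; have [s ds e] := dsym_surj (sinv_sym _) it.
rewrite -[t](subrK s); apply: (@closedD _ (@dsym V) (@zalg0 _ _ _) (@zalgB _ _ _)) => //.
by apply: zalg_gen; apply: dsym_ideal; apply/ideal_sym_eq.
Qed.

Lemma dsymP (t : tens rat V) : dsym t <-> integral (sym (of_tens t)).
Proof. by split; [exact: dsym_integral|exact: integral_dsym]. Qed.

Definition kappaZ (t : tens rat V) : tens int V := toZ (sym (of_tens t)).

Lemma ofZ_kappaZ t : dsym t -> ofZ (kappaZ t) = sym (of_tens t).
Proof. by move/dsym_integral; exact: ofZK. Qed.

(** All properties of kappa are those of sym: it is multiplicative for shuffles, its
    kernel is the ideal, and its image is known by orbit sums. *)
Lemma kappaZ_is_kappa : is_kappa kappaZ.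
Proof.
have kE (t : tens rat V) (s : tens int V) : dsym t -> sym (of_tens t) = ofZ s -> kappaZ t = s.
  by move=> dt e; apply: ofZ_inj; rewrite ofZ_kappaZ.
have dev v m : even_vec v -> dsym (divpow v m).
  by move=> ev; apply: zalg_gen; exact: dsym_even.
have dod v : odd_vec v -> dsym (extQ (tvec v)).
  by move=> ov; apply: zalg_gen; exact: dsym_odd.
split; last 2 first.
- by move=> v m ev; apply: kE; [exact: dev|rewrite sym_divpow // ofZX].
- by move=> v ov; apply: kE; [exact: dod|exact: sym_tvec].
split=> /=.
- by move=> x dx; rewrite inv_ofZ ofZ_kappaZ //; exact: sinv_sym.
- move=> x y dx dy; apply: kE; first exact: zalgB.
  by rewrite of_tensB sym_sub ofZB !ofZ_kappaZ.
- move=> x y dx dy; split=> [h|h].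
    by apply: kE => //; rewrite (ofZ_kappaZ dy); apply/ideal_sym_eq; exact: h.
  have h' : kappaZ x = kappaZ y by exact: h.
  have : sym (of_tens x) = sym (of_tens y) by rewrite -(ofZ_kappaZ dx) -(ofZ_kappaZ dy) h'.
  by move/(ideal_sym_eq x y).
- move=> y; rewrite inv_ofZ => sy; have [t dt e] := dsym_surj sy (integral_ofZ y).
  by exists t => //; apply: kE.
- by move=> x y; exact: zalgM.
- move=> x y dx dy; apply: kE; first exact: zalgM.
  by rewrite ofZ_shuffle !ofZ_kappaZ // shf_sym of_tensM.
- move=> p x dx; rewrite thomP thom_ofZ ofZ_kappaZ // => h.
  by rewrite -sym_J h symZ.
Qed.
End Vectors.

(** * Integral elements of the dual *)

Lemma integral_sym (V : superspace) (y : T rat V) : integral y -> integral (sym y).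
Proof.
move=> iy v; rewrite (tens_sum y) sym_sum cf_sum; apply: rpred_sum => w _.
rewrite symZ cfZ; apply: rpredM => //; move: v.
elim: w => [|i w IH]; first by rewrite mon0 sym1 -mon0 => v; rewrite cf_mon; case: eqP.
rewrite mon_cons -shf_sym; apply: integral_shf => // v.
by rewrite -[let1 _ _]mulr1 sym_let sym1 ins1 cf_mon; case: eqP.
Qed.

Section IntegralDual.
Variable V : superspace.
Local Notation VD := (dualsp V).
Implicit Types (x y : T rat VD) (z : T rat V).

Lemma integral_pr x z : integral x -> integral z -> pr x z \is a Num.int.
Proof.
move=> ix iz; rewrite /pr linxE; apply: rpred_sum => w _.
by apply: rpredM => //; apply: rpredM => //; exact: rpred_sign.
Qed.

(** If x has integral pairings with the orbit sums, replace x by the combination of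
    sorted words that has the same symmetrization: its coefficients are these
    pairings, up to signs. *)
Lemma dual_integral x :
  (forall z, sinv z -> integral z -> pr x z \is a Num.int) <->
  (exists2 y, integral y & sym x = sym y).
Proof.
split=> [ix|[y iy e] z sz iz]; last by rewrite (pr_sym_eq sz e); exact: integral_pr.
pose s := sym x; have ss : sinv s by exact: sinv_sym.
pose e : seq V := enum V.
have ue : uniq e by exact: enum_uniq.
have ae (i : V) : i \in e by exact: mem_enum.
pose D := supp s.
pose f (v : seq V) : rat := \prod_(i <- e) (count_mem i v)`!%:R.
(* This has the same symmetrization as x, because sorted words symmetrize to
   multiples of orbit sums. *)
pose y := \sum_(v <- D | srt (e : seq VD) v == v) ((f v)^-1 * cf s v) *: mon rat (v : seq VD).
have xy : sym x = sym y.
  rewrite -/s [LHS](@orb_expand VD e ue ae s D ss (supp_uniq _) (fun _ => id)).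
  rewrite /y sym_sum; apply: eq_bigr => v /eqP vs.
  by rewrite symZ sym_mon orbE vs scalerA mulrC.
exists y => // w; rewrite /y cf_sum big_seq_cond; apply: rpred_sum => v /andP [vD /eqP vs].
rewrite cfZ; apply: rpredM; last by rewrite cf_mon; case: eqP.
have nz : cf s v != 0 by rewrite -mem_supp.
have av : adm (v : seq V) by exact: cf_adm ss nz.
have := ix (orb e v) (sinv_orb e v) (integral_orb ue av).
rewrite (pr_sym_eq (sinv_orb e v) xy).
rewrite {1}/y (islin_sum (lin_prl _)) -big_filter (bigD1_seq v) ?filter_uniq ?supp_uniq //=; last first.
  by rewrite mem_filter vs eqxx.
rewrite big1_seq ?addr0 => [|u /andP [uv]]; last first.
  rewrite mem_filter => /andP [/eqP us _]; rewrite (islinZ (lin_prl _)) pr_mon.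
  have [->|/cf_orb_perm p] := eqVneq (cf (orb e v) u) 0; first by rewrite mulr0 scaler0.
  case/eqP: uv; rewrite -us -[RHS]vs.
  have h := @srt_perm V e u _ p; rewrite (srtK ue ae) in h; exact: h.
rewrite (islinZ (lin_prl _)) pr_mon.
have -> : cf (orb e v) v = 1 by have h := cf_orb_srt ue av; rewrite [X in cf _ X](vs : srt e (v : seq V) = v) in h.
rewrite mulr1 -[_ *: _]/(_ * _) => h.
have := rpredM h (rpred_sign _ (eps (v : seq V))).
by rewrite -mulrA -signr_addb addbb mulr1.
Qed.
End IntegralDual.

Section Subgroups.
Variable X : superalgebra.
Local Notation V := (sspace X).
Local Notation VD := (dualsp V).
Local Notation VT := (sspace (trivext X)).
Implicit Types (x y : tens rat VD) (c : tens rat V).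

Lemma inv_dualP x : inv_dual x <-> exists2 y, integral y & sym (of_tens x) = sym y.
Proof.
rewrite -dual_integral; split=> h z.
  move=> sz iz; have := h (toZ z); rewrite inv_ofZ ofZK // => /(_ sz).
  by rewrite of_tpair -/(ofZ _) ofZK.
by rewrite inv_ofZ => sz; rewrite of_tpair; apply: h => //; exact: integral_ofZ.
Qed.

Lemma iD_inj : injective (@iD rat X).
Proof.
move=> x y e; apply/cfP => w.
by rewrite -!(cf_lmap_inj (@ir_inj X)) -/(iD _) e.
Qed.

Lemma integral_iD (y : T rat VD) : integral (iD y) -> integral y.
Proof. by move=> iy w; rewrite -(cf_lmap_inj (@ir_inj X)); exact: iy. Qed.

Lemma iD_sym_tract x c : sinv (of_tens c) ->
  iD (sym (of_tens (tract x c))) = tm (iD (sym (of_tens x))) (iX (of_tens c)).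
Proof.
move=> sc; rewrite /iD (lmap_sym (@spar_ir X)) -/(iD _) of_tract.
by rewrite sym_tml ?(lmap_sym (@spar_ir X)) //; exact: (sinv_lmap (@spar_il X)).
Qed.

Lemma iD_sym_tlact x c : sinv (of_tens c) ->
  iD (sym (of_tens (tlact c x))) = tm (iX (of_tens c)) (iD (sym (of_tens x))).
Proof.
move=> sc; rewrite /iD (lmap_sym (@spar_ir X)) -/(iD _) of_tlact.
by rewrite sym_tmr ?(lmap_sym (@spar_ir X)) //; exact: (sinv_lmap (@spar_il X)).
Qed.

(** What makes a subgroup of the tensor algebra of the dual define a subring of the
    double. *)
Record good (S : tens rat VD -> Prop) : Prop := Good {
  good0 : S 0;
  goodB : forall x y, S x -> S y -> S (x - y);
  goodM : forall x y, S x -> S y -> S (x * y);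
  goodJ : forall (b : bool) x, S x -> S (to_tens (J b (of_tens x)));
  good_tract : forall x c, S x -> sinv (of_tens c) -> integral (of_tens c) -> S (tract x c);
  good_tlact : forall x c, S x -> sinv (of_tens c) -> integral (of_tens c) -> S (tlact c x)
}.

(** The actions commute with symmetrization, and products of integral elements are
    integral. *)
Lemma good_dsym : good (@dsym VD).
Proof.
split.
- exact: zalg0.
- by move=> x y; exact: zalgB.
- by move=> x y; exact: zalgM.
- by move=> b x /dsymP ix; apply/dsymP; rewrite to_tensK sym_J; exact: integral_J.
- move=> x c /dsymP ix sc ic; apply/dsymP; apply: integral_iD; rewrite iD_sym_tract //.
  by apply: integral_tm; exact: integral_lmap.
- move=> x c /dsymP ix sc ic; apply/dsymP; apply: integral_iD; rewrite iD_sym_tlact //.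
  by apply: integral_tm; exact: integral_lmap.
Qed.

(** Here all operations can be performed on integral representatives. *)
Lemma good_inv_dual : good (@inv_dual X).
Proof.
split.
- apply/inv_dualP; exists 0; first by move=> w; rewrite cf0.
  by rewrite of_tens0.
- move=> x y /inv_dualP [x' ix ex] /inv_dualP [y' iy ey]; apply/inv_dualP.
  exists (x' - y'); first exact: integralB.
  by rewrite of_tensB !sym_sub ex ey.
- move=> x y /inv_dualP [x' ix ex] /inv_dualP [y' iy ey]; apply/inv_dualP.
  exists (x' * y'); first by rewrite -(ofZK ix) -(ofZK iy) -ofZM; exact: integral_ofZ.
  by rewrite of_tensM (sym_eql _ ex) (sym_eqr _ ey).
- move=> b x /inv_dualP [x' ix ex]; apply/inv_dualP; exists (J b x'); first exact: integral_J.
  by rewrite to_tensK !sym_J ex.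
- move=> x c /inv_dualP [x' ix ex] sc ic; apply/inv_dualP.
  exists (of_tens (tract (to_tens x') c)).
    apply: integral_iD; rewrite of_tract to_tensK.
    by apply: integral_tm; exact: integral_lmap.
  by apply: iD_inj; rewrite !iD_sym_tract // to_tensK ex.
- move=> x c /inv_dualP [x' ix ex] sc ic; apply/inv_dualP.
  exists (of_tens (tlact c (to_tens x'))).
    apply: integral_iD; rewrite of_tlact to_tensK.
    by apply: integral_tm; exact: integral_lmap.
  by apply: iD_inj; rewrite !iD_sym_tlact // to_tensK ex.
Qed.

Lemma inv_dual_dsym x : inv_dual x -> dsym x.
Proof. by move/inv_dualP => [y iy e]; apply/dsymP; rewrite e; exact: integral_sym. Qed.
End Subgroups.

(** * The product of the double *)

Section LinearMaps.
Variables (R : comNzRingType) (V V' : superspace).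

Lemma linx_lin (W : lmodType R) (F : T R V -> W) x : islin F ->
  linx (fun u => F (mon R u)) x = F x.
Proof.
move=> lF; move: x; apply: tens_eq => [||u]; [exact: lin_linx|exact: lF|].
by rewrite linx_mon.
Qed.

Lemma eq_linx_supp (W : lmodType R) (f g : seq V -> W) x :
  (forall u, cf x u != 0 -> f u = g u) -> linx f x = linx g x.
Proof.
move=> fg; rewrite !linxE; apply: eq_big_seq => u; rewrite mem_supp => nz.
by rewrite fg.
Qed.

Lemma linx_par (U W : lmodType R) (F : U -> seq V -> W) x :
  (forall u, islin (fun y => F y u)) -> islin (fun y => linx (F y) x).
Proof.
move=> lF a y z; rewrite !linxE scaler_sumr -big_split; apply: eq_bigr => u _.
by rewrite lF scalerDr !scalerA mulrC.
Qed.

Lemma lext_tprod (L : choiceType) (f : word V * word (dualsp V) -> {malg R[L]})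
    (s : tens R V) (x : tens R (dualsp V)) :
  lext f (tprod s x) =
  linx (fun u => linx (fun a => f (u : word V, a : word (dualsp V))) (of_tens x)) (of_tens s).
Proof.
rewrite /tprod linxE /supp of_tensK (islin_sum (lin_lext f)); apply: eq_bigr => u _.
rewrite linxE /supp of_tensK (islin_sum (lin_lext f)) scaler_sumr; apply: eq_bigr => a _.
by rewrite malgUE (islinZ (lin_lext f)) lextU scalerA !cf_of.
Qed.

Lemma malg_lin_tprod (W : lmodType R) (f : word V * word (dualsp V) -> W)
    (s : tens R V) (x : tens R (dualsp V)) :
  malg_lin f (tprod s x) =
  linx (fun u => linx (fun a => f (u : word V, a : word (dualsp V))) (of_tens x)) (of_tens s).
Proof.
rewrite /tprod linxE /supp of_tensK (islin_sum (lin_malg_lin f)); apply: eq_bigr => u _.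
rewrite linxE /supp of_tensK (islin_sum (lin_malg_lin f)) scaler_sumr; apply: eq_bigr => a _.
by rewrite malgUE (islinZ (lin_malg_lin f)) malg_linU scalerA !cf_of.
Qed.

End LinearMaps.

Section Tprod.
Variables (R : comNzRingType) (V : superspace).

Lemma tprod_linx (s : tens R V) (x : tens R (dualsp V)) : tprod s x =
  linx (fun u => linx (fun a => << (u : word V, a : word (dualsp V)) >>) (of_tens x)) (of_tens s)
  :> tens2 R V.
Proof.
rewrite -(lext_tprod (fun k => << k >>) s x); move: (tprod s x); apply: lin_eq; [exact: lin_id|exact: lin_lext|].
by move=> k; rewrite lextU.
Qed.

Lemma lin_tprodl (x : tens R (dualsp V)) : islin (fun s : tens R V => tprod s x).
Proof.
by move=> a s t; rewrite !tprod_linx (@lin_of R V) lin_linx.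
Qed.

Lemma lin_tprodr (s : tens R V) : islin (tprod s).
Proof.
move=> a x y; rewrite !tprod_linx (@lin_of R (dualsp V)).
by move: a (of_tens x) (of_tens y); apply: linx_par => u; exact: lin_linx.
Qed.
End Tprod.

Section Dmul.
Variables (R : comNzRingType) (X : superalgebra).
Local Notation V := (sspace X).
Local Notation VD := (dualsp V).
Local Notation VT := (sspace (trivext X)).

Lemma lin_dmull (z' : tens2 R V) : islin (fun z => @dmul R X z z').
Proof. exact: lin_lext. Qed.

Lemma lin_dmulr (z : tens2 R V) : islin (@dmul R X z).
Proof. exact: lin_lext_lextr. Qed.

Lemma lin_tract (c : tens R V) : islin (fun x => @tract R X x c).
Proof. exact: lin_lext. Qed.
Lemma lin_tlact (c : tens R V) : islin (@tlact R X c).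
Proof. exact: lin_lext. Qed.

Lemma lin_tmull (t : tens R V) : islin (fun s => @tmul R X s t).
Proof.
move=> a x y; apply: (can_inj (@of_tensK R V)).
by rewrite of_tmul (@lin_of R V) (lin_tml _) -!of_tmul (@lin_of R V).
Qed.
Lemma lin_tmulr (s : tens R V) : islin (@tmul R X s).
Proof.
move=> a x y; apply: (can_inj (@of_tensK R V)).
by rewrite of_tmul (@lin_of R V) (lin_tmr _) -!of_tmul (@lin_of R V).
Qed.

Definition dsign (u1 u2 w1 w2 : seq V) : bool :=
  (wp u1 && (wp u2 (+) (wp w1 (+) wp w2))).

(** A term of the product of the double, in which the part of the sign that involves the
    parity of x has been absorbed into x. *)
Definition dterm (x y : T R VD) (u1 u2 w1 w2 : seq V) : tens2 R V :=
  (-1) ^+ dsign u1 u2 w1 w2 *: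
  tprod (@tmul R X << (u2 : word V) >> << (w1 : word V) >>)
    (@tract R X (to_tens (J (wp u1 (+) wp w1) x)) << (w2 : word V) >> *
     @tlact R X << (u1 : word V) >> (to_tens y)).

Lemma to_mon (U : superspace) (u : seq U) : to_tens (mon R u) = << (u : word U) >>.
Proof. exact: of_tensK. Qed.

Lemma lin_malgMl (U : superspace) (t : tens R U) : islin (fun s : tens R U => s * t).
Proof. by move=> a x y; rewrite mulrDl -scalerAl. Qed.
Lemma lin_malgMr (U : superspace) (t : tens R U) : islin (fun s : tens R U => t * s).
Proof. by move=> a x y; rewrite mulrDr malg_scalerAr. Qed.

Lemma lin_dtermx y u1 u2 w1 w2 : islin (fun x => dterm x y u1 u2 w1 w2).
Proof.
apply: lin_scale; apply: (lin_app (lin_tprodr _)); apply: (lin_app (lin_malgMl _)).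
by apply: (lin_app (lin_tract _)); apply: (lin_app (@lin_to R VD)); exact: lin_J.
Qed.

Lemma lin_dtermy x u1 u2 w1 w2 : islin (fun y => dterm x y u1 u2 w1 w2).
Proof.
apply: lin_scale; apply: (lin_app (lin_tprodr _)); apply: (lin_app (lin_malgMr _)).
by apply: (lin_app (lin_tlact _)); exact: (@lin_to R VD).
Qed.

Lemma wdsum_deconc (W : lmodType R) (G : seq V -> seq V -> W) (w : seq V) :
  wdsum G w = \sum_(r <- @deconc X (w : word V)) G r.1 r.2.
Proof.
rewrite /wdsum /deconc big_map -(big_mkord xpredT (fun m => G (take m w) (drop m w))).
by rewrite /index_iota subn0.
Qed.

Lemma wdmul_mon (u a w b : seq V) :
  @wdmul R X (u : word V, a : word VD) (w : word V, b : word VD) =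
  wdsum (fun u1 u2 => wdsum (dterm (mon R (a : seq VD)) (mon R (b : seq VD)) u1 u2) w) u.
Proof.
rewrite wdsum_deconc /wdmul; apply: eq_bigr => -[u1 u2] _.
rewrite wdsum_deconc; apply: eq_big_seq => -[w1 w2] /mapP [n _ [-> ->]].
rewrite [(take n w, drop n w).1]/= [(take n w, drop n w).2]/= [(u1, u2).1]/= [(u1, u2).2]/=.
rewrite /dterm !J_mon to_tensZ !to_mon.
rewrite (islinZ (lin_tract _)) (islinZ (lin_malgMl _)) (islinZ (lin_tprodr _)).
rewrite scalerA -signr_addb -signr_odd; congr (_ *: _).
rewrite oddD !oddM !oddD -!/(wp _) /dsign; congr (_ ^+ nat_of_bool _).
rewrite -[in wp w](cat_take_drop n w) wp_cat.
by bcases.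
Qed.

Lemma dmul_tprod (s t : T R V) (x y : T R VD) :
  dmul (tprod (to_tens s) (to_tens x)) (tprod (to_tens t) (to_tens y)) =
  dsum (fun u1 u2 => dsum (dterm x y u1 u2) t) s.
Proof.
move: s; apply: tens_eq => [||u].
- apply: (lin_app (lin_dmull _)); apply: (lin_app (lin_tprodl _)); exact: lin_to.
- exact: lin_dsum.
move: t; apply: tens_eq => [||w].
- apply: (lin_app (lin_dmulr _)); apply: (lin_app (lin_tprodl _)); exact: lin_to.
- by apply: lin_dsum_par => u1 u2; exact: lin_dsum.
move: x; apply: tens_eq => [||a].
- apply: (lin_app (lin_dmull _)); apply: (lin_app (lin_tprodr _)); exact: lin_to.
- by apply: lin_dsum_par => u1 u2; apply: lin_dsum_par => w1 w2; exact: lin_dtermx.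
move: y; apply: tens_eq => [||b].
- apply: (lin_app (lin_dmulr _)); apply: (lin_app (lin_tprodr _)); exact: lin_to.
- by apply: lin_dsum_par => u1 u2; apply: lin_dsum_par => w1 w2; exact: lin_dtermy.
rewrite dsum_mon /dmul lext_tprod !to_tensK !linx_mon lext_tprod !to_tensK !linx_mon.
rewrite wdmul_mon; apply: eq_bigr => m _; rewrite dsum_mon.
by [].
Qed.
End Dmul.

(** * Subrings of the double *)

Section Closure.
Variable X : superalgebra.
Local Notation V := (sspace X).
Local Notation VD := (dualsp V).
Local Notation VT := (sspace (trivext X)).
Variable S : tens rat VD -> Prop.
Hypothesis gS : good S.

Lemma double_tprod (s : T rat V) (x : tens rat VD) : sinv s -> integral s -> S x ->
  double_of S (tprod (to_tens s) x).
Proof.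
move=> ss is_ Sx; apply: zspan_gen; exists (toZ s), x; split; first 2 last.
- by congr tprod; apply: (can_inj (@of_tensK _ _)); rewrite to_tensK -/(ofZ _) ofZK.
- by rewrite inv_ofZ ofZK.
- exact: Sx.
Qed.

Lemma lin_iX : islin (@iX rat X). Proof. exact: lin_lmap. Qed.
Lemma lin_iD : islin (@iD rat X). Proof. exact: lin_lmap. Qed.

(** Linearity is inherited from the product of the trivial extension. *)
Lemma lin_tractr (x : tens rat VD) : islin (@tract rat X x).
Proof.
have [F FE] : exists F, forall c, F c = of_tens (tract x c) by exists (fun c => of_tens (tract x c)).
have iF c : iD (F c) = tm (iD (of_tens x)) (iX (of_tens c)) by rewrite FE of_tract.
have lF : islin F.
  move: F iF {FE} => F iF a c d; apply: iD_inj.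
  by rewrite lin_iD !iF (@lin_of _ V) lin_iX (lin_tmr _).
move=> a c d; apply: (can_inj (@of_tensK _ _)).
apply: etrans (esym (FE _)) _; apply: etrans (lF a c d) _; rewrite !FE.
exact: esym (@lin_of rat VD a _ _).
Qed.

Lemma lin_tlactl (x : tens rat VD) : islin (fun c => @tlact rat X c x).
Proof.
have [F FE] : exists F, forall c, F c = of_tens (tlact c x) by exists (fun c => of_tens (tlact c x)).
have iF c : iD (F c) = tm (iX (of_tens c)) (iD (of_tens x)) by rewrite FE of_tlact.
have lF : islin F.
  move: F iF {FE} => F iF a c d; apply: iD_inj.
  by rewrite lin_iD !iF (@lin_of _ V) lin_iX (lin_tml _).
move=> a c d; apply: (can_inj (@of_tensK _ _)).
apply: etrans (esym (FE _)) _; apply: etrans (lF a c d) _; rewrite !FE.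
exact: esym (@lin_of rat VD a _ _).
Qed.

Lemma linx_dsum (W : lmodType rat) (G : seq V -> seq V -> seq V -> W) (s t : T rat V) :
  linx (fun u => dsum (G u) t) s = dsum (fun w1 w2 => linx (fun u => G u w1 w2) s) t.
Proof.
move: s; apply: tens_eq => [||u]; first exact: lin_linx.
  by apply: lin_dsum_par => w1 w2; exact: lin_linx.
by rewrite linx_mon; apply: eq_dsum => w1 w2; rewrite linx_mon.
Qed.

(** On homogeneous elements the signs are constant, and the sums over words only express
    multilinearity. *)
Lemma dterm_homog (x y : T rat VD) (b1 b2 b3 b4 : bool) (s1 s2 t1 t2 : T rat V) :
  (forall u, cf s1 u != 0 -> wp u = b1) -> (forall u, cf s2 u != 0 -> wp u = b2) ->
  (forall u, cf t1 u != 0 -> wp u = b3) -> (forall u, cf t2 u != 0 -> wp u = b4) ->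
  linx (fun w1 => linx (fun w2 => linx (fun u1 => linx (fun u2 =>
    dterm x y u1 u2 w1 w2) s2) s1) t2) t1 =
  (-1) ^+ (b1 && (b2 (+) (b3 (+) b4))) *:
  tprod (tmul (to_tens s2) (to_tens t1))
    (tract (to_tens (J (b1 (+) b3) x)) (to_tens t2) * tlact (to_tens s1) (to_tens y)).
Proof.
move=> h1 h2 h3 h4; set c := (-1) ^+ _.
pose F s1 s2 t1 t2 : tens2 rat V := c *: tprod (tmul (to_tens s2) (to_tens t1))
    (tract (to_tens (J (b1 (+) b3) x)) (to_tens t2) * tlact (to_tens s1) (to_tens y)).
have l2 s1' t1' t2' : islin (fun s => F s1' s t1' t2').
  apply: lin_scale; apply: (lin_app (lin_tprodl _)); apply: (lin_app (lin_tmull _)).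
  exact: lin_to.
have l3 s1' s2' t2' : islin (fun s => F s1' s2' s t2').
  apply: lin_scale; apply: (lin_app (lin_tprodl _)); apply: (lin_app (lin_tmulr _)).
  exact: lin_to.
have l4 s1' s2' t1' : islin (fun s => F s1' s2' t1' s).
  apply: lin_scale; apply: (lin_app (lin_tprodr _)); apply: (lin_app (lin_malgMl _)).
  by apply: (lin_app (lin_tractr _)); exact: lin_to.
have l1 s2' t1' t2' : islin (fun s => F s s2' t1' t2').
  apply: lin_scale; apply: (lin_app (lin_tprodr _)); apply: (lin_app (lin_malgMr _)).
  by apply: (lin_app (lin_tlactl _)); exact: lin_to.
rewrite -/(F s1 s2 t1 t2).
rewrite -(linx_lin t1 (l3 s1 s2 t2)); apply: eq_linx_supp => w1 /h3 e3.
rewrite -(linx_lin t2 (l4 s1 s2 _)); apply: eq_linx_supp => w2 /h4 e4.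
rewrite -(linx_lin s1 (l1 s2 _ _)); apply: eq_linx_supp => u1 /h1 e1.
rewrite -(linx_lin s2 (l2 _ _ _)); apply: eq_linx_supp => u2 /h2 e2.
by rewrite /F /dterm !to_mon /dsign e1 e2 e3 e4.
Qed.

Lemma homog_wp (b : bool) (s : T rat V) (u : seq V) : J true s = (-1) ^+ b *: s ->
  cf s u != 0 -> wp u = b.
Proof.
move=> Js nz; have := congr1 (fun x => cf x u) Js; rewrite cf_J cfZ => /(mulIf nz) /=.
by case: (wp u); case: b {Js} => //= /eqP; rewrite ?expr0 ?expr1 1?eq_sym eqrNxx oner_eq0.
Qed.

(** Both coproducts are combinations of products of integral homogeneous invariants, so
    that every term is again of the required form. *)
Lemma double_dmul_tprod (s t : T rat V) (x y : tens rat VD) :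
  sinv s -> integral s -> sinv t -> integral t -> S x -> S y ->
  double_of S (dmul (tprod (to_tens s) x) (tprod (to_tens t) y)).
Proof.
move=> ss is_ st it Sx Sy; rewrite -[x]of_tensK -[y]of_tensK dmul_tprod.
have D0 : double_of S 0 by exact: zspan0.
have DB a b : double_of S a -> double_of S b -> double_of S (a - b) by exact: zspanB.
apply: (@dsum_span V (enum V) (enum_uniq _) (mem_enum V) _ _ _ _ D0 DB) => //.
move=> s1 s2 ss1 is1 ss2 is2 [b1 /(_ true) J1] [b2 /(_ true) J2].
have -> : linx (fun u => linx (fun v => dsum (dterm (of_tens x) (of_tens y) u v) t) s2) s1 =
  dsum (fun w1 w2 => linx (fun u => linx (fun v =>
     dterm (of_tens x) (of_tens y) u v w1 w2) s2) s1) t.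
  by rewrite -linx_dsum; apply: eq_linx => u; rewrite linx_dsum.
apply: (@dsum_span V (enum V) (enum_uniq _) (mem_enum V) _ _ _ _ D0 DB) => //.
move=> t1 t2 st1 it1 st2 it2 [b3 /(_ true) J3] [b4 /(_ true) J4].
rewrite (@dterm_homog _ _ b1 b2 b3 b4); last first.
- by move=> u; exact: homog_wp.
- by move=> u; exact: homog_wp.
- by move=> u; exact: homog_wp.
- by move=> u; exact: homog_wp.
apply: (closed_int D0 DB); first exact: rpred_sign.
have -> : tmul (to_tens s2) (to_tens t1) = to_tens (tm s2 t1).
  by apply: (can_inj (@of_tensK _ _)); rewrite of_tmul !to_tensK.
apply: double_tprod; [exact: sinv_tm|exact: integral_tm|].
by apply: (goodM gS); [apply: (good_tract gS)|apply: (good_tlact gS)];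
  rewrite ?to_tensK // ?of_tensK //; exact: (goodJ gS).
Qed.

Lemma double_dmull (F : tens2 rat V -> tens2 rat V) : islin F ->
  (forall (s : tens int V) x, Defs.inv s -> S x -> double_of S (F (tprod (extQ s) x))) ->
  forall z, double_of S z -> double_of S (F z).
Proof.
move=> lF Fg z; elim=> {z} [z [xi [x [ixi Sx ->]]]||z1 z2 _ IH1 _ IH2].
- exact: Fg.
- by rewrite (islin0 lF); exact: zspan0.
- by rewrite (islinB lF); exact: zspanB.
Qed.

Lemma double_dmul (z z' : tens2 rat V) : double_of S z -> double_of S z' ->
  double_of S (dmul z z').
Proof.
move=> dz dz'; apply: (double_dmull (lin_dmull z')) dz => xi x ixi Sx.
apply: (double_dmull (lin_dmulr _)) dz' => eta y ieta Sy.
have := @double_dmul_tprod (ofZ xi) (ofZ eta) x y; rewrite /ofZ !of_tensK; apply=> //.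
- exact/inv_ofZ.
- exact: integral_ofZ.
- exact/inv_ofZ.
- exact: integral_ofZ.
Qed.
End Closure.

(** * The map from the double to the trivial extension *)

Section PhiMap.
Variable X : superalgebra.
Local Notation V := (sspace X).
Local Notation VD := (dualsp V).
Local Notation VT := (sspace (trivext X)).
Implicit Types (z : tens2 rat V) (S : tens rat VD -> Prop).

Definition phiQ z : T rat VT :=
  malg_lin (fun ua => Phi (mon rat (ua.1 : seq V)) (mon rat (ua.2 : seq VD))) z.

Lemma lin_phiQ : islin phiQ. Proof. exact: lin_malg_lin. Qed.

Lemma phiQ_tprod (s : tens rat V) (x : tens rat VD) :
  phiQ (tprod s x) = Phi (of_tens s) (of_tens x).
Proof.
rewrite /phiQ malg_lin_tprod -(linx_lin (of_tens s) (lin_Phil (of_tens x))).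
by apply: eq_linx => u; rewrite -(linx_lin (of_tens x) (lin_Phir (mon rat u))).
Qed.

Definition slice (u : seq V) z : T rat VD :=
  malg_lin (fun ua => (ua.1 == (u : word V))%:R *: mon rat (ua.2 : seq VD)) z.

Lemma lin_slice u : islin (slice u). Proof. exact: lin_malg_lin. Qed.

Lemma slice_tprod u (s : tens rat V) (x : tens rat VD) :
  slice u (tprod s x) = cf (of_tens s) u *: of_tens x.
Proof.
rewrite /slice malg_lin_tprod; have l : islin (fun y => cf y u *: of_tens x).
  by move=> a y1 y2; rewrite cfD cfZ scalerDl scalerA.
rewrite -(linx_lin (of_tens s) l); apply: eq_linx => u'.
rewrite -[in RHS](linx_lin (of_tens x) (@lin_id _ _)).
rewrite cf_mon; case: eqP => _; first by rewrite scale1r; apply: eq_linx => a; rewrite scale1r.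
by rewrite scale0r linxE big1 // => a _; rewrite scale0r scaler0.
Qed.

Lemma contract_slice z (eta : tens rat V) (u : seq V) :
  (contract z eta)@_(u : word V) = pr (slice u z) (of_tens eta).
Proof.
apply: (@lin_eq _ _ rat^o (fun z => (contract z eta)@_(u : word V))
  (fun z => pr (slice u z) (of_tens eta))) => [||[w a]].
- by apply: (lin_app (@lin_coef _ _ _)); exact: lin_lext.
- by apply: (lin_app (lin_prl _)); exact: lin_slice.
rewrite /contract lextU /slice malg_linU /= (islinZ (lin_prl _)) mcoeffZ mcoeffU.
rewrite of_tpair -[of_tens << a >>]/(mon rat (a : seq VD)) mulrC.
by [].
Qed.

Lemma Phi_mon (u : seq V) (a : seq VD) :
  Phi (mon rat u) (mon rat a) = (size u)`!%:R^-1 *: wsym rat (map (@il X) u ++ map (@ir X) a).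
Proof.
rewrite /Phi /iX /iD !lmap_mon /nrm degscale_mon -scalerAl monM symZ.
by rewrite sym_mon size_map.
Qed.

(** The letters of X in the word are stripped off by left derivatives; then only the term
    of degree zero of xi contributes. *)
Lemma cf_Phi (xi : T rat V) y (u : seq V) (a : seq VD) : sinv xi ->
  cf (Phi xi y) (map (@il X) u ++ map (@ir X) a) = cf xi u * cf (sym y) a.
Proof.
elim: u xi => [|k u IH] xi sxi; last first.
  rewrite -[LHS](cf_der (il k) (Phi xi y)) der_Phi // IH; last exact: sinv_der.
  by rewrite cf_der.
rewrite /=; move: xi {sxi}; apply: cf_eq => [||w].
- exact: lin_Phil.
- by move=> c p q; rewrite cfD cfZ mulrDl -mulrA.
rewrite cf_mon; case: w => [|k w].
  rewrite eqxx mul1r /Phi mon0 /iX lmap1 -mon0 /nrm degscale_mon invr1 scale1r mon0 mul1r.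
  by rewrite -(lmap_sym (@spar_ir X)) (cf_lmap_inj (@ir_inj X)).
rewrite mul0r; move: y; apply: (@tens_eq _ _ rat^o) => [||b].
- by apply: (lin_app (lin_cf _)); exact: lin_Phir.
- exact: lin_cst0.
rewrite Phi_mon cfZ; set v := _ ++ _.
have [->|/cf_wsym_perm p] := eqVneq (cf (wsym rat v) (map (@ir X) a)) 0.
  by rewrite mulr0.
have : il k \in map (@ir X) a by rewrite (perm_mem p) mem_head.
by case/mapP.
Qed.

Lemma lin_eq_double S (W : lmodType rat) (F G : tens2 rat V -> W) : islin F -> islin G ->
  (forall (s : tens int V) x, Defs.inv s -> S x -> F (tprod (extQ s) x) = G (tprod (extQ s) x)) ->
  forall z, double_of S z -> F z = G z.
Proof.
move=> lF lG FG z; elim=> {z} [z [xi [x [ixi Sx ->]]]||z1 z2 _ IH1 _ IH2].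
- exact: FG.
- by rewrite (islin0 lF) (islin0 lG).
- by rewrite (islinB lF) (islinB lG) IH1 IH2.
Qed.

Lemma cf_phiQ S z (u : seq V) (a : seq VD) : double_of S z ->
  cf (phiQ z) (map (@il X) u ++ map (@ir X) a) = cf (sym (slice u z)) a.
Proof.
apply: (lin_eq_double (W := rat^o) (F := fun z => cf (phiQ z) _)
  (G := fun z => cf (sym (slice u z)) a)) => [||s x ixi _].
- by apply: (lin_app (lin_cf _)); exact: lin_phiQ.
- apply: (lin_app (lin_cf _)); apply: (lin_app (@lin_sym _ VD)); exact: lin_slice.
rewrite phiQ_tprod slice_tprod symZ cfZ cf_Phi //.
exact/inv_ofZ.
Qed.

Lemma sinv_phiQ z : sinv (phiQ z).
Proof. by rewrite /phiQ; apply: sinv_sum => ua; apply: sinvZ; exact: sinv_Phi. Qed.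

Lemma perm_split (v : seq VT) : exists u a, perm_eq v (map (@il X) u ++ map (@ir X) a).
Proof.
elim: v => [|[i|i] v [u [a p]]]; first by exists [::], [::].
  by exists (i :: u), a; rewrite /= perm_cons.
exists u, (i :: a); rewrite perm_sym perm_catC /= perm_cons perm_catC perm_sym.
exact: p.
Qed.

(** Both sides say that all slices of z and of its counterpart have the same
    symmetrization: on the left since the kernel of sym is the annihilator of the
    invariants, on the right by looking at coefficients. *)
Lemma phiQ_eqP S z z' : double_of S z -> double_of S z' ->
  double_eq z z' <-> phiQ z = phiQ z'.
Proof.
move=> dz dz'; split=> [e|e eta ieta]; last first.
  have es u : sym (slice u z) = sym (slice u z').
    by apply/cfP => a; rewrite -(cf_phiQ _ _ dz) e (cf_phiQ _ _ dz').
  apply/malgP => u; rewrite !contract_slice; apply: pr_sym_eq => //.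
  exact/inv_sinv.
have es u : sym (slice u z) = sym (slice u z').
  apply/eqP; rewrite -subr_eq0 -sym_sub; apply/eqP; apply: pr_perp => y sy.
  have := congr1 (fun t => t@_(u : word V)) (e (to_tens y) _).
  rewrite !contract_slice to_tensK => h; rewrite (islinB (lin_prl _)) h ?subrr //.
  by apply/inv_sinv; rewrite to_tensK.
apply/cfP => v; have [u [a p]] := perm_split v; have [b bP] := cf_perm p.
by rewrite !(bP _ (sinv_phiQ _)) (cf_phiQ _ _ dz) (cf_phiQ _ _ dz') es.
Qed.

Lemma J_Phi (b : bool) x y : J b (Phi x y) = @Phi X (J b x) (J b y).
Proof.
rewrite /Phi -sym_J JM /nrm -degscale_J /iX /iD.
by rewrite (lmap_J (@spar_il X)) (lmap_J (@spar_ir X)).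
Qed.

Lemma iD_tract_tlact (x y : tens rat VD) (c c' : tens rat V) :
  iD (of_tens (tract x c * tlact c' y)) =
  tm (iD (of_tens x)) (iX (of_tens c)) * tm (iX (of_tens c')) (iD (of_tens y)).
Proof.
apply: etrans (congr1 (@iD rat X) (of_tensM _ _)) _; apply: etrans (lmapM _ _ _) _.
exact: (f_equal2 *%R (of_tract _ _) (of_tlact _ _)).
Qed.

Lemma phiQ_dmul_tprod (s t : T rat V) (x y : T rat VD) : sinv s -> sinv t ->
  phiQ (dmul (tprod (to_tens s) (to_tens x)) (tprod (to_tens t) (to_tens y))) =
  tm (Phi s x) (Phi t y).
Proof.
move=> ss st; move: x; apply: tens_eq => [||a].
- apply: (lin_app lin_phiQ); apply: (lin_app (lin_dmull _)); apply: (lin_app (lin_tprodr _)).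
  exact: lin_to.
- by apply: (lin_app (lin_tml _)); exact: lin_Phir.
rewrite dmul_tprod (dsum_app _ _ lin_phiQ) Phi_mul //; apply: eq_dsum => u1 u2.
rewrite (dsum_app _ _ lin_phiQ); apply: eq_dsum => w1 w2.
rewrite /dterm (islinZ lin_phiQ) phiQ_tprod J_mon to_tensZ.
rewrite (islinZ (lin_tract _)) (islinZ (lin_malgMl _)) of_tensZ.
rewrite (islinZ (lin_Phir _)) scalerA -signr_addb of_tmul.
rewrite /Phi iD_tract_tlact !to_tensK -!/(mon rat _).
congr (_ *: _); rewrite /dsign; congr (_ ^+ nat_of_bool _).
by bcases.
Qed.

Lemma phiQ_mul S z z' : double_of S z -> double_of S z' ->
  phiQ (dmul z z') = tm (phiQ z) (phiQ z').
Proof.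
move=> dz dz'.
apply: (lin_eq_double (F := fun z => phiQ (dmul z z')) (G := fun z => tm (phiQ z) (phiQ z')) _ _ _ dz).
- by apply: (lin_app lin_phiQ); exact: lin_dmull.
- by apply: (lin_app (lin_tml _)); exact: lin_phiQ.
move=> xi x ixi _.
apply: (lin_eq_double (F := fun z' => phiQ (dmul _ z')) (G := fun z' => tm _ (phiQ z')) _ _ _ dz').
- by apply: (lin_app lin_phiQ); exact: lin_dmulr.
- by apply: (lin_app (lin_tmr _)); exact: lin_phiQ.
move=> eta y ieta _.
have := @phiQ_dmul_tprod (ofZ xi) (ofZ eta) (of_tens x) (of_tens y).
rewrite /ofZ !of_tensK !phiQ_tprod; apply; exact/inv_ofZ.
Qed.
End PhiMap.

(** * Bijectivity *)

Lemma lmapX (R : comNzRingType) (U W : superspace) (f : U -> W) (x : T R U) n :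
  lmap f (x ^+ n) = lmap f x ^+ n.
Proof. by elim: n => [|n IH]; rewrite ?expr0 ?lmap1 // !exprS lmapM IH. Qed.

Lemma dmon_map (U W : superspace) (f : U -> W) (s : seq U) (n : W -> nat) :
  dmon (map f s) n = lmap f (dmon s (fun i => n (f i))).
Proof.
rewrite /dmon big_map; elim: s => [|i s IH]; first by rewrite !big_nil lmap1.
rewrite !big_cons IH lmapM lmapZ lmapX lmap_let.
by [].
Qed.

Section PhiIso.
Variable X : superalgebra.
Local Notation V := (sspace X).
Local Notation VD := (dualsp V).
Local Notation VT := (sspace (trivext X)).
Local Notation DD := (double_of (@dsym VD)).

Lemma Phi_shf (s : T rat V) (y : T rat VD) : sinv s ->
  Phi s y = shf (iX s) (iD (sym y)).
Proof.
move=> ss; rewrite shf_sinv.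
- by rewrite /Phi /iD (lmap_sym (@spar_ir X)) sym_nrm_mulr.
- exact: (sinv_lmap (@spar_il X)).
- apply: (sinv_lmap (@spar_ir X)); exact: sinv_sym.
Qed.

Lemma integral_phiQ (z : tens2 rat V) : DD z -> integral (phiQ z).
Proof.
elim=> {z} [z [xi [x [ixi dx ->]]]||z1 z2 _ IH1 _ IH2].
- rewrite phiQ_tprod Phi_shf; last exact/inv_ofZ.
  apply: integral_shf; apply: integral_lmap; first exact: integral_ofZ.
  exact: dsym_integral.
- by move=> w; rewrite (islin0 (@lin_phiQ X)) cf0.
- by rewrite (islinB (@lin_phiQ X)); exact: integralB.
Qed.

Definition phi (z : tens2 rat V) : tens int VT := toZ (phiQ z).

Lemma ofZ_phi z : DD z -> ofZ (phi z) = phiQ z.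
Proof. by move/integral_phiQ; exact: ofZK. Qed.

Lemma phi_tprod (xi : tens int V) (x : tens rat VD) : Defs.inv xi -> dsym x ->
  phi (tprod (extQ xi) x) = shuffle (in_X xi) (in_dual (kappaZ x)).
Proof.
move=> ixi dx; apply: ofZ_inj; rewrite ofZ_phi; last first.
  by apply: zspan_gen; exists xi, x; split.
rewrite phiQ_tprod Phi_shf; last exact/inv_ofZ.
rewrite ofZ_shuffle /in_X /in_dual !ofZ_tmap ofZ_kappaZ //.
Qed.

(** The letters of X come first, so that sorted monomials factor into two monomials. *)
Definition eT : seq VT := map (@il X) (enum V) ++ map (@ir X) (enum VD).

Lemma uniq_eT : uniq eT.
Proof.
rewrite /eT cat_uniq (map_inj_uniq (@il_inj X)) (map_inj_uniq (@ir_inj X)) !enum_uniq andbT /=.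
by apply/hasPn => _ /mapP [i _ ->]; apply/mapP => -[j _].
Qed.

Lemma mem_eT i : i \in eT.
Proof.
rewrite mem_cat; case: i => i; first by rewrite (map_f (@il X)) ?mem_enum.
by rewrite (map_f (@ir X)) ?orbT // mem_enum.
Qed.

Lemma dmon_eT (m : VT -> nat) : dmon eT m =
  iX (dmon (enum V) (fun i => m (il i))) * iD (dmon (enum VD) (fun i => m (ir i))).
Proof.
by rewrite /eT {1}/dmon big_cat -!/(dmon _ _) !dmon_map.
Qed.

Lemma adm_il (w : seq VT) : adm w -> forall i : V, spar i -> (count_mem (il i) w <= 1)%N.
Proof. by move=> /forallP aw i; exact: (implyP (aw (il i))). Qed.
Lemma adm_ir (w : seq VT) : adm w -> forall i : VD, spar i -> (count_mem (ir i) w <= 1)%N.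
Proof. by move=> /forallP aw i; exact: (implyP (aw (ir i))). Qed.

Lemma phiQ_surj y : sinv y -> integral y -> exists2 z, DD z & phiQ z = y.
Proof.
move: y; apply: (@sinv_span VT eT uniq_eT mem_eT (fun y => exists2 z, DD z & phiQ z = y)).
- by exists 0; [exact: zspan0|exact: (islin0 (@lin_phiQ X))].
- move=> y y' [z dz <-] [z' dz' <-]; exists (z - z'); first exact: zspanB.
  exact: (islinB (@lin_phiQ X)).
move=> w aw _; pose m i := count_mem (i : VT) w.
pose d1 := dmon (enum V) (fun i => m (il i)); pose d2 := dmon (enum VD) (fun i => m (ir i)).
have D2 : dsym (to_tens d2) by apply: dsym_dmon; exact: adm_ir.
exists (tprod (to_tens (sym d1)) (to_tens d2)).
  apply: double_tprod => //; first exact: sinv_sym.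
  rewrite -[d1]to_tensK; apply: dsym_integral; apply: dsym_dmon; exact: adm_il.
rewrite phiQ_tprod !to_tensK /Phi /iX (lmap_sym (@spar_il X)) sym_nrm_mull.
by rewrite /orb dmon_eT.
Qed.

Lemma phiE z (t : tens int VT) : DD z -> phiQ z = ofZ t -> phi z = t.
Proof. by move=> dz e; apply: ofZ_inj; rewrite ofZ_phi. Qed.

Lemma phi_iso : superring_iso (A := dturner_double X) (B := inv_ring (trivext X)) phi.
Proof.
split=> /=.
- by move=> z dz; apply/inv_ofZ; rewrite ofZ_phi //; exact: sinv_phiQ.
- move=> z z' dz dz'; apply: phiE; first exact: zspanB.
  by rewrite ofZB !ofZ_phi //; exact: (islinB (@lin_phiQ X)).
- move=> z z' dz dz'; split=> [/(phiQ_eqP dz dz') e|e].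
    by apply: phiE => //; rewrite ofZ_phi.
  apply/(phiQ_eqP dz dz'); have e' : phi z = phi z' by exact: e.
  by rewrite -(ofZ_phi dz) -(ofZ_phi dz') e'.
- move=> y iy; have sy : sinv (@ofZ VT y) by exact/inv_ofZ.
  have [z dz e] := phiQ_surj sy (@integral_ofZ VT y).
  by exists z => //; apply: phiE.
- by move=> z z'; exact: (double_dmul (good_dsym X)).
- move=> z z' dz dz'; apply: phiE; first exact: (double_dmul (good_dsym X)).
  by rewrite ofZ_tmul !ofZ_phi //; exact: phiQ_mul dz dz'.
- move=> p z dz hz; apply/thom_ofZ; rewrite ofZ_phi //.
  rewrite /phiQ /malg_lin J_sum scaler_sumr big_seq [RHS]big_seq.
  apply: eq_bigr => ua /hz; rewrite oddD -!/(wp _) => <-.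
  rewrite JZ J_Phi !J_mon /= (islinZ (lin_Phir _)).
  rewrite (islinZ (lin_Phil _)) !scalerA signr_addb; congr (_ *: _).
  by rewrite mulrC; congr (_ * _); exact: mulrC.
Qed.
End PhiIso.

(** * A derivation given by an invariant *)

Section Degree.
Variables (V : superspace).
Implicit Types (x y : T rat V).

(** Homogeneous of degree n, tested on powers of 2 because rescaling by powers is
    multiplicative. *)
Definition hdeg n x := degscale (fun k => 2%:R ^+ k) x = 2%:R ^+ n *: x.

Lemma hdeg_size n x w : hdeg n x -> cf x w != 0 -> size w = n.
Proof.
move=> hx nz; have := congr1 (fun y => cf y w) hx; rewrite cf_degscale cfZ => /(mulIf nz).
by rewrite -!natrX => /eqP; rewrite eqr_nat eqn_exp2l // => /eqP.
Qed.

Lemma degscale_expM (c : rat) x y : degscale (fun k => c ^+ k) (x * y) =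
  degscale (fun k => c ^+ k) x * degscale (fun k => c ^+ k) y.
Proof.
move: x; apply: tens_eq => [||u].
- by apply: (lin_app (lin_degscale _)); lin.
- by apply: lin_mull; exact: lin_degscale.
move: y; apply: tens_eq => [||v].
- by apply: (lin_app (lin_degscale _)); lin.
- by apply: lin_mulr; exact: lin_degscale.
by rewrite monM !degscale_mon size_cat exprD -scalerAl -scalerAr scalerA monM.
Qed.

Lemma hdegM n n' x y : hdeg n x -> hdeg n' y -> hdeg (n + n') (x * y).
Proof.
rewrite /hdeg => hx hy; rewrite degscale_expM hx hy -scalerAl -scalerAr scalerA.
by rewrite exprD.
Qed.

Lemma hdegZ n a x : hdeg n x -> hdeg n (a *: x).
Proof. by rewrite /hdeg => hx; rewrite (islinZ (lin_degscale _)) hx !scalerA mulrC. Qed.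

Lemma hdeg_mon w : hdeg (size w) (mon rat w).
Proof. by rewrite /hdeg degscale_mon. Qed.

Lemma hdeg1 : hdeg 0 1. Proof. by rewrite -mon0; exact: hdeg_mon. Qed.

Lemma hdegX n x k : hdeg n x -> hdeg (n * k) (x ^+ k).
Proof.
move=> hx; elim: k => [|k IH]; first by rewrite muln0 expr0; exact: hdeg1.
by rewrite mulnS exprS; exact: hdegM.
Qed.

Lemma hdeg_tvec (v : {ffun V -> int}) : hdeg 1 (ofZ (tvec v)).
Proof.
rewrite /hdeg ofZ_tvec (islin_sum (lin_degscale _)) scaler_sumr; apply: eq_bigr => i _.
by rewrite (islinZ (lin_degscale _)) degscale_mon !scalerA mulrC.
Qed.
End Degree.

Section LetterMultiplication.
Variables (A : superalgebra).
Local Notation V := (sspace A).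
Implicit Types (i j k : V) (u w : seq V) (x y : T rat V) (m : V -> nat).

Definition unitv : T rat V := ofZ (tvec (scoord (1 : A))).

Lemma J_one (b : bool) : J b unitv = unitv.
Proof.
rewrite /unitv ofZ_tvec J_sum; apply: eq_bigr => k _.
rewrite JZ J_let.
have [->|/spar1/negPf ->] := eqVneq (scoord (1 : A) k) 0; first by rewrite !scale0r.
by rewrite andbF scale1r.
Qed.

Lemma scoord_lin (I : finType) (F : I -> A) (c : I -> int) k :
  scoord (\sum_i F i *~ c i) k = \sum_i c i * scoord (F i) k.
Proof.
elim/big_rec2: _ => [|i n x _ <-]; first by rewrite scoord0 ffunE.
by rewrite scoordD ffunE scoordMz ffunMzE mulrzz; congr (_ + _); exact: mulrC.
Qed.

Lemma lmul_one i : \sum_k (scoord (1 : A) k)%:~R *: lmul rat i k = let1 rat i.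
Proof.
under eq_bigr => k _ do rewrite lmulE scaler_sumr.
rewrite sum_exchange.
transitivity (\sum_l (scoord (sbasis i : A) l)%:~R *: let1 rat l).
  apply: eq_bigr => l _; under eq_bigr => k _ do rewrite scalerA.
  rewrite -scaler_suml; congr (_ *: _).
  have e : sbasis i = \sum_k (sbasis i * sbasis k) *~ scoord (1 : A) k.
    rewrite -[LHS]mulr1 {1}(scoord_sum (1 : A)) mulr_sumr.
    by apply: eq_bigr => k _; rewrite mulrzAr.
  rewrite [X in _ = (scoord X l)%:~R]e.
  by rewrite scoord_lin rmorph_sum; apply: eq_bigr => k _; rewrite rmorphM.
rewrite scoord_basis (bigD1 i) //= ffunE eqxx scale1r big1 ?addr0 // => l /negPf ne.
by rewrite ffunE eq_sym ne scale0r.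
Qed.

Lemma one_lmul j : \sum_k (scoord (1 : A) k)%:~R *: lmul rat k j = let1 rat j.
Proof.
under eq_bigr => k _ do rewrite lmulE scaler_sumr.
rewrite sum_exchange.
transitivity (\sum_l (scoord (sbasis j : A) l)%:~R *: let1 rat l).
  apply: eq_bigr => l _; under eq_bigr => k _ do rewrite scalerA.
  rewrite -scaler_suml; congr (_ *: _).
  have e : sbasis j = \sum_k (sbasis k * sbasis j) *~ scoord (1 : A) k.
    rewrite -[LHS]mul1r {1}(scoord_sum (1 : A)) mulr_suml.
    by apply: eq_bigr => k _; rewrite mulrzAl.
  rewrite [X in _ = (scoord X l)%:~R]e.
  by rewrite scoord_lin rmorph_sum; apply: eq_bigr => k _; rewrite rmorphM.
rewrite scoord_basis (bigD1 j) //= ffunE eqxx scale1r big1 ?addr0 // => l /negPf ne.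
by rewrite ffunE eq_sym ne scale0r.
Qed.

Lemma tm_one i x y : tm (let1 rat i * x) (unitv * y) = let1 rat i * tm x y.
Proof.
rewrite -[in RHS](lmul_one i) /unitv ofZ_tvec !mulr_suml tm_sumr.
apply: eq_bigr => k _; rewrite -!scalerAl tmZr tm_let.
have [->|/spar1/negPf ->] := eqVneq (scoord (1 : A) k) 0; first by rewrite !scale0r.
by rewrite J0.
Qed.

Lemma tm_oneX w : tm (mon rat w) (unitv ^+ size w) = mon rat w.
Proof.
elim: w => [|i w IH]; first by rewrite mon0 expr0 tm1l -mon0 cf_mon eqxx scale1r.
by rewrite mon_cons exprS tm_one IH.
Qed.

(** The derivation of the tensor algebra multiplying one factor by the letter j from the
    right. *)
Fixpoint wD j w : T rat V :=
  if w is i :: w' then lmul rat i j * J (spar j) (mon rat w') + let1 rat i * wD j w'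
  else 0.
Definition D j : T rat V -> T rat V := linx (wD j).

Lemma lin_D j : islin (D j). Proof. exact: lin_linx. Qed.

Lemma D_let j i x : D j (let1 rat i * x) = lmul rat i j * J (spar j) x + let1 rat i * D j x.
Proof.
move: x; apply: tens_eq => [||w].
- by apply: (lin_app (lin_D j)); lin.
- by apply: lin_add; apply: lin_mulr; [exact: lin_J|exact: lin_D].
by rewrite -mon_cons /D !linx_mon.
Qed.

Lemma D1 j : D j 1 = 0. Proof. by rewrite -mon0 /D linx_mon. Qed.

Lemma DM j x y : D j (x * y) = D j x * J (spar j) y + x * D j y.
Proof.
move: x; apply: tens_eq => [||u].
- by apply: (lin_app (lin_D j)); lin.
- by apply: lin_add; apply: lin_mull; [exact: lin_D|exact: lin_id].
elim: u => [|i u IH]; first by rewrite mon0 !mul1r D1 mul0r add0r.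
by rewrite mon_cons -!mulrA !D_let IH JM mulrDr mulrDl !mulrA addrA.
Qed.

Lemma D_let1 j i : D j (let1 rat i) = lmul rat i j.
Proof. by rewrite -[let1 _ _]mulr1 D_let D1 mulr0 addr0 J1 mulr1. Qed.

Lemma D_one j : D j unitv = let1 rat j.
Proof.
rewrite -[RHS]one_lmul /unitv ofZ_tvec (islin_sum (lin_D j)); apply: eq_bigr => k _.
by rewrite (islinZ (lin_D j)) D_let1.
Qed.

(** The shuffle of j with a power of 1, written as an insertion; its degree is n, and there
    is no such element in degree 0. *)
Definition gone j n : T rat V := if n is n'.+1 then ins j (unitv ^+ n') else 0.

Lemma ins_one j x : ins j (unitv * x) = let1 rat j * (unitv * x) + unitv * ins j x.
Proof.
rewrite /unitv ofZ_tvec !mulr_suml ins_sum mulr_sumr -big_split.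
apply: eq_bigr => k _; rewrite -!scalerAl insZ ins_let scalerDr.
rewrite -scalerAr /=; congr (_ + _).
have [->|/spar1/negPf ->] := eqVneq (scoord (1 : A) k) 0; first by rewrite !scale0r.
by rewrite andbF scale1r.
Qed.

Lemma goneS j n : gone j n.+1 = let1 rat j * unitv ^+ n + unitv * gone j n.
Proof.
case: n => [|n] /=; first by rewrite expr0 ins1 mulr1 mulr0 addr0.
by rewrite exprS ins_one.
Qed.

Lemma sinv_gone j n : sinv (gone j n).
Proof.
case: n => [|n]; first exact: sinv0.
apply: sinv_ins; rewrite /unitv; apply: sinv_tvecX => k; exact: spar1.
Qed.

(** Multiplying by an invariant with one factor j and all other factors 1 changes one
    factor at a time. *)
Lemma tm_gone j n x : hdeg n x -> tm x (gone j n) = D j x.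
Proof.
move=> hx; rewrite -(linx_lin x (lin_tml (gone j n))) -(linx_lin x (lin_D j)).
apply: eq_linx_supp => w /(hdeg_size hx) <-{n hx}.
elim: w => [|i w IH]; first by rewrite mon0 D1 tm0r.
rewrite goneS mon_cons tmDr tm_let tm_one IH D_let; congr (_ * _ + _).
by rewrite J_mon tmZl tm_oneX.
Qed.

Lemma sym_D j n x : hdeg n x -> sym (D j x) = tm (sym x) (gone j n).
Proof. by move=> hx; rewrite -(tm_gone j hx) sym_tml //; exact: sinv_gone. Qed.

End LetterMultiplication.

(** * Elimination of letters *)

Section DividedPower.
Variable V : superspace.
Implicit Type x : T rat V.

Definition dp x (n : nat) : T rat V := n`!%:R^-1 *: x ^+ n.

Lemma J_dp x n (b : bool) : J b x = x -> J b (dp x n) = dp x n.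
Proof.
move=> jx; rewrite /dp JZ; congr (_ *: _).
by elim: n => [|n IH]; rewrite ?expr0 ?J1 // !exprS JM jx IH.
Qed.

End DividedPower.

Section EvenPowers.
Variable A : superalgebra.
Local Notation V := (sspace A).
Implicit Types (i j k : V) (u w : seq V) (x y : T rat V) (m : V -> nat) (s : seq V).

Lemma sym_evenC x y : J true y = y -> sym (x * y) = sym (y * x).
Proof.
by move=> jy; rewrite [RHS](@sym_mulC_homog _ false) ?J0 // expr0 scale1r.
Qed.

(** Up to symmetrization, even vectors commute with everything, so the usual rule for
    the derivative of a divided power holds. *)
Lemma D_dp j x n : (forall b : bool, J b x = x) ->
  sym (D j (dp x n.+1)) = sym (dp x n * D j x).
Proof.
move=> jx; have jX b (k : nat) : J b (x ^+ k) = x ^+ k.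
  by elim: k => [|k IH]; rewrite ?expr0 ?J1 // !exprS JM jx IH.
have e (k : nat) : sym (D j (x ^+ k.+1)) = sym (k.+1%:R *: (x ^+ k * D j x)).
  elim: k => [|k IH]; first by rewrite expr1 expr0 mul1r scale1r.
  rewrite exprS DM symD jX (sym_evenC _ (jX true k.+1)).
  rewrite (sym_eqr x IH) -symD -scalerAr mulrA -exprS.
  by rewrite -[k.+2%:R]natr1 scalerDl scale1r addrC.
rewrite /dp (islinZ (lin_D j)) symZ e -symZ.
rewrite scalerA -scalerAl factS natrM invfM mulrAC mulVf ?mul1r //.
by rewrite pnatr_eq0.
Qed.

Definition dec m i : V -> nat := fun k => if k == i then (m k).-1 else m k.

Lemma eq_dmon s m m' : {in s, m =1 m'} -> dmon s m = dmon s m'.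
Proof. by move=> e; apply: eq_big_seq => i /e ->. Qed.

Lemma dmon_cons i s m : dmon (i :: s) m = dp (let1 rat i) (m i) * dmon s m.
Proof. by rewrite /dmon big_cons. Qed.

Lemma J_let_even i (b : bool) : ~~ spar i -> J b (let1 rat i) = let1 rat i.
Proof. by move=> /negPf ei; rewrite J_let ei andbF scale1r. Qed.

Lemma J_dmon s m (b : bool) : all (fun i => ~~ spar i) s -> J b (dmon s m) = dmon s m.
Proof.
elim: s => [|i s IH] /=; first by rewrite /dmon big_nil J1.
by case/andP => ei es; rewrite !dmon_cons JM IH // J_dp // J_let_even.
Qed.

(** The Leibniz rule; up to symmetrization, the new factors may be collected at the
    end. *)
Lemma D_dmon j s m : uniq s -> all (fun i => ~~ spar i) s ->
  sym (D j (dmon s m)) =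
  sym (\sum_(i <- s | (0 < m i)%N) dmon s (dec m i) * lmul rat i j).
Proof.
elim: s => [|i s IH] /=; first by rewrite /dmon !big_nil D1.
case/andP => nis us /andP [ei es].
have se x y z : sym x = sym y -> sym (z * x) = sym (z * y) by exact: sym_eqr.
rewrite dmon_cons DM symD (se _ _ _ (IH us es)) {IH}.
rewrite J_dmon // big_cons mulr_sumr.
have -> : \sum_(k <- s | (0 < m k)%N) dp (let1 rat i) (m i) * (dmon s (dec m k) * lmul rat k j) =
  \sum_(k <- s | (0 < m k)%N) dmon (i :: s) (dec m k) * lmul rat k j.
  rewrite big_seq_cond [RHS]big_seq_cond; apply: eq_bigr => k /andP [ks _].
  rewrite dmon_cons {2}/dec; have [ik|_] := eqVneq i k; first by rewrite ik ks in nis.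
  by rewrite mulrA.
case: (posnP (m i)) => [m0|mp].
  by rewrite m0 /dp expr0 (islinZ (lin_D j)) D1 scaler0 mul0r sym0 add0r.
rewrite symD; congr (_ + _).
have -> : dp (let1 rat i) (m i) = dp (let1 rat i) (m i).-1.+1 by rewrite prednK.
rewrite (sym_eql (dmon s m) (D_dp j (m i).-1 (fun b => J_let_even b ei))) D_let1.
rewrite -mulrA (se _ _ _ (sym_evenC _ (J_dmon m true es))) mulrA.
rewrite dmon_cons {1}/dec eqxx; congr (sym (_ * _ * _)).
apply: eq_dmon => k ks; rewrite /dec; have [ki|//] := eqVneq k i.
by rewrite -ki ks in nis.
Qed.
End EvenPowers.

Section Generation.
Variable A : superalgebra.
Local Notation V := (sspace A).
Implicit Types (i j k : V) (u w : seq V) (x y : T rat V) (m : V -> nat).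
Variables (s : seq V) (P : T rat V -> Prop).
Hypothesis uniq_s : uniq s.
Hypothesis even_s : all (fun i => ~~ spar i) s.
Hypothesis P0 : P 0.
Hypothesis PB : forall x y, P x -> P y -> P (x - y).
Hypothesis Pgone : forall x j n, P x -> P (tm x (gone j n)).
Hypothesis Pbase : forall m l, P (sym (dmon s m * dp (unitv A) l)).

Let elt m l w : T rat V := dmon s m * dp (unitv A) l * mon rat w.

Lemma hdeg_dp n x l : hdeg n x -> hdeg (n * l) (dp x l).
Proof. by move=> hx; apply: hdegZ; exact: hdegX. Qed.

Lemma hdeg_elt m l w : exists n, hdeg n (elt m l w).
Proof.
have [n1 h1] : exists n, hdeg n (dmon s m).
  rewrite /dmon; elim: s => [|i r [n IH]]; first by exists 0; rewrite big_nil; exact: hdeg1.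
  exists (1 * m i + n)%N; rewrite big_cons; apply: hdegM => //.
  by apply: (hdeg_dp (m i)); exact: (hdeg_mon [:: i]).
exists (n1 + 1 * l + size w)%N; apply: hdegM; last exact: hdeg_mon.
by apply: hdegM => //; apply: hdeg_dp; exact: hdeg_tvec.
Qed.

Lemma P_lmul y i j x : (forall k, P (sym (y * (let1 rat k * x)))) ->
  P (sym (y * (lmul rat i j * x))).
Proof.
move=> Pk; rewrite lmulM mulr_sumr sym_sum.
apply: (closed_sum P0 PB) => k _; rewrite -scalerAr symZ.
by apply: (closed_int P0 PB) => //; exact: intr_int.
Qed.

Lemma P_J y (b : bool) w : P (sym (y * mon rat w)) -> P (sym (y * J b (mon rat w))).
Proof.
move=> Py; rewrite J_mon -scalerAr symZ.
by apply: (closed_int P0 PB) => //; exact: rpred_sign.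
Qed.

Lemma P_Dmon y j w : (forall w', size w' = size w -> P (sym (y * mon rat w'))) ->
  P (sym (y * D j (mon rat w))).
Proof.
elim: w y => [|i w IH] y Py; first by rewrite mon0 D1 mulr0 sym0.
rewrite mon_cons D_let mulrDr symD; apply: (closedD P0 PB).
  apply: P_lmul => k; rewrite mulrA; apply: P_J; rewrite -[_ * let1 rat k * _]mulrA -mon_cons.
  exact: Py.
by rewrite mulrA; apply: IH => w' sw; rewrite -mulrA -mon_cons; apply: Py; rewrite /= sw.
Qed.

(** The derivation may hit the divided power of 1, a divided power of an even letter, or
    the word. *)
Lemma sym_D_elt j m l w : sym (D j (elt m l.+1 w)) =
  sym (dmon s m * dp (unitv A) l * let1 rat j * J (spar j) (mon rat w)) +
  \sum_(i <- s | (0 < m i)%N)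
    sym (dmon s (dec m i) * dp (unitv A) l.+1 * (lmul rat i j * J (spar j) (mon rat w))) +
  sym (dmon s m * dp (unitv A) l.+1 * D j (mon rat w)).
Proof.
have se x y z : sym x = sym y -> sym (z * x) = sym (z * y) by exact: sym_eqr.
have jO b n : J b (dp (unitv A) n) = dp (unitv A) n by apply: J_dp; exact: J_one.
rewrite /elt !DM !symD; congr (_ + _).
rewrite mulrDl symD jO addrC; congr (_ + _).
  apply: sym_eql; rewrite (se _ _ _ (D_dp j l (fun b => J_one A b))) D_one.
  by rewrite mulrA.
rewrite -(mulrA (D j _)) (sym_eql _ (D_dmon j m uniq_s even_s)) mulr_suml.
rewrite sym_sum; apply: eq_bigr => i _.
rewrite -!mulrA; apply: (se); rewrite !mulrA; apply: sym_eql.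
by apply: sym_evenC; exact: jO.
Qed.

(** Induction on the length of w, and then on the total exponent of m: the derivation by
    a letter of w creates that letter, and its error terms precede in this order. *)
Lemma generation m l w : P (sym (elt m l w)).
Proof.
have [n] := ubnP (size w); elim: n => // n IHn in m l w *.
have [d] := ubnP (\sum_(i <- s) m i); elim: d => // d IHd in m l w *.
case: w => [|j w]; first by rewrite /elt mon0 mulr1 => _ _; exact: Pbase.
rewrite !ltnS /= => md wn.
have Pw m' l' w' : size w' = size w -> P (sym (elt m' l' w')).
  by move=> sw; apply: IHn; rewrite sw.
(* The letter j is produced from a word without it and one more factor 1. *)
have [n0 h0] := hdeg_elt m l.+1 w.
have := Pgone j n0 (Pw m l.+1 w erefl); rewrite -(sym_D j h0) sym_D_elt => PD.
suff P1 : P (sym (dmon s m * dp (unitv A) l * let1 rat j * J (spar j) (mon rat w))).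
  move: P1; rewrite J_mon -scalerAr symZ.
  rewrite -[_ * let1 rat j * _]mulrA -mon_cons => P1.
  have := closed_int P0 PB (rpred_sign _ (spar j && wp w)) P1.
  by rewrite scalerA -signr_addb addbb scale1r.
have P3 : P (sym (dmon s m * dp (unitv A) l.+1 * D j (mon rat w))).
  by apply: P_Dmon => w' sw; exact: Pw.
have P2 : P (\sum_(i <- s | (0 < m i)%N)
    sym (dmon s (dec m i) * dp (unitv A) l.+1 * (lmul rat i j * J (spar j) (mon rat w)))).
  rewrite big_seq_cond; apply: (closed_sum P0 PB) => i /andP [is_ mi].
  apply: P_lmul => k; rewrite mulrA; apply: P_J; rewrite -[_ * let1 rat k * _]mulrA -mon_cons.
  apply: IHd; last by rewrite ltnS.
  apply: leq_trans md; rewrite (bigD1_seq i) //= [X in (_ <= X)%N](bigD1_seq i) //=.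
  rewrite {1}/dec eqxx -[in X in (_ <= X)%N](prednK mi) addSn ltnS leq_add2l.
  by apply: leq_sum => k' /negPf ne; rewrite /dec ne.
by have := PB (PB PD P3) P2; rewrite addrK addrK.
Qed.
End Generation.

(** * The image is generated *)

Section Generators.
Variable X : superalgebra.
Local Notation V := (sspace X).
Local Notation VD := (dualsp V).
Local Notation VT := (sspace (trivext X)).
Local Notation U := (evensp V).
Local Notation DX := (double_of (@inv_dual X)).

Definition generated (y : T rat VT) : Prop :=
  exists2 t : tens int VT, zalg (@tmul int (trivext X)) (@double_gen X) t & ofZ t = y.

Lemma generated0 : generated 0.
Proof. by exists 0; [exact: zalg0|exact: ofZ0]. Qed.

Lemma generatedB x y : generated x -> generated y -> generated (x - y).
Proof.
by move=> [s gs <-] [t gt <-]; exists (s - t); [exact: zalgB|exact: ofZB].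
Qed.

Lemma generated_tm x y : generated x -> generated y -> generated (tm x y).
Proof.
by move=> [s gs <-] [t gt <-]; exists (tmul s t); [exact: zalgM|exact: ofZ_tmul].
Qed.

Lemma dpE (W : superspace) (v : {ffun W -> int}) n : of_tens (divpow v n) = dp (ofZ (tvec v)) n.
Proof. exact: of_divpow. Qed.

Lemma unitv_even (A : superalgebra) : even_vec (scoord (1 : A)).
Proof. by move=> k; exact: spar1. Qed.

Lemma generated_gone j n : generated (@gone (trivext X) j n).
Proof.
case: n => [|n]; first exact: generated0.
exists (shuffle (tvec (scoord (sbasis j : trivext X)))
          (tvec (scoord (trivext_in (1 : X))) ^+ n)).
  exact: zalg_gen (gen_shuffle _ _).
rewrite ofZ_shuffle ofZX -[trivext_in 1]/(1 : trivext X) -/(unitv (trivext X)).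
rewrite scoord_basis -/(delta int j) ofZ_delta.
have -> : unitv (trivext X) ^+ n = sym (dp (unitv (trivext X)) n).
  by rewrite -dpE sym_divpow //; exact: unitv_even.
have -> : let1 rat j = sym (let1 rat j) by rewrite -[let1 rat j]mulr1 sym_let sym1 ins1 mulr1.
rewrite shf_sym sym_let /=; congr ins.
by rewrite -dpE sym_divpow //; exact: unitv_even.
Qed.

Definition fU (i : U) : VT := il (val i : V).
Definition sU : seq VT := map fU (enum U).

Lemma spar_fU i : spar (fU i) = spar i.
Proof. exact: negbTE (valP i). Qed.

Lemma ofZ_tvec_trivext (t : trivext X) :
  ofZ (tvec (scoord t)) = iX (ofZ (tvec (scoord t.1))) + iD (ofZ (@tvec int VD t.2)).
Proof.
rewrite !ofZ_tvec /iX /iD lmap_sum lmap_sum.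
rewrite big_sumType /=; congr (_ + _); apply: eq_bigr => i _.
  by rewrite ffunE lmapZ lmap_let.
by rewrite ffunE lmapZ lmap_let.
Qed.

Lemma unitv_trivext : unitv (trivext X) = iX (unitv X).
Proof.
rewrite /unitv ofZ_tvec_trivext /= [X in _ + X](_ : _ = 0) ?addr0 //.
rewrite ofZ_tvec big1 ?(islin0 (@lin_iD X)) // => i _.
by rewrite ffunE scale0r.
Qed.

Definition unitU : {ffun U -> int} := [ffun i => scoord (1 : X) (val i)].

(** The unit is even, so it is a combination of even letters. *)
Lemma unitv_U : unitv (trivext X) = lmap fU (ofZ (tvec unitU)).
Proof.
rewrite unitv_trivext /unitv /iX !ofZ_tvec lmap_sum.
rewrite lmap_sum.
under eq_bigr => i _ do rewrite lmapZ lmap_let.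
under [RHS]eq_bigr => i _ do rewrite lmapZ lmap_let ffunE.
rewrite (bigID (fun i : V => ~~ spar i)) /= [X in _ + X]big1 ?addr0; last first.
  move=> i; rewrite negbK => oi.
  have [->|/spar1] := eqVneq (scoord (1 : X) i) 0; first by rewrite scale0r.
  by rewrite oi.
rewrite (reindex_omap (fun i : U => val i) insub) /=; last first.
  by move=> i ei; rewrite insubT.
apply: eq_bigl => i; rewrite valK eqxx andbT; exact: valP i.
Qed.

(** Without odd letters and dual letters, one has the invariants of the even part. *)
Lemma generated_base m l : generated (sym (dmon sU m * dp (unitv (trivext X)) l)).
Proof.
pose z := dmon (enum U) (fun i => m (fU i)) * dp (ofZ (tvec unitU)) l.
have -> : dmon sU m * dp (unitv (trivext X)) l = lmap fU z.
  rewrite /z lmapM /sU dmon_map; congr (_ * _).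
  by rewrite /dp lmapZ lmapX unitv_U.
have iz : integral (sym z).
  rewrite -[z]to_tensK; apply: dsym_integral; rewrite to_tensM; apply: zalgM.
    by apply: dsym_dmon.
  rewrite -dpE of_tensK; apply: zalg_gen; apply: dsym_even => i.
  by [].
rewrite -(lmap_sym spar_fU) -(ofZK iz) -ofZ_tmap.
eexists; last by [].
apply: zalg_gen; apply: gen_even; apply/inv_ofZ; rewrite ofZK //; exact: sinv_sym.
Qed.

(** Even letters come first, the odd ones form a word without divided powers. *)
Definition eV : seq V := map val (enum U) ++ filter (fun i => spar i) (enum V).

Lemma uniq_eV : uniq eV.
Proof.
rewrite cat_uniq (map_inj_uniq val_inj) enum_uniq filter_uniq ?enum_uniq // andbT /=.
apply/hasPn => i; rewrite mem_filter => /andP [oi _]; apply/mapP => -[k _ ik].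
by move: oi; rewrite ik; apply/negP; exact: valP k.
Qed.

Lemma mem_eV i : i \in eV.
Proof.
rewrite mem_cat mem_filter mem_enum andbT; have [oi|ei] := boolP (spar i).
  by rewrite orbT.
apply/orP; left; apply/mapP; exists (Sub i ei); rewrite ?mem_enum //.
Qed.

Lemma generated_Phi_orb w (a : seq VD) : adm w ->
  generated (Phi (orb eV w) (mon rat a)).
Proof.
move=> /forallP aw; set m := fun i => count_mem i w.
have om i : spar i -> (m i <= 1)%N by exact/implyP.
pose M (i : VT) := if i is inl j then m j else 0%N.
have -> : Phi (orb eV w) (mon rat a) = sym (dmon sU M * dp (unitv (trivext X)) 0 *
    mon rat (map (@il X) (sword (filter (fun i => spar i) (enum V)) m) ++ map (@ir X) a)).
  rewrite /Phi /iX (lmap_sym (@spar_il X)) sym_nrm_mull /dp expr0 invr1 scale1r mulr1.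
  rewrite -monM -!lmap_mon mulrA; congr (sym (_ * _)).
  rewrite /eV {1}/dmon big_cat -!/(dmon _ _) lmapM; congr (_ * _).
    apply: etrans (esym (@dmon_map _ _ (@il X) _ M)) _; congr dmon.
    by rewrite /sU -map_comp.
  congr lmap; rewrite dmonE big1_seq ?invr1 ?scale1r // => i /andP [_].
  by rewrite mem_filter => /andP [/om]; rewrite /m; case: (count_mem i w) => [|[|]].
apply: (@generation (trivext X) sU generated).
- rewrite map_inj_uniq ?enum_uniq // => i k /(@il_inj X); exact: val_inj.
- by apply/allP => _ /mapP [i _ ->]; rewrite spar_fU.
- exact: generated0.
- exact: generatedB.
- by move=> x j n gx; apply: generated_tm => //; exact: generated_gone.
- exact: generated_base.
Qed.

(** The class of an element of the integral dual has an integral representative, which is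
    a combination of words. *)
Lemma generated_phiQ z : DX z -> generated (phiQ z).
Proof.
elim=> {z} [z [xi [x [ixi /inv_dualP [y iy xy] ->]]]||z1 z2 _ IH1 _ IH2].
- rewrite phiQ_tprod.
  have -> : Phi (of_tens (extQ xi)) (of_tens x) = Phi (ofZ xi) y.
    rewrite /Phi; apply: sym_eqr.
    by rewrite /iD -!(lmap_sym (@spar_ir X)) xy.
  rewrite -(linx_lin y (@lin_Phir X _)) linxE; apply: (closed_sum generated0 generatedB) => a _.
  apply: (closed_int generated0 generatedB) => //.
  have sxi : sinv (ofZ xi) by exact/inv_ofZ.
  move: (ofZ xi) sxi (integral_ofZ xi).
  apply: (@sinv_span V eV uniq_eV mem_eV (fun s => generated (Phi s (mon rat a)))).
  + by rewrite (islin0 (lin_Phil _)); exact: generated0.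
  + by move=> s t gs gt; rewrite (islinB (lin_Phil _)); exact: generatedB.
  by move=> w aw _; exact: generated_Phi_orb.
- by rewrite (islin0 (@lin_phiQ X)); exact: generated0.
- by rewrite (islinB (@lin_phiQ X)); exact: generatedB.
Qed.

Lemma double_of_mono z : DX z -> double_of (@dsym VD) z.
Proof.
elim=> {z} [z [xi [x [ixi dx ->]]]||z1 z2 _ IH1 _ IH2].
- by apply: zspan_gen; exists xi, x; split=> //; exact: inv_dual_dsym.
- exact: zspan0.
- exact: zspanB.
Qed.

End Generators.

(** * The generators lie in the image *)

Section Image.
Variable X : superalgebra.
Local Notation V := (sspace X).
Local Notation VD := (dualsp V).
Local Notation VT := (sspace (trivext X)).
Local Notation DX := (double_of (@inv_dual X)).

Definition image (t : tens int VT) : Prop := exists2 z, DX z & phiQ z = ofZ t.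

Lemma inv_dual_integral (y : tens rat VD) : integral (of_tens y) -> inv_dual y.
Proof. by move=> iy; apply/inv_dualP; exists (of_tens y). Qed.

Lemma phiQ_iX (s : T rat V) : sinv s -> integral s ->
  exists2 z, DX z & phiQ z = iX s.
Proof.
move=> ss is_; exists (tprod (to_tens s) 1).
  apply: double_tprod => //; apply: inv_dual_integral => w.
  by rewrite of_tens1 -mon0 cf_mon; case: eqP.
rewrite phiQ_tprod to_tensK of_tens1 /Phi /iD lmap1 mulr1 sym_nrm //.
exact: (sinv_lmap (@spar_il X)).
Qed.

Lemma sinv_tvec (W : superspace) (v : {ffun W -> int}) : sinv (ofZ (tvec v)).
Proof. by rewrite -sym_tvec; exact: sinv_sym. Qed.

Lemma image_even s : Defs.inv s -> image (in_even s).
Proof.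
move=> /inv_ofZ ss; pose f (i : evensp V) : V := val i.
have pf i : spar (f i) = spar i by exact: negbTE (valP i).
have [] := @phiQ_iX (lmap f (ofZ s)).
- exact: (sinv_lmap pf).
- by apply: integral_lmap; exact: integral_ofZ.
move=> z dz e; exists z => //; rewrite e /in_even ofZ_tmap; move: (ofZ s).
apply: tens_eq => [||w]; [|exact: lin_lmap|].
  by apply: (lin_app (@lin_iX X)); exact: lin_lmap.
by rewrite /iX !lmap_mon -map_comp.
Qed.

Lemma iX_shf (s t : T rat V) : sinv s -> sinv t -> iX (shf s t) = shf (iX s) (iX t).
Proof.
move=> ss st; have sX x : sinv x -> sinv (@iX rat X x) by exact: (sinv_lmap (@spar_il X)).
rewrite (shf_sinv ss st) (shf_sinv (sX _ ss) (sX _ st)).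
by rewrite /iX (lmap_sym (@spar_il X)) lmapM /nrm !lmap_degscale.
Qed.

Lemma shf_evenC (s t : T rat VT) : sinv s -> sinv t -> J true t = t ->
  shf s t = shf t s.
Proof.
move=> ss st jt; rewrite (shf_sinv ss st) (shf_sinv st ss); apply: sym_evenC.
by rewrite /nrm -degscale_J jt.
Qed.

(** The two components of t give two elements of the double: one with trivial second
    factor, one with a power of 1 as first factor. *)
Lemma image_shuffle (t : trivext X) d :
  image (shuffle (tvec (scoord t)) (tvec (scoord (trivext_in (1 : X))) ^+ d)).
Proof.
pose o : T rat V := unitv X ^+ d; pose a := ofZ (tvec (scoord t.1)).
pose al : T rat VD := ofZ (@tvec int VD t.2).
have so : sinv o by apply: sinv_tvecX; exact: unitv_even.
have io : integral o by rewrite /o /unitv -ofZX; exact: integral_ofZ.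
have sa : sinv a by exact: sinv_tvec.
have sXo : sinv (iX o) by exact: (sinv_lmap (@spar_il X)).
have sXa : sinv (iX a) by exact: (sinv_lmap (@spar_il X)).
have sal : sinv (iD al) by apply: (sinv_lmap (@spar_ir X)); exact: sinv_tvec.
have Jo (b : bool) : J b o = o.
  by rewrite /o; elim: d {o so io sXo} => [|n IH]; rewrite ?expr0 ?J1 // !exprS JM J_one IH.
have sao : sinv (shf a o) by rewrite shf_sinv //; exact: sinv_sym.
have iao : integral (shf a o) by apply: integral_shf => //; exact: integral_ofZ.
have [z1 dz1 e1] := phiQ_iX sao iao.
pose z2 := tprod (to_tens o) (to_tens al).
have dz2 : DX z2.
  by apply: double_tprod => //; apply: inv_dual_integral; rewrite to_tensK; exact: integral_ofZ.
exists (z1 + z2).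
  by apply: (closedD (@zspan0 _ _) (@zspanB _ _)).
rewrite (islinD (@lin_phiQ X)) e1 phiQ_tprod !to_tensK ofZ_shuffle ofZX.
rewrite -[trivext_in 1]/(1 : trivext X) -/(unitv (trivext X)) unitv_trivext.
rewrite ofZ_tvec_trivext /iX -lmapX -/(iX _) -/(iX _) -/o -/a -/al.
rewrite (islinD (@lin_shfl _ _ _)); congr (_ + _); first exact: iX_shf.
have Jo' : J true (iX o) = iX o by rewrite /iX -(lmap_J (@spar_il X)) Jo.
rewrite (shf_evenC sal sXo Jo') (Phi_shf al so).
by have -> : sym al = al by exact: sym_tvec.
Qed.

Lemma zalg_image t : zalg (@tmul int (trivext X)) (@double_gen X) t -> image t.
Proof.
elim=> {t} [x [s is_|t d]||s t _ [z dz e] _ [z' dz' e']|s t _ [z dz e] _ [z' dz' e']].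
- exact: image_even.
- exact: image_shuffle.
- by exists 0; [exact: zspan0|rewrite (islin0 (@lin_phiQ X)) ofZ0].
- by exists (z - z'); [exact: zspanB|rewrite (islinB (@lin_phiQ X)) ofZB e e'].
- exists (dmul z z'); first exact: (double_dmul (good_inv_dual X)).
  by rewrite (phiQ_mul dz dz') e e' ofZ_tmul.
Qed.

Lemma imageP (y : tens int VT) :
  (exists2 z, DX z & phi z = y) <-> zalg (@tmul int (trivext X)) (@double_gen X) y.
Proof.
split=> [[z dz <-]|/zalg_image [z dz e]].
  have [t gt e] := generated_phiQ dz.
  by rewrite (_ : phi z = t) //; apply: (phiE (double_of_mono dz)).
by exists z => //; apply: (phiE (double_of_mono dz)).
Qed.
End Image.

Theorem theorem1 (X : superalgebra) :
  exists (kappa : tens rat (dualsp (sspace X)) -> tens int (dualsp (sspace X)))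
         (phi : dturner_double X -> inv_ring (trivext X)),
    [/\ is_kappa kappa,
        is_phi kappa phi,
        superring_iso phi &
        forall y : inv_ring (trivext X),
          (exists2 z : turner_double X, rmem _ z & phi z = y) <->
          zalg (rmul (inv_ring (trivext X))) (@double_gen X) y].
Proof.
exists (@kappaZ (dualsp (sspace X))), (@phi X); split.
- exact: kappaZ_is_kappa.
- exact: (@phi_tprod X).
- exact: phi_iso.
- exact: (@imageP X).
Qed.
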